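(* Let $\pi$ be the closure ordinal of $\mathcal{I}$, i.e. the least ordinal with no code computable in $\mathcal{I}$. If $\alpha<\pi$, then there is a reflecting ordinal $\gamma$ with $\alpha<\gamma<\pi$.
   Context: Non-monotone induction. Let $C=\{0,1\}^{\mathbb{N}}$ with the pointwise order. For a possibly partial $F:C\to C$ (each $F(f)$ is an element of $C$ or undefined) define $f_0$ = constant $0$, $f_{\beta+1}=\max\{f_\beta,F(f_\beta)\}$, $f_\beta=\sup_{\gamma<\beta}f_\gamma$ for limit $\beta$, where for $\beta>0$, $f_\beta$ is defined iff $f_\gamma$ and $F(f_\gamma)$ are defined for all $\gamma<\beta$. $\mathcal{I}(F)$ is defined iff there is $\alpha$ with $f_{\alpha+1}$ defined and $f_\alpha=f_{\alpha+1}$; then, for the least such $\alpha$, $\mathcal{I}(F)=f_\alpha$. For possibly partial $G:\mathbb{N}^{\mathbb{N}}\to\mathbb{N}$ let $F_G(f)(n)=\min\{G(n^\frown f),1\}$ for $f\in C$, where $(n^\frown f)(0)=n$, $(n^\frown f)(k+1)=f(k)$; $F_G(f)$ is defined iff all $G(n^\frown f)$ are. Kleene computability. $\{e\}(\mathcal{I},\vec f,\vec a)=c$ ($\vec f$ from $\mathbb{N}^{\mathbb{N}}$, $\vec a$ from $\mathbb{N}$) is the least relation given by: S1: $e=\langle1\rangle$, value $a_1+1$. S2: $e=\langle2,q\rangle$, value $q$. S3: $e=\langle3\rangle$, value $a_1$. S4: $e=\langle4,e_1,e_2\rangle$, value $\{e_1\}(\mathcal{I},\vec f,b,\vec a)$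 where $b=\{e_2\}(\mathcal{I},\vec f,\vec a)$. S6: permutation of the arguments in $\vec f$ and in $\vec a$. S7: $e=\langle7\rangle$, value $f_1(a_1)$. S8: $e=\langle8,3,d\rangle$, $\{e\}(\mathcal{I},\vec f,b,\vec a)=\mathcal{I}(F_G)(b)$ where $G(h)=\{d\}(\mathcal{I},h,\vec f,\vec a)$, provided $\mathcal{I}(F_G)$ is defined. S9: $e=\langle9\rangle$, $\{e\}(\mathcal{I},\vec f,d,\vec a)=\{d\}(\mathcal{I},\vec f,\vec a)$. A function $f\in\mathbb{N}^{\mathbb{N}}$ is computable in $\mathcal{I}$ if for some $e$, $f(a)=\{e\}(\mathcal{I},a)$ for all $a$. Countable ordinals are coded in a standard way by functions in $\mathbb{N}^{\mathbb{N}}$ coding well-orderings of subsets of $\mathbb{N}$. An ordinal $\gamma$ is reflecting if for all (first-order, set-theoretic) formulas $\Phi(x_1,\dots,x_n)$ and elements $X_1,\dots,X_n\in L_\gamma$: if $L_\gamma\models\Phi(X_1,\dots,X_n)$, then there is $\beta<\gamma$ (with $X_1,\dots,X_n\in L_\beta$) such that $L_\beta\models\Phi(X_1,\dots,X_n)$. Here $L_\gamma$ denotes the levels of the constructible hierarchy. *)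

(* Defs.v *)
From mathcomp Require Import all_boot.
From mathcomp Require Import boolp wochoice.

Set Implicit Arguments.
Unset Strict Implicit.
Unset Printing Implicit Defensive.

(** * Sets and ordinals *)

(* Aczel's cumulative hierarchy: [sup f] is the set {f a | a : A}.  Equality of
   sets is the bisimulation [eqV], not Leibniz equality. *)
Inductive V : Type := sup (A : Type) of (A -> V).

Definition idx (x : V) : Type := let: @sup A _ := x in A.

Definition elt (x : V) : idx x -> V :=
  match x return idx x -> V with sup _ f => f end.

Fixpoint eqV (x y : V) {struct x} : Prop :=
  match x, y with
  | sup A f, sup B g =>
      (forall a, exists b, eqV (f a) (g b)) /\
      (forall b, exists a, eqV (f a) (g b))
  end.

Definition memV (x y : V) : Prop := exists b : idx y, eqV x (elt b).

Definition bigcupV (A : Type) (f : A -> V) : V :=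
  sup (fun p : {a : A & idx (f a)} => elt (projT2 p)).

Definition succV (x : V) : V := sup (fun o : option (idx x) => oapp (@elt x) x o).

Definition transitiveV (x : V) : Prop :=
  forall y z, memV y x -> memV z y -> memV z x.

Definition is_ord (x : V) : Prop :=
  transitiveV x /\ forall y, memV y x -> transitiveV y.

Definition is_zero (x : V) : Prop := forall y, ~ memV y x.

Definition is_limit (x : V) : Prop :=
  [/\ is_ord x, exists y, memV y x & forall y, memV y x -> memV (succV y) x].

(** * First-order set theory and the constructible hierarchy *)

(* [form n] is the type of formulas with free variables among 'I_n; the
   quantifier binds variable [ord0]. *)
Inductive form : nat -> Type :=
| Fmem n of 'I_n & 'I_n : form n
| Feq n of 'I_n & 'I_n : form n
| Fnot n of form n : form n
| Fand n of form n & form n : form n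
| Fall n of form n.+1 : form n.

Definition env_cons n (x : V) (X : 'I_n -> V) (i : 'I_n.+1) : V :=
  oapp X x (unlift ord0 i).

Fixpoint sat (M : V) n (phi : form n) : ('I_n -> V) -> Prop :=
  match phi in form n return ('I_n -> V) -> Prop with
  | Fmem _ i j => fun X => memV (X i) (X j)
  | Feq _ i j => fun X => eqV (X i) (X j)
  | Fnot _ p => fun X => ~ sat M p X
  | Fand _ p q => fun X => sat M p X /\ sat M q X
  | Fall _ p => fun X => forall x, memV x M -> sat M p (env_cons x X)
  end.

(* The set of subsets of [M] first-order definable over [M] with parameters. *)
Definition defV (M : V) : V :=
  sup (fun t : {n : nat & (form n.+1 * ('I_n -> idx M))%type} =>
    let phi := (projT2 t).1 in
    let P := (projT2 t).2 in
    sup (fun b : {b : idx M | sat M phi (env_cons (elt b) (fun i => elt (P i)))} =>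
      elt (sval b))).

(* L_alpha is the union of the Def(L_beta) for beta < alpha. *)
Fixpoint L (x : V) : V :=
  match x with sup A f => bigcupV (fun a : A => defV (L (f a))) end.

Definition reflecting (gamma : V) : Prop :=
  is_ord gamma /\
  forall n (phi : form n) (X : 'I_n -> V),
    (forall i, memV (X i) (L gamma)) -> sat (L gamma) phi X ->
    exists beta, [/\ memV beta gamma, forall i, memV (X i) (L beta)
                   & sat (L beta) phi X].

(** * Non-monotone induction *)

Definition cantor : Type := nat -> bool.
Definition baire : Type := nat -> nat.

(* Partial functions are represented by their graphs throughout.  All
   operations on graphs below are written positively in the graph, so that
   they can be iterated inside the inductive definition of [kleene]. *)

(* [stage F beta f]: f_beta is defined and equal to f. *)
Inductive stage (F : cantor -> cantor -> Prop) : V -> cantor -> Prop :=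
| stage_zero beta :
    is_zero beta -> stage F beta (fun=> false)
| stage_succ beta beta' f g :
    eqV beta' (succV beta) -> stage F beta f -> F f g ->
    stage F beta' (fun n => f n || g n)
| stage_limit beta (f g : V -> cantor) :
    is_limit beta ->
    (forall gamma, memV gamma beta -> stage F gamma (f gamma)) ->
    (forall gamma, memV gamma beta -> F (f gamma) (g gamma)) ->
    stage F beta (fun n => `[< exists2 gamma, memV gamma beta & f gamma n >]).

(* [nmind F f]: I(F) is defined and equal to f.  Minimality of alpha says that
   f_beta and f_(beta+1), which are defined for beta < alpha, are distinct. *)
Definition nmind (F : cantor -> cantor -> Prop) (f : cantor) : Prop :=
  exists alpha,
    [/\ is_ord alpha, stage F alpha f, stage F (succV alpha) f
      & forall beta, memV beta alpha ->
          exists g h, [/\ stage F beta g, stage F (succV beta) h & g <> h]].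

Definition consB (n : nat) (f : cantor) : baire :=
  fun k => if k is k'.+1 then nat_of_bool (f k') else n.

Definition FG (G : baire -> nat -> Prop) (f g : cantor) : Prop :=
  forall n, exists2 m, G (consB n f) m & nat_of_bool (g n) = minn m 1.

(** * Kleene computability relative to I *)

Local Notation "<< x ; .. ; y >>" := (CodeSeq.code (cons x .. (cons y nil) ..)).

(* [kleene e fs a c]: {e}(I, fs, a) = c.  In S6, permutations of the index sets
   of [fs] and [a] are lists of indices, and their codes are part of e. *)
Inductive kleene : nat -> seq baire -> seq nat -> nat -> Prop :=
| S1 fs a1 a : kleene << 1 >> fs (a1 :: a) a1.+1
| S2 q fs a : kleene << 2; q >> fs a q
| S3 fs a1 a : kleene << 3 >> fs (a1 :: a) a1
| S4 e1 e2 fs a b c :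
    kleene e2 fs a b -> kleene e1 fs (b :: a) c ->
    kleene << 4; e1; e2 >> fs a c
| S6 d (s t : seq nat) fs a c :
    perm_eq s (iota 0 (size fs)) -> perm_eq t (iota 0 (size a)) ->
    kleene d [seq nth (fun=> 0) fs i | i <- s] [seq nth 0 a i | i <- t] c ->
    kleene << 6; d; CodeSeq.code s; CodeSeq.code t >> fs a c
| S7 f1 fs a1 a : kleene << 7 >> (f1 :: fs) (a1 :: a) (f1 a1)
| S8 d fs b a g :
    nmind (FG (fun h => kleene d (h :: fs) a)) g ->
    kleene << 8; 3; d >> fs (b :: a) (g b)
| S9 d fs a c : kleene d fs a c -> kleene << 9 >> fs (d :: a) c.

Definition computable (f : baire) : Prop :=
  exists e, forall a, kleene e [::] [:: a] (f a).

(** * Codes of countable ordinals *)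

(* f codes the relation x <= y iff f(<x, y>) = 1; the reflexive order is used
   so that its field, possibly a singleton, can be recovered from f. *)
Definition code_le (f : baire) : rel nat := fun x y => f << x; y >> == 1.

Definition code_dom (f : baire) : pred nat := fun x => code_le f x x.

Definition codes_wo (f : baire) : Prop :=
  (forall x y, code_le f x y -> code_dom f x && code_dom f y) /\
  wo_chain (code_le f) (code_dom f).

Definition codes (f : baire) (alpha : V) : Prop :=
  [/\ is_ord alpha, codes_wo f
    & exists rk : nat -> V,
      [/\ forall x, code_dom f x -> memV (rk x) alpha,
          forall beta, memV beta alpha -> exists2 x, code_dom f x & eqV (rk x) beta
        & forall x y, code_dom f x -> code_dom f y ->
            code_le f x y <-> memV (rk x) (rk y) \/ eqV (rk x) (rk y)]].

Definition has_computable_code (alpha : V) : Prop :=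
  exists2 f, computable f & codes f alpha.

(* pi is the least ordinal with no code computable in I. *)
Definition closure_ordinal (pi : V) : Prop :=
  [/\ is_ord pi, ~ has_computable_code pi
    & forall beta, is_ord beta -> ~ has_computable_code beta ->
        eqV pi beta \/ memV pi beta].

(* Main.v *)
(* Let a be a computable code of alpha.  A non-monotone induction F, computable
   in I, adds one element of a well-ordering per stage: first the elements of
   the coded ordinal, then its successor, and then, at the stage that codes
   delta, the least pair (phi, e) not used so far such that L_delta satisfies
   phi at the sets named by e; the truth predicate of L_delta is recorded
   together with the new element.  The induction stops at an ordinal gamma > alpha
   at which every pair that is true in L_gamma has been used, i.e. was true in
   L_delta for some delta < gamma; so gamma is reflecting.  Its order is computable,
   and so are its initial segments, so gamma < pi.

   The calculus has no case distinction and never drops an argument.  Relations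
   are bootstrapped from I itself: comparison, pairing and recursion
   along well-founded relations are non-monotone inductions.  Unused arguments are
   permuted to the end, with indices that depend only on the arities.
   The index of alpha's code is arbitrary, so it cannot be given additional
   arguments; instead a table of programs, closed under a recursion theorem for
   arity-dependent indices, simulates every computation in the presence of
   further arguments. *)

Require Import Defs.
From mathcomp Require Import all_boot.
From mathcomp Require Import boolp wochoice zify.

Set Implicit Arguments.
Unset Strict Implicit.
Unset Printing Implicit Defensive.

(** * Ordinals *)

(** [I] returns only bits, and no clause of the calculus returns the number that a decidable
    relation determines. Hence [crel], a decidable relation, is the basic notion; functions enter
    through their graphs [gr]; and an index that has to be computed before S9 can run it is guessed
    instead, by the number at which a non-monotone induction is evaluated.

    S8 is partial: the body must have a value at every function met in the induction. Contexts deal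
    with this. A context is a type of admissible points, possibly a subtype, and a program has to
    work at these points only.

    Truth in L_delta must be obtained from a stage in a single step. This is possible because a
    stage keeps the truth predicates of all earlier levels: equality and membership of named sets
    reduce to recorded truth at lower levels, and only a recursion on formulas is left. *)

Lemma eqV_refl x : eqV x x.
Proof. by elim: x => A f IH /=; split=> a; exists a. Qed.

Lemma eqV_sym x y : eqV x y -> eqV y x.
Proof.
elim: x y => A f IH [B g] /= [h1 h2]; split=> [b|a].
  by have [a /IH] := h2 b; exists a.
by have [b /IH] := h1 a; exists b.
Qed.

Lemma eqV_trans x y z : eqV x y -> eqV y z -> eqV x z.
Proof.
elim: x y z => A f IH [B g] [C h] /= [h1 h2] [h3 h4]; split=> [a|c].
  by have [b ab] := h1 a; have [c bc] := h3 b; exists c; apply: IH ab bc.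
by have [b bc] := h4 c; have [a ab] := h2 b; exists a; apply: IH ab bc.
Qed.

Lemma memV_eqL x y z : eqV x y -> memV y z -> memV x z.
Proof. by move=> xy [b yb]; exists b; apply: eqV_trans xy yb. Qed.

Lemma memV_eqR x y z : memV x y -> eqV y z -> memV x z.
Proof.
case: y z => [B g] [C h] [/= b xb] [/= h1 _].
by have [c bc] := h1 b; exists c; apply: eqV_trans xb bc.
Qed.

Lemma mem_elt x (b : idx x) : memV (elt b) x.
Proof. by exists b; apply: eqV_refl. Qed.

Lemma eqV_ext x y : (forall z, memV z x <-> memV z y) -> eqV x y.
Proof.
case: x y => [A f] [B g] h /=; split=> [a|b].
  by have /h[b] := mem_elt (x := sup f) a; exists b.
have /h[a] := mem_elt (x := sup g) b; exists a; exact: eqV_sym.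
Qed.

Lemma memV_ind (P : V -> Prop) :
  (forall x, (forall y, memV y x -> P y) -> P x) -> forall x, P x.
Proof.
move=> h x; suff: forall y, eqV y x -> P y by apply; apply: eqV_refl.
elim: x => A f IH y yx; apply: h => z zy.
by have [a za] := memV_eqR zy yx; apply: IH za.
Qed.

Lemma memV_succ z x : memV z (succV x) <-> memV z x \/ eqV z x.
Proof.
split=> [[[b|] /= zb]|[[b zb]|zx]]; first by left; exists b.
- by right.
- by exists (Some b).
- by exists None.
Qed.

Lemma memV_bigcup z (A : Type) (f : A -> V) :
  memV z (bigcupV f) <-> exists a, memV z (f a).
Proof.
split=> [[[a b] /= zb]|[a [b zb]]]; first by exists a, b.
by exists (existT _ a b).
Qed.

Lemma memV_irr x : ~ memV x x.
Proof.
by elim/memV_ind: x => x IH xx; apply: (IH _ xx xx).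
Qed.

Lemma is_ord_eq x y : eqV x y -> is_ord x -> is_ord y.
Proof.
move=> xy [tx hx]; split=> [z t zy tz|z zy]; last first.
  by apply: hx; apply: memV_eqR zy (eqV_sym xy).
by apply: memV_eqR (tx _ _ (memV_eqR zy (eqV_sym xy)) tz) xy.
Qed.

Lemma is_ord_mem x y : is_ord x -> memV y x -> is_ord y.
Proof.
move=> [tx hx] yx; split=> [|z zy]; first exact: hx.
by apply: hx; apply: tx zy.
Qed.

Lemma ord_trans x y z : is_ord x -> memV y x -> memV z y -> memV z x.
Proof. by case=> tx _; apply: tx. Qed.

Lemma ord_asym x y : is_ord x -> memV y x -> memV x y -> False.
Proof. by move=> ox yx xy; apply: (@memV_irr x); apply: ord_trans xy. Qed.

Lemma is_ord_succ x : is_ord x -> is_ord (succV x).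
Proof.
move=> ox; split=> [y z /memV_succ[yx|yx] zy|y /memV_succ[yx|yx]].
- by apply/memV_succ; left; apply: ord_trans yx zy.
- by apply/memV_succ; left; apply: memV_eqR zy yx.
- by case: (is_ord_mem ox yx).
- by case: (is_ord_eq (eqV_sym yx) ox).
Qed.

Lemma is_ord_bigcup (A : Type) (f : A -> V) :
  (forall a, is_ord (f a)) -> is_ord (bigcupV f).
Proof.
move=> of_; split=> [y z /memV_bigcup[a ya] zy|y /memV_bigcup[a ya]].
  by apply/memV_bigcup; exists a; apply: ord_trans ya zy.
by case: (is_ord_mem (of_ a) ya).
Qed.

Lemma ord_trichotomy x y :
  is_ord x -> is_ord y -> [\/ memV x y, eqV x y | memV y x].
Proof.
elim/memV_ind: x y => x IHx; elim/memV_ind => y IHy ox oy.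
case: (pselect (memV x y)) => [|nxy]; first by constructor 1.
case: (pselect (memV y x)) => [|nyx]; first by constructor 3.
constructor 2; apply: eqV_ext => z; split=> [zx|zy].
  case: (IHx z zx y (is_ord_mem ox zx) oy) => // [zy|yz].
    by case: nyx; apply: memV_eqL zx; apply: eqV_sym.
  by case: nyx; apply: ord_trans zx yz.
case: (IHy z zy ox (is_ord_mem oy zy)) => // [xz|xz].
  by case: nxy; apply: ord_trans zy xz.
by case: nxy; apply: memV_eqL zy.
Qed.

Lemma ord_cases x : is_ord x ->
  [\/ is_zero x, exists2 y, memV y x & eqV x (succV y) | is_limit x].
Proof.
move=> ox; case: (pselect (exists y, memV y x)) => [nz|z]; last first.
  by constructor 1 => y yx; apply: z; exists y.
case: (pselect (forall y, memV y x -> memV (succV y) x)) => [lx|].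
  by constructor 3.
move=> /existsNP[y /not_implyP[yx nyx]]; constructor 2; exists y => //.
have oy := is_ord_mem ox yx.
case: (ord_trichotomy ox (is_ord_succ oy)) => // /memV_succ[xy|xy].
  by case: (ord_asym ox yx xy).
by case: (@memV_irr x); apply: memV_eqL yx.
Qed.

Lemma ord_least (P : V -> Prop) x : P x ->
  exists2 y, P y & forall z, memV z y -> ~ P z.
Proof.
elim/memV_ind: x => x IH Px.
case: (pselect (exists2 z, memV z x & P z)) => [[z zx Pz]|nz]; first exact: IH zx Pz.
by exists x => // z zx Pz; apply: nz; exists z.
Qed.

(** * Non-monotone induction for total operators *)

Definition op := (nat -> Prop) -> nat -> Prop.

(** The two disjuncts treat successors and limits by one clause, so that invariants of stages follow
    from [stg_ind] without case distinction. *)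
Fixpoint stg (H : op) (x : V) : nat -> Prop :=
  match x with
  | sup A f => fun n => exists a, stg H (f a) n \/ H (stg H (f a)) n
  end.

Lemma stg_ind (H : op) (P : (nat -> Prop) -> Prop) :
  (forall (A : Type) (X : A -> nat -> Prop), (forall a, P (X a)) ->
     P (fun n => exists a, X a n)) ->
  (forall X, P X -> P (fun n => X n \/ H X n)) ->
  forall x, P (stg H x).
Proof. by move=> hU hS; elim=> A f IH /=; apply: hU => a; apply: hS. Qed.

Lemma stg_eq H x y : eqV x y -> stg H x = stg H y.
Proof.
elim: x y => A f IH [B g] /= [h1 h2]; apply: funext => n; apply: propext; split.
  by case=> a; have [b /IH ->] := h1 a; exists b.
by case=> b; have [a /IH <-] := h2 b; exists a.
Qed.

Lemma stg_mem H x n :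
  stg H x n <-> exists2 y, memV y x & stg H y n \/ H (stg H y) n.
Proof.
case: x => A f /=; split=> [[a h]|[y [/= a ya] h]].
  by exists (f a) => //; exact: (mem_elt (x := sup f)).
by exists a; rewrite -(stg_eq H ya).
Qed.

Lemma stg_ord H x n :
  is_ord x -> stg H x n <-> exists2 y, memV y x & H (stg H y) n.
Proof.
elim/memV_ind: x => x IH ox; rewrite stg_mem; split=> [[y yx [|hy]]|[y yx hy]].
- case/(IH _ yx (is_ord_mem ox yx)) => z zy hz; exists z => //.
  exact: ord_trans yx zy.
- by exists y.
- by exists y => //; right.
Qed.

Definition closing (H : op) (x : V) : Prop :=
  is_ord x /\ forall n, H (stg H x) n -> stg H x n.

(** Only countably many numbers can enter. If no stage were closing, let [b n] be a stage at which n
    is new, if there is one, and let t lie above all [b n]. Some n is new at t, but it entered right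
    after [b n]. *)
Lemma closing_exists H : exists x, closing H x.
Proof.
apply: contrapT => /forallNP nocl.
pose Q n x := is_ord x /\ H (stg H x) n /\ ~ stg H x n.
have zero_ord : is_ord (sup (fun v : void => match v with end)).
  by split=> [y z []|y []].
pose b n := if pselect (exists x, Q n x) is left e then projT1 (cid e)
            else sup (fun v : void => match v with end).
have ob n : is_ord (b n).
  by rewrite /b; case: pselect => // e; case: cid => x [].
pose t := bigcupV (fun n => succV (b n)).
have ot : is_ord t by apply: is_ord_bigcup => n; apply: is_ord_succ.
have [n [hn nn]] : exists n, H (stg H t) n /\ ~ stg H t n.
  apply: contrapT => nh; apply: (nocl t); split=> // n hn.
  by apply: contrapT => nn; apply: nh; exists n.
have : Q n (b n).
  rewrite /b; case: pselect => [e|[]]; first by case: cid.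
  by exists t.
move=> [_ [hb nb]]; apply: nn; apply/stg_mem; exists (b n); last by right.
by apply/memV_bigcup; exists n; apply/memV_succ; right; apply: eqV_refl.
Qed.

Lemma least_closing H :
  exists x, closing H x /\ forall y, memV y x -> ~ closing H y.
Proof.
have [x cx] := closing_exists H.
by have [y cy hy] := ord_least cx; exists y.
Qed.

Definition clord (H : op) : V := projT1 (cid (least_closing H)).

Definition Ifix (H : op) : nat -> Prop := stg H (clord H).

Lemma clord_ord H : is_ord (clord H).
Proof. by rewrite /clord; case: cid => x [[]]. Qed.

Lemma Ifix_closed H n : H (Ifix H) n -> Ifix H n.
Proof. by rewrite /Ifix /clord; case: cid => x [[_ h] _] /=; apply: h. Qed.

Lemma clord_least H y : memV y (clord H) ->
  exists n, H (stg H y) n /\ ~ stg H y n.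
Proof.
have := clord_ord H.
rewrite /clord; case: cid => x [_ h] /= ox yx; apply: contrapT => nh; apply: (h _ yx).
split; first exact: is_ord_mem yx.
by move=> n hn; apply: contrapT => nn; apply: nh; exists n.
Qed.

Lemma Ifix_ind (H : op) (P : (nat -> Prop) -> Prop) :
  (forall (A : Type) (X : A -> nat -> Prop), (forall a, P (X a)) ->
     P (fun n => exists a, X a n)) ->
  (forall X, P X -> P (fun n => X n \/ H X n)) ->
  P (Ifix H).
Proof. by move=> hU hS; apply: stg_ind. Qed.

(** Every stage is some [g k] with k <= K, since a union of such sets is the largest of them. The
    final one is closed, so the sequence is constant from there on and its value is [g K]. This
    evaluates finite inductions without mentioning ordinals. *)
Lemma finite_run (H : op) (g : nat -> nat -> Prop) K :
  (forall n, ~ g 0 n) ->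
  (forall k, k < K -> forall n, g k.+1 n <-> g k n \/ H (g k) n) ->
  (forall n, H (g K) n -> g K n) ->
  Ifix H = g K.
Proof.
move=> g0 gS gK.
have gm j k n : j <= k -> k <= K -> g j n -> g k n.
  elim: k => [|k IH]; first by rewrite leqn0 => /eqP->.
  rewrite leq_eqVlt => /orP[/eqP-> //|jk kK gj].
  by apply/gS => //; left; apply: IH => //; apply: ltnW.
have [k kK ek] : exists2 k, k <= K & Ifix H = g k.
  apply: (@Ifix_ind H (fun X => exists2 k, k <= K & X = g k)) => [A X hX|X [k kK ->]].
    case: (pselect (exists k, (exists a, k <= K /\ X a = g k))) => [e|ne]; last first.
      exists 0 => //; apply: funext => n; apply: propext.
      split=> [[a]|/g0//]; case: ne; have [k kK e] := hX a; by exists k, a.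
    have e' : exists k, `[<exists a, k <= K /\ X a = g k>].
      by have [k h] := e; exists k; apply/asboolP.
    have ub k : `[<exists a, k <= K /\ X a = g k>] -> k <= K.
      by move=> /asboolP[a []].
    case: (ex_maxnP e' ub) => k /asboolP[a [kK Xa]] kmax; exists k => //.
    apply: funext => n; apply: propext; split=> [[a']|gk]; last by exists a; rewrite Xa.
    have [k' k'K e''] := hX a'; rewrite e''; apply: gm => //.
    by apply: kmax; apply/asboolP; exists a'.
  case: (ltnP k K) => [ltkK|geKk].
    by exists k.+1 => //; apply: funext => n; apply: propext; rewrite gS.
  have -> : k = K by apply/eqP; rewrite eqn_leq kK.
  exists K => //; apply: funext => n; apply: propext; split=> [[//|/gK//]|]; by left.
rewrite ek; apply: funext => n; apply: propext.
have closed : forall n, H (g k) n -> g k n by rewrite -ek; apply: Ifix_closed.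
have stay j : j <= K -> k <= j -> forall n, g j n -> g k n.
  elim: j => [|j IH] jK kj m; first by move/g0.
  move: kj; rewrite leq_eqVlt => /orP[/eqP-> //|kj].
  have ejk : g j = g k.
    apply: funext => p; apply: propext; split; first by apply: IH => //; apply: ltnW.
    by apply: gm => //; apply: ltnW.
  by move/(gS _ jK); rewrite ejk => -[//|/closed].
by split; [apply: gm | apply: stay].
Qed.

Definition bset (X : nat -> Prop) : cantor := fun n => `[< X n >].

Lemma stage_stg (F : cantor -> cantor -> Prop) (H : op) x :
  (forall y, memV y x -> F (bset (stg H y)) (bset (H (stg H y)))) ->
  is_ord x -> stage F x (bset (stg H x)).
Proof.
elim/memV_ind: x => x IH hF ox.
have IH' y : memV y x -> stage F y (bset (stg H y)).
  move=> yx; apply: IH => //; last exact: is_ord_mem yx.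
  by move=> z zy; apply: hF; apply: ord_trans zy.
case: (ord_cases ox) => [zx|[y yx xy]|lx].
- rewrite (_ : bset _ = fun=> false); first exact: stage_zero.
  by apply: funext => n; apply/asboolP => /stg_mem[y /zx].
- rewrite (_ : bset _ = fun n => bset (stg H y) n || bset (H (stg H y)) n).
    by apply: stage_succ xy _ _; [apply: IH' | apply: hF].
  apply: funext => n; rewrite /bset -asbool_or; congr asbool; apply: propext.
  have oy := is_ord_mem ox yx.
  rewrite (stg_eq H xy) stg_mem; split=> [[z /memV_succ[zy|zy] h]|h].
  + by left; apply/stg_mem; exists z.
  + by rewrite -(stg_eq H zy).
  + by exists y => //; apply/memV_succ; right; apply: eqV_refl.
- rewrite (_ : bset _ = fun n => `[< exists2 y, memV y x & bset (stg H y) n >]).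
    exact: (stage_limit (f := fun y => bset (stg H y)) (g := fun y => bset (H (stg H y)))).
  apply: funext => n; congr asbool; apply: propext; rewrite stg_mem.
  split=> [[y yx h]|[y yx /asboolP h]]; last by exists y => //; left.
  case: lx => _ _ /(_ y yx) syx; exists (succV y) => //; apply/asboolP/stg_mem.
  by exists y => //; apply/memV_succ; right; apply: eqV_refl.
Qed.

(** F has to be given at the stages of H only; elsewhere it may be undefined. *)
Lemma nmind_Ifix (F : cantor -> cantor -> Prop) (H : op) :
  (forall y, F (bset (stg H y)) (bset (H (stg H y)))) ->
  nmind F (bset (Ifix H)).
Proof.
move=> hF; exists (clord H); have oc := clord_ord H.
have e : bset (stg H (succV (clord H))) = bset (Ifix H).
  apply: funext => n; congr asbool; apply: propext; rewrite stg_mem.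
  split=> [[y /memV_succ[yc|yc] h]|h]; first by apply/stg_mem; exists y.
    by move: h; rewrite (stg_eq H yc) => -[//|/Ifix_closed].
  by exists (clord H); [apply/memV_succ; right; apply: eqV_refl | left].
split=> //; first exact: stage_stg.
  by rewrite -e; apply: stage_stg => //; apply: is_ord_succ.
move=> y yc; have oy := is_ord_mem oc yc.
exists (bset (stg H y)), (bset (stg H (succV y))); split; first exact: stage_stg.
  by apply: stage_stg => //; apply: is_ord_succ.
have [n [hn nn]] := clord_least yc.
move=> eqs; apply: nn; apply/asboolP; rewrite -/(bset (stg H y) n) eqs.
apply/asboolP/stg_mem.
by exists y; [apply/memV_succ; right; apply: eqV_refl | right].
Qed.

(** * Indices that are uniform in the arities *)

Notation code := CodeSeq.code.
Notation decode := CodeSeq.decode.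
Arguments CodeSeq.code : simpl never.
Arguments CodeSeq.decode : simpl never.

Definition cns (x s : nat) : nat := 2 ^ x * s.*2.+1.

Lemma code_cons x s : code (x :: s) = cns x (code s).
Proof. by []. Qed.

Lemma decode_cns x s : decode (cns x s) = x :: decode s.
Proof. by rewrite -{1}(CodeSeq.decodeK s) -code_cons CodeSeq.codeK. Qed.

Lemma cns_inj x s y t : cns x s = cns y t -> x = y /\ s = t.
Proof.
by move=> /(congr1 decode); rewrite !decode_cns => -[-> /(can_inj CodeSeq.decodeK)->].
Qed.

Lemma ltn_cns2 x s : s < cns x s.
Proof.
rewrite /cns; apply: (@leq_trans (1 * s.*2.+1)); first by rewrite mul1n; lia.
by rewrite leq_mul2r expn_gt0.
Qed.

Lemma ltn_cns1 x s : x < cns x s.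
Proof. by rewrite /cns; apply: leq_trans (leq_pmulr _ _) => //; apply: ltn_expl. Qed.

Lemma cns_gt0 x s : 0 < cns x s.
Proof. exact: leq_ltn_trans (leq0n _) (ltn_cns1 x s). Qed.

(* [perml 0 n] lists the identity of n; [perml i.+1 n] moves the entry with
   index i to the end. *)
Definition perml (i n : nat) : seq nat :=
  if i is i'.+1 then iota 0 i' ++ iota i (n - i) ++ [:: i'] else iota 0 n.

Definition permute (T : Type) (i : nat) (s : seq T) : seq T :=
  if i is i'.+1 then take i' s ++ drop i s ++ take 1 (drop i' s) else s.

Lemma perml_perm i n : i <= n -> perm_eq (perml i n) (iota 0 n).
Proof.
case: i => [//|i] ltin; rewrite /perml -{2}(subnKC ltin) -addn1 -addnA iotaD add0n.
by rewrite perm_cat2l iotaD addn1 perm_catC.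
Qed.

Lemma perml_nth (T : Type) (d : T) i (s : seq T) :
  i <= size s -> [seq nth d s j | j <- perml i (size s)] = permute i s.
Proof.
have iotaE j k : j + k <= size s ->
    [seq nth d s m | m <- iota j k] = take k (drop j s).
  move=> jk; apply: (@eq_from_nth _ d) => [|m].
    by rewrite size_map size_iota size_takel // size_drop; lia.
  rewrite size_map size_iota => mk.
  by rewrite (nth_map 0) ?size_iota // nth_iota // nth_take // nth_drop.
case: i => [_|i lti]; rewrite /= ?map_cat iotaE ?drop0 ?take_size //; last by lia.
rewrite iotaE ?subnKC // -(size_drop i.+1) take_size.
by rewrite (_ : [seq _ | j <- [:: i]] = [seq nth d s m | m <- iota i 1]) // iotaE // addn1.
Qed.

(** Indices as functions of the numbers l and m of function and number arguments. S6 indices contain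
    permutations of the full lists, so their arity cannot be left open in a single number. [PShL]
    and [PShM] account for the argument added by S8 and by S4. *)
Inductive pr : Type :=
| PC of nat | PL | PM | PpL of nat | PpM of nat
| PCns of pr & pr | PShL of pr | PShM of pr.

Fixpoint ev (p : pr) (l m : nat) : nat :=
  match p with
  | PC c => c
  | PL => l
  | PM => m
  | PpL i => code (perml i l)
  | PpM i => code (perml i m)
  | PCns p q => cns (ev p l m) (ev q l m)
  | PShL p => ev p l.+1 m
  | PShM p => ev p l m.+1
  end.

Definition PList (s : seq pr) : pr := foldr PCns (PC 0) s.

Lemma ev_PList s l m : ev (PList s) l m = code [seq ev p l m | p <- s].
Proof. by elim: s => //= p s ->. Qed.

(** * Computability in a context *)

(** A point may carry more than its arguments, and [pt] may be a subtype; this is how side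
    conditions on the inputs of a program are expressed. *)
Record ctx := Ctx { pt :> Type; fa : pt -> seq baire; na : pt -> seq nat }.
Arguments fa : clear implicits.
Arguments na : clear implicits.
Arguments fa {c} _.
Arguments na {c} _.

Definition xn (G : ctx) : ctx :=
  @Ctx (G * nat)%type (fun g => fa g.1) (fun g => g.2 :: na g.1).
Definition xf (G : ctx) : ctx :=
  @Ctx (G * baire)%type (fun g => g.2 :: fa g.1) (fun g => na g.1).

(* The trailing arguments fs' and a' are arbitrary, and the index depends on
   the arguments only through their numbers l and m, on which the value may
   depend. *)
Definition rcomp (G : ctx) (t : nat -> nat -> G -> nat) : Prop :=
  exists p, forall g fs a (l := size (fa g ++ fs)) (m := size (na g ++ a)),
    kleene (ev p l m) (fa g ++ fs) (na g ++ a) (t l m g).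

Definition comp (G : ctx) (t : G -> nat) : Prop := rcomp (fun _ _ => t).

Lemma rcomp_cst (G : ctx) p : @rcomp G (fun l m _ => ev p l m).
Proof. by exists (PList [:: PC 2; p]) => g fs a l m; rewrite ev_PList; apply: S2. Qed.

Lemma rcomp_var (G : ctx) : @rcomp (xn G) (fun _ _ g => g.2).
Proof. by exists (PList [:: PC 3]) => g fs a l m; rewrite ev_PList; apply: S3. Qed.

Lemma rcomp_let (G : ctx) (t : nat -> nat -> G -> nat) (u : nat -> nat -> xn G -> nat) :
  rcomp t -> rcomp u -> rcomp (fun l m g => u l m.+1 (g, t l m g)).
Proof.
move=> [p hp] [q hq]; exists (PList [:: PC 4; PShM q; p]) => g fs a l m.
by rewrite ev_PList; apply: S4 (hp _ _ _) (hq (g, _) _ _).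
Qed.

Lemma rcomp_hd (G : ctx) (hd : G -> baire) (tl : G -> seq baire)
    (t : nat -> nat -> G -> nat) : (forall g, fa g = hd g :: tl g) ->
  rcomp t -> rcomp (fun l m g => hd g (t l m g)).
Proof.
move=> e [p hp]; exists (PList [:: PC 4; PC (code [:: 7]); p]) => g fs a l m.
rewrite ev_PList; apply: S4 (hp _ _ _) _; rewrite {1}e /=; exact: S7.
Qed.

Lemma rcomp_succ (G : ctx) (t : nat -> nat -> G -> nat) :
  rcomp t -> rcomp (fun l m g => (t l m g).+1).
Proof.
move=> [p hp]; exists (PList [:: PC 4; PC (code [:: 1]); p]) => g fs a l m.
by rewrite ev_PList; apply: S4 (hp _ _ _) _; apply: S1.
Qed.

(** Weakening: the argument that [pi] forgets is moved to the end, where it counts as a trailing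
    one. With i = j = 0 only the type of points changes, for instance to a subtype. *)
Lemma rcomp_permute (G D : ctx) (pi : D -> G) i j (t : nat -> nat -> G -> nat) :
  (forall d fs, i <= size (fa d) /\
     exists fs', permute i (fa d ++ fs) = fa (pi d) ++ fs') ->
  (forall d a, j <= size (na d) /\
     exists a', permute j (na d ++ a) = na (pi d) ++ a') ->
  rcomp t -> rcomp (fun l m d => t l m (pi d)).
Proof.
move=> hf hn [p hp]; exists (PList [:: PC 6; p; PpL i; PpM j]) => d fs a l m.
rewrite ev_PList /=.
have [si [fs' ef]] := hf d fs; have [sj [a' ea]] := hn d a.
have li : i <= l by rewrite /l size_cat (leq_trans si) ?leq_addr.
have mj : j <= m by rewrite /m size_cat (leq_trans sj) ?leq_addr.
apply: (@S6 _ (perml i l) (perml j m)); [exact: perml_perm | exact: perml_perm | ].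
have sp (T : Type) k (s : seq T) : k <= size s -> size (permute k s) = size s.
  case: s => [|d0 s] ks; first by case: k ks.
  by rewrite -(perml_nth d0 ks) size_map (perm_size (perml_perm ks)) size_iota.
rewrite !perml_nth // ef ea /l /m -(sp _ _ _ li) -(sp _ _ _ mj) ef ea.
exact: hp.
Qed.

Lemma rcomp_wkn (G : ctx) (t : nat -> nat -> G -> nat) :
  rcomp t -> rcomp (G := xn G) (fun l m g => t l m g.1).
Proof.
apply: (@rcomp_permute _ (xn G) (fun g => g.1) 0 1) => d s; split=> //; first by exists s.
by rewrite /= take0 drop0; exists (s ++ [:: d.2]); rewrite catA.
Qed.

Lemma rcomp_wkf (G : ctx) (t : nat -> nat -> G -> nat) :
  rcomp t -> rcomp (G := xf G) (fun l m g => t l m g.1).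
Proof.
apply: (@rcomp_permute _ (xf G) (fun g => g.1) 1 0) => d s; split=> //; last by exists s.
by rewrite /= take0 drop0; exists (s ++ [:: d.2]); rewrite catA.
Qed.

Lemma rcomp_wknn (G : ctx) (t : nat -> nat -> xn G -> nat) :
  rcomp t -> rcomp (G := xn (xn G)) (fun l m g => t l m (g.1.1, g.2)).
Proof.
apply: (@rcomp_permute (xn G) (xn (xn G)) (fun g => (g.1.1, g.2)) 0 2) => d s; split=> //.
  by exists s.
by rewrite /= take0 drop0; exists (s ++ [:: d.1.2]); rewrite catA.
Qed.

Lemma rcomp_wkfn (G : ctx) (t : nat -> nat -> xn G -> nat) :
  rcomp t -> rcomp (G := xn (xf G)) (fun l m g => t l m (g.1.1, g.2)).
Proof.
apply: (@rcomp_permute (xn G) (xn (xf G)) (fun g => (g.1.1, g.2)) 1 0) => d s; split=> //.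
  by rewrite /= take0 drop0; exists (s ++ [:: d.1.2]); rewrite catA.
by exists s.
Qed.

(* These are transparent for the guard condition of [kleene_nested_ind]. *)
Definition stage_mono (F F' : cantor -> cantor -> Prop)
    (h : forall f g, F f g -> F' f g) : forall x f, stage F x f -> stage F' x f :=
  fix rec x f s {struct s} :=
    match s in stage _ x f return stage F' x f with
    | stage_zero x hx => stage_zero F' hx
    | stage_succ x x' f g e sf fg => stage_succ e (rec _ _ sf) (h _ _ fg)
    | stage_limit x f g lx sf hF =>
        stage_limit lx (fun y yx => rec _ _ (sf y yx)) (fun y yx => h _ _ (hF y yx))
    end.

Definition nmind_mono (F F' : cantor -> cantor -> Prop)
    (h : forall f g, F f g -> F' f g) f (s : nmind F f) : nmind F' f :=
  match s with
  | ex_intro x (And4 ox s1 s2 s3) =>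
    ex_intro _ x (And4 ox (stage_mono h s1) (stage_mono h s2) (fun y yx =>
      match s3 y yx with
      | ex_intro g (ex_intro k (And3 sg sk gk)) =>
        ex_intro _ g (ex_intro _ k (And3 (stage_mono h sg) (stage_mono h sk) gk))
      end))
  end.

(** D collects the points at which the body runs. It may be smaller than [xf G], provided that every
    function met in the induction comes from one of its points. *)
Lemma rcomp_S8 (G D : ctx) (pi : D -> G) (h : D -> baire)
    (t : nat -> nat -> D -> nat) (b : nat -> nat -> G -> nat)
    (f : nat -> nat -> G -> cantor) :
  (forall d, fa d = h d :: fa (pi d)) -> (forall d, na d = na (pi d)) ->
  rcomp t -> rcomp b ->
  (forall l m g, nmind (FG (fun x c =>
     exists d, [/\ pi d = g, h d = x & t l.+1 m d = c])) (f l m g)) ->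
  rcomp (fun l m g => f l m g (b l m g)).
Proof.
move=> ef en [p hp] [q hq] hf.
exists (PList [:: PC 4; PList [:: PC 8; PC 3; PShL p]; q]) => g fs a l m.
rewrite ev_PList /=; apply: S4 (hq _ _ _) _.
apply: (@S8 _ _ _ _ (f l m g)); apply: (nmind_mono _ (hf l m g)) => x y hxy n.
have [c [d [dg dh <-]] e] := hxy n; exists (t l.+1 m d) => //.
by have := hp d fs a; rewrite ef en dg dh.
Qed.

Lemma rcomp_Ifix (G D : ctx) (pi : D -> G) (h : D -> baire)
    (t : nat -> nat -> D -> nat) (b : nat -> nat -> G -> nat)
    (H : nat -> nat -> G -> op) :
  (forall d, fa d = h d :: fa (pi d)) -> (forall d, na d = na (pi d)) ->
  rcomp t -> rcomp b ->
  (forall l m g x n, exists d, [/\ pi d = g,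
      h d = consB n (bset (stg (H l m g) x)) &
      (0 < t l.+1 m d) = `[< H l m g (stg (H l m g) x) n >] ]) ->
  rcomp (fun l m g => `[< Ifix (H l m g) (b l m g) >]).
Proof.
move=> ef en ht hb hH.
apply: (rcomp_S8 (f := fun l m g => bset (Ifix (H l m g))) ef en ht hb) => l m g.
apply: nmind_Ifix => x n; have [d [dg dh dt]] := hH l m g x n.
exists (t l.+1 m d); first by exists d.
by rewrite /bset -dt; case: (t _ _ _) => //= k; rewrite minnSS minn0.
Qed.

(* The only case distinction of the calculus: an argument [x] of the function
   n^f selects n if x = 0, and a value of f otherwise. *)
Lemma comp_and0 (G : ctx) (b : G -> nat) :
  comp b -> comp (G := xn G) (fun g => (g.2 == 0) && (0 < b g.1)).
Proof.
move=> hb; pose H (l m : nat) (g : xn G) : op :=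
  fun X n => if g.2 is k.+1 then X k else 0 < n.
have ht : comp (G := xf (xn G)) (fun d => d.2 d.1.2).
  apply: (@rcomp_hd (xf (xn G)) snd (fun d => fa d.1) (fun _ _ d => d.1.2)) => //.
  exact: rcomp_wkf (rcomp_var _).
have h : rcomp (fun l m g => `[< Ifix (H l m g) (b g.1) >]).
  apply: (rcomp_Ifix (D := xf (xn G)) (pi := fst) (h := snd) _ _ ht) => //.
    exact: rcomp_wkn hb.
  move=> l m g x n; exists (g, consB n (bset (stg (H l m g) x))); split=> //=.
  rewrite /H /consB; case: (g.2) => [|k]; first by rewrite asboolb.
  by rewrite /bset; case: asbool.
have [p hp] := h; exists p => g fs a l m; rewrite (_ : nat_of_bool _ = `[< Ifix (H l m g) (b g.1) >]); first exact: hp.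
congr nat_of_bool; case e : (g.2) => [|k] /=.
  apply/idP/asboolP => [b0|]; first by apply: Ifix_closed; rewrite /H e.
  apply: (@Ifix_ind (H l m g) (fun X => X (b g.1) -> 0 < b g.1)) => //.
    by move=> A X hX [a0 /hX].
  by move=> X hX [/hX//|]; rewrite /H e.
(* Here a number enters only if k is already present, so every stage is empty. *)
apply: esym; apply/negbTE/asboolP.
move: (b _); apply: (@Ifix_ind (H l m g) (fun X => forall n, ~ X n)).
  by move=> A X hX n [a0 /hX].
by move=> X hX n [/hX//|]; rewrite /H e => /hX.
Qed.

(** * Decidable relations and their closure properties *)

Definition crel (G : ctx) (P : G -> Prop) : Prop := comp (fun g => `[< P g >]).

Definition cset (G : ctx) (X : G -> nat -> Prop) : Prop :=
  crel (G := xn G) (fun g => X g.1 g.2).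

Lemma crel_ext (G : ctx) (P Q : G -> Prop) :
  (forall g, P g <-> Q g) -> crel P -> crel Q.
Proof. by move=> h; rewrite (_ : Q = P) //; apply: funext => g; apply: propext; rewrite h. Qed.

Lemma comp_cst (G : ctx) c : comp (fun _ : G => c).
Proof. exact: (rcomp_cst G (PC c)). Qed.

Lemma comp_var (G : ctx) : comp (G := xn G) (fun g => g.2).
Proof. exact: rcomp_var. Qed.

Lemma comp_wkn (G : ctx) (t : G -> nat) : comp t -> comp (G := xn G) (fun g => t g.1).
Proof. exact: rcomp_wkn. Qed.

Lemma comp_wkf (G : ctx) (t : G -> nat) : comp t -> comp (G := xf G) (fun g => t g.1).
Proof. exact: rcomp_wkf. Qed.

Lemma comp_succ (G : ctx) (t : G -> nat) : comp t -> comp (fun g => (t g).+1).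
Proof. exact: rcomp_succ. Qed.

Lemma comp_app (G : ctx) (t : xf G -> nat) :
  comp (G := xf G) t -> comp (G := xf G) (fun g => g.2 (t g)).
Proof. exact: (@rcomp_hd (xf G) snd (fun d => fa d.1)). Qed.

Lemma comp_let (G : ctx) (t : G -> nat) (u : xn G -> nat) :
  comp t -> comp u -> comp (fun g => u (g, t g)).
Proof. by move=> ht hu; exact: (rcomp_let ht hu). Qed.

Lemma comp_and (G : ctx) (x b : G -> nat) :
  comp x -> comp b -> comp (fun g => (x g == 0) && (0 < b g)).
Proof. by move=> hx hb; exact: (comp_let hx (comp_and0 hb)). Qed.

Lemma crel_not (G : ctx) (P : G -> Prop) : crel P -> crel (fun g => ~ P g).
Proof.
move=> hP; have := comp_and hP (comp_cst G 1); congr comp; apply: funext => g.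
by rewrite asbool_neg; case: asbool.
Qed.

Lemma crel_and (G : ctx) (P Q : G -> Prop) :
  crel P -> crel Q -> crel (fun g => P g /\ Q g).
Proof.
move=> /crel_not hP hQ; have := comp_and hP hQ; congr comp; apply: funext => g.
by rewrite asbool_and asbool_neg; case: asbool; case: asbool.
Qed.

Lemma crel_imp (G : ctx) (P Q : G -> Prop) :
  crel P -> crel Q -> crel (fun g => P g -> Q g).
Proof.
move=> hP hQ; apply: crel_ext (crel_not (crel_and hP (crel_not hQ))) => g.
by split=> [h p|h [p q]]; [apply: contrapT => q; apply: h | apply: q; apply: h].
Qed.

Lemma crel_or (G : ctx) (P Q : G -> Prop) :
  crel P -> crel Q -> crel (fun g => P g \/ Q g).
Proof.
move=> hP hQ; apply: crel_ext (crel_imp (crel_not hP) hQ) => g.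
by case: (pselect (P g)); tauto.
Qed.

Lemma crel_iff (G : ctx) (P Q : G -> Prop) :
  crel P -> crel Q -> crel (fun g => P g <-> Q g).
Proof. by move=> hP hQ; apply: crel_and; apply: crel_imp. Qed.

Lemma crel_gt0 (G : ctx) (t : G -> nat) : comp t -> crel (fun g => 0 < t g).
Proof.
move=> ht; have := comp_and (comp_cst G 0) ht; congr comp; apply: funext => g.
by rewrite asboolb.
Qed.

Lemma crel_eq0 (G : ctx) (t : G -> nat) : comp t -> crel (fun g => t g = 0).
Proof.
move=> /crel_gt0 /crel_not; apply: crel_ext => g.
by case: (t g) => [|n]; split=> // h; case: h.
Qed.

Lemma crel_let (G : ctx) (P : G -> nat -> Prop) (t : G -> nat) :
  cset P -> comp t -> crel (fun g => P g (t g)).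
Proof. by move=> hP ht; exact: (comp_let ht hP). Qed.

Lemma cset_wkn (G : ctx) (X : G -> nat -> Prop) :
  cset X -> cset (G := xn G) (fun g => X g.1).
Proof. exact: rcomp_wknn. Qed.

Lemma cset_wkf (G : ctx) (X : G -> nat -> Prop) :
  cset X -> cset (G := xf G) (fun g => X g.1).
Proof. exact: rcomp_wkfn. Qed.

(* The set f, when h is the argument n^f of G. *)
Definition hset (h : baire) : nat -> Prop := fun k => 0 < h k.+1.

Lemma hset_consB n X : hset (consB n (bset X)) = X.
Proof.
apply: funext => k; apply: propext; rewrite /hset /= /bset.
by split=> [|h]; [case: asboolP | rewrite asboolT].
Qed.

Lemma crel_Ifix (G : ctx) (H : G -> op) (b : G -> nat) :
  crel (G := xf G) (fun d => H d.1 (hset d.2) (d.2 0)) -> comp b ->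
  crel (fun g => Ifix (H g) (b g)).
Proof.
move=> hH hb.
apply: (@rcomp_Ifix G (xf G) fst snd _ (fun _ _ => b) (fun _ _ => H) _ _ hH hb) => //.
move=> l m g x n; exists (g, consB n (bset (stg (H g) x))); split=> //=.
by rewrite hset_consB; case: asbool.
Qed.

Lemma cset_hset (G : ctx) : cset (G := xf G) (fun d => hset d.2).
Proof.
apply: crel_gt0.
apply: (@rcomp_hd (xn (xf G)) (fun d => d.1.2) (fun d => fa d.1.1)
   (fun _ _ d => d.2.+1)) => //.
exact: comp_succ (comp_var _).
Qed.

(** Membership propagates downwards one number per stage, so a witness anywhere eventually puts 0
    into the set; without a witness nothing ever enters. *)
Lemma crel_ex (G : ctx) (P : G -> nat -> Prop) :
  crel (G := xn G) (fun g => P g.1 g.2) -> crel (fun g => exists n, P g n).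
Proof.
move=> hP; pose H g : op := fun X n => P g n \/ X n.+1.
have h0 : comp (G := xf G) (fun d => d.2 0) by apply: comp_app; apply: comp_cst.
have : crel (fun g => Ifix (H g) 0).
  apply: crel_Ifix; last exact: comp_cst.
  apply: crel_or; first exact: (crel_let (cset_wkf hP) h0).
  exact: (crel_let (cset_hset G) (comp_succ h0)).
apply: crel_ext => g; split.
  suff: forall n, Ifix (H g) n -> exists m, P g m by apply.
  apply: (@Ifix_ind (H g) (fun X => forall n, X n -> exists m, P g m)).
    by move=> A X hX n [a] /hX.
  by move=> X hX n [/hX//|[|/hX//]]; exists n.
case=> n Pn; suff h k : Ifix (H g) (n - k) by rewrite -(subnn n).
elim: k => [|k IH]; first by rewrite subn0; apply: Ifix_closed; left.
case: (ltnP k n) => kn; first by apply: Ifix_closed; right; rewrite subnSK.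
by rewrite (_ : n - k.+1 = n - k) //; lia.
Qed.

(** A term not mentioning the last variable is recovered by substituting a dummy for it; the later
    [change] fails if the variable did occur. *)
Ltac wk_term t G :=
  let t0 := constr:(fun g : G => t (g, 0)) in
  eval cbn beta iota delta [fst snd] in t0.
Ltac wk_termf t G :=
  let t0 := constr:(fun g : G => t (g, (fun _ : nat => 0))) in
  eval cbn beta iota delta [fst snd] in t0.

Ltac cwk :=
  lazymatch goal with
  | |- @comp (xn ?G) ?t => let t' := wk_term t (pt G) in
      change (@comp (xn G) (fun g => t' g.1)); apply comp_wkn; cbn beta
  | |- @comp (xf ?G) ?t => let t' := wk_termf t (pt G) in
      change (@comp (xf G) (fun g => t' g.1)); apply comp_wkf; cbn beta
  | |- @cset (xn ?G) ?t => let t' := wk_term t (pt G) in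
      change (@cset (xn G) (fun g => t' g.1)); apply cset_wkn; cbn beta
  | |- @cset (xf ?G) ?t => let t' := wk_termf t (pt G) in
      change (@cset (xf G) (fun g => t' g.1)); apply cset_wkf; cbn beta
  end.

Ltac cterm :=
  first [ eassumption | apply comp_var | apply cset_hset | apply comp_cst
        | apply comp_succ; cterm | apply comp_app; cterm | cwk; cterm ].

Ltac crel1 :=
  lazymatch goal with
  | |- @crel ?G (fun g => (@?P g) <-> (@?Q g)) => apply (@crel_iff G P Q)
  | |- @crel ?G (fun g => (@?P g) /\ (@?Q g)) => apply (@crel_and G P Q)
  | |- @crel ?G (fun g => (@?P g) \/ (@?Q g)) => apply (@crel_or G P Q)
  | |- @crel ?G (fun g => ~ (@?P g)) => apply (@crel_not G P)
  | |- @crel ?G (fun g => (@?P g) -> (@?Q g)) => apply (@crel_imp G P Q)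
  | |- @crel ?G (fun g => exists n : nat, @?P g n) => apply (@crel_ex G P)
  end; cbn beta.

Lemma crel_leq (G : ctx) (x y : G -> nat) :
  comp x -> comp y -> crel (fun g => x g <= y g).
Proof.
move=> hx hy.
(* The numbers 0, 1, 2, ... enter one per stage until [y g] is present, which leaves the initial
   segment up to [y g]. *)
pose H g : op := fun X n => ~ X (y g) /\ (n = 0 \/ (0 < n /\ X n.-1)).
have : crel (fun g => Ifix (H g) (x g)).
  apply: (@crel_Ifix G H x _ hx).
  (* At n > 0 the function n^f takes the value f(n-1), so the shift in the coding supplies the
     predecessor. *)
  suff : crel (G := xf G) (fun d => ~ hset d.2 (y d.1) /\
      (d.2 0 = 0 \/ (0 < d.2 0 /\ 0 < d.2 (d.2 0)))).
    apply: crel_ext => d; rewrite /H.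
    by split=> -[h [->|[h0 h1]]]; split; auto; right; split=> //;
       move: h1; rewrite /hset prednK.
  crel1; [crel1; apply: (@crel_let (xf G) (fun d => hset d.2)); cterm | crel1; [apply: crel_eq0; cterm |]].
  by crel1; apply: crel_gt0; cterm.
apply: crel_ext => g.
rewrite (@finite_run (H g) (fun k n => n < k) (y g).+1) //; rewrite /H; lia.
Qed.

Lemma crel_eq (G : ctx) (x y : G -> nat) :
  comp x -> comp y -> crel (fun g => x g = y g).
Proof.
move=> hx hy; apply: crel_ext (crel_and (crel_leq hx hy) (crel_leq hy hx)) => g; lia.
Qed.

(** * Functions with computable graphs *)

Definition gr (G : ctx) (t : G -> nat) : Prop := crel (G := xn G) (fun g => g.2 = t g.1).

Lemma gr_comp (G : ctx) (t : G -> nat) : comp t -> gr t.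
Proof. by move=> ht; apply: crel_eq; cterm. Qed.

Lemma crel_app (G : ctx) (X : G -> nat -> Prop) (t : G -> nat) :
  cset X -> gr t -> crel (fun g => X g (t g)).
Proof.
move=> hX ht; have : crel (fun g => exists n, n = t g /\ X g n) by crel1; crel1.
by apply: crel_ext => g; split=> [[n [->]]|]; last by exists (t g).
Qed.

Lemma gr_wkn (G : ctx) (t : G -> nat) : gr t -> gr (G := xn G) (fun g => t g.1).
Proof. exact: rcomp_wknn. Qed.

Lemma gr_wkf (G : ctx) (t : G -> nat) : gr t -> gr (G := xf G) (fun g => t g.1).
Proof. exact: rcomp_wkfn. Qed.

Lemma crel_gr2 (A : nat -> nat -> Prop) :
  (forall (G : ctx) (x y : G -> nat), comp x -> comp y -> crel (fun g => A (x g) (y g))) ->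
  forall (G : ctx) (x y : G -> nat), gr x -> gr y -> crel (fun g => A (x g) (y g)).
Proof.
move=> hA G x y hx hy; apply: (crel_app (X := fun g => A (x g))) hy.
apply: (crel_app (G := xn G) (X := fun g n => A n g.2)) (gr_wkn hx).
by apply: hA; cterm.
Qed.

Lemma crel_gr3 (A : nat -> nat -> nat -> Prop) :
  (forall (G : ctx) (x y z : G -> nat), comp x -> comp y -> comp z ->
     crel (fun g => A (x g) (y g) (z g))) ->
  forall (G : ctx) (x y z : G -> nat), gr x -> gr y -> gr z ->
    crel (fun g => A (x g) (y g) (z g)).
Proof.
move=> hA G x y z hx hy hz; apply: (crel_app (X := fun g => A (x g) (y g))) hz.
apply: (crel_app (G := xn G) (X := fun g n => A (x g.1) n g.2)) (gr_wkn hy).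
apply: (crel_app (G := xn (xn G)) (X := fun g n => A n g.2 g.1.2)) (gr_wkn (gr_wkn hx)).
by apply: hA; cterm.
Qed.

Lemma gr_fun1 (f : nat -> nat) :
  (forall (G : ctx) (x y : G -> nat), comp x -> comp y -> crel (fun g => y g = f (x g))) ->
  forall (G : ctx) (x : G -> nat), gr x -> gr (fun g => f (x g)).
Proof.
move=> hf G x hx.
by apply: (@crel_gr2 (fun x y => y = f x) hf (xn G)) (gr_wkn hx) (gr_comp (comp_var G)).
Qed.

Lemma gr_fun2 (f : nat -> nat -> nat) :
  (forall (G : ctx) (x y z : G -> nat), comp x -> comp y -> comp z ->
     crel (fun g => z g = f (x g) (y g))) ->
  forall (G : ctx) (x y : G -> nat), gr x -> gr y -> gr (fun g => f (x g) (y g)).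
Proof.
move=> hf G x y hx hy.
by apply: (@crel_gr3 (fun x y z => z = f x y) hf (xn G)) (gr_wkn hx) (gr_wkn hy)
  (gr_comp (comp_var G)).
Qed.

Lemma gr_succ (G : ctx) (t : G -> nat) : gr t -> gr (fun g => (t g).+1).
Proof. by apply: (@gr_fun1 succn) => D x y hx hy; apply: crel_eq => //; cterm. Qed.

Lemma crel_geq (G : ctx) (x y : G -> nat) : gr x -> gr y -> crel (fun g => x g <= y g).
Proof. exact: (@crel_gr2 (fun x y => x <= y) crel_leq). Qed.

Lemma crel_geqn (G : ctx) (x y : G -> nat) : gr x -> gr y -> crel (fun g => x g = y g).
Proof. exact: (@crel_gr2 (fun x y => x = y) crel_eq). Qed.

Lemma crel_all (G : ctx) (P : G -> nat -> Prop) :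
  crel (G := xn G) (fun g => P g.1 g.2) -> crel (fun g => forall n, P g n).
Proof.
move=> hP; have : crel (fun g => ~ exists n, ~ P g n) by do 3 crel1.
by apply: crel_ext => g; split=> [h n|h [n]]; [apply: contrapT => nP; apply: h; exists n | apply].
Qed.

Lemma crel_ltn (G : ctx) (x y : G -> nat) : gr x -> gr y -> crel (fun g => x g < y g).
Proof. by move=> hx hy; apply: (crel_geq (x := fun g => (x g).+1)) => //; apply: gr_succ. Qed.

Lemma crel_True (G : ctx) : crel (fun _ : G => True).
Proof. by apply: crel_ext (crel_eq0 (comp_cst G 0)). Qed.

Ltac gwk :=
  lazymatch goal with
  | |- @gr (xn ?G) ?t => let t' := wk_term t (pt G) in
      change (@gr (xn G) (fun g => t' g.1)); apply gr_wkn; cbn beta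
  | |- @gr (xf ?G) ?t => let t' := wk_termf t (pt G) in
      change (@gr (xf G) (fun g => t' g.1)); apply gr_wkf; cbn beta
  end.

Ltac split_app :=
  lazymatch goal with
  | |- @crel ?G ?P =>
    let X := constr:(fun g : pt G => ltac:(let b := eval cbn beta in (P g) in
               lazymatch b with ?Y ?t => exact Y end)) in
    let t := constr:(fun g : pt G => ltac:(let b := eval cbn beta in (P g) in
               lazymatch b with ?Y ?t => exact t end)) in
    apply (@crel_app G X t)
  end.

(** Hooks of [ctac], redefined after each new closure property. *)
Ltac gr_user := fail.
Ltac crel_user := fail.

Ltac ctac := cbn beta;
  lazymatch goal with
  | |- @gr ?G ?t =>
    first [ eassumption
          | solve [apply gr_comp; cterm]
          | gwk; ctac
          | gr_user; ctac
          | lazymatch t with fun g => (@?x g).+1 => apply (@gr_succ G x); cbn beta; ctac end ]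
  | |- @cset ?G ?X =>
    first [ eassumption | solve [cterm] | cwk; ctac
          | change (@crel (xn G) (fun g => X g.1 g.2)); cbn beta; ctac ]
  | |- @comp _ _ => cterm
  | |- @crel ?G (fun g => True) => apply crel_True
  | |- @crel ?G (fun g => (@?x g) = (@?y g)) => apply (@crel_geqn G x y); cbn beta; ctac
  | |- @crel ?G (fun g => is_true ((@?x g) < (@?y g))) =>
      apply (@crel_ltn G x y); cbn beta; ctac
  | |- @crel ?G (fun g => is_true ((@?x g) <= (@?y g))) =>
      apply (@crel_geq G x y); cbn beta; ctac
  | |- @crel ?G (fun g => (@?P g) -> (@?Q g)) => apply (@crel_imp G P Q); cbn beta; ctac
  | |- @crel ?G (fun g => forall n : nat, @?P g n) =>
      apply (@crel_all G P); cbn beta; ctac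
  | |- @crel ?G ?P =>
    first [ eassumption | crel1; ctac | crel_user; ctac
          | split_app; [solve [ctac] | ctac] ]
  | |- _ => idtac
  end.

Lemma crel_dbl0 (G : ctx) (x z : G -> nat) :
  comp x -> comp z -> crel (fun g => z g = (x g).*2).
Proof.
move=> hx hz.
(* Two counters run in step, one from 0 and one from x+1. Both stop when the first reaches x; the
   second is then at 2x+1, the largest number present. *)
pose H g : op := fun X n => ~ X (x g) /\
  (n = 0 \/ n = (x g).+1 \/ exists m, n = m.+1 /\ X m).
have hc : cset (fun g => Ifix (H g)).
  apply: (@crel_Ifix (xn G) (fun g => H g.1)); last by cterm.
  by rewrite /H; ctac.
have : crel (fun g => Ifix (H g) (z g).+1 /\ ~ Ifix (H g) (z g).+2) by ctac.
apply: crel_ext => g.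
rewrite (@finite_run (H g) (fun k n => n < k \/ x g < n <= x g + k) (x g).+1) //=; rewrite /H.
- lia.
- by move=> n; rewrite ltn0 addn0; lia.
- move=> k lek n; split=> [|[|[_ [->|[->|[m [-> hm]]]]]]]; try lia.
  by case: n => [|n] h; [right; lia |]; case: (eqVneq n (x g)) => e;
     [right; lia | right; split; first lia; right; right; exists n; lia].
- by move=> n [] []; left.
Qed.

Lemma gr_dbl (G : ctx) (x : G -> nat) : gr x -> gr (fun g => (x g).*2).
Proof. exact: (@gr_fun1 double crel_dbl0). Qed.

Ltac gr_atoms1 :=
  lazymatch goal with
  | |- @gr ?G (fun g => (@?x g).*2) => apply (@gr_dbl G x)
  end.
Ltac gr_user ::= gr_atoms1; cbn beta.

Lemma crel_cns0 (G : ctx) (x s z : G -> nat) :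
  comp x -> comp s -> comp z -> crel (fun g => z g = cns (x g) (s g)).
Proof.
move=> hx hs hz.
(* even numbers carry a counter, odd numbers the values 2^j(2s+1) *)
pose H g : op := fun X z => ~ X (x g).*2 /\
  ((exists n, z = n.*2 /\ (n = 0 \/ exists m, n = m.+1 /\ X m.*2)) \/
   (exists n, z = n.*2.+1 /\ (n = (s g).*2.+1 \/ exists m, n = m.*2 /\ X m.*2.+1))).
have hc : cset (fun g => Ifix (H g)).
  apply: (@crel_Ifix (xn G) (fun g => H g.1)); last by cterm.
  by rewrite /H; ctac.
(* [cns x s] is recognized as the last value to enter, the one whose double does not. *)
have : crel (fun g => Ifix (H g) (z g).*2.+1 /\ ~ Ifix (H g) (z g).*2.*2.+1) by ctac.
apply: crel_ext => g.
pose f k n := (exists2 j, j < k & n = j.*2) \/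
  (exists2 j, j < k & n = (cns j (s g)).*2.+1).
have cnsS j : cns j.+1 (s g) = (cns j (s g)).*2 by rewrite /cns expnS -mulnA mul2n.
have cns_inj2 i j : cns i (s g) = cns j (s g) -> i = j by case/cns_inj.
have f0 k i : f k i.*2 <-> i < k.
  split=> [[[j jk /double_inj->//]|[j jk]]|ik]; first by lia.
  by left; exists i.
have f1 k i : f k i.*2.+1 <-> exists2 j, j < k & i = cns j (s g).
  split=> [[[j jk]|[j jk [/double_inj->]]]|[j jk ->]]; first by lia.
    by exists j.
  by right; exists j.
rewrite (@finite_run (H g) f (x g).+1) //=; rewrite /H.
- rewrite !f1; split=> [[[j jx ->] h]|->].
    have [->//|ltjx] : j = x g \/ j < x g by lia.
    by case: h; exists j.+1; rewrite ?cnsS.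
  by split=> [|[j jx]]; [exists (x g) | rewrite -cnsS => /cns_inj2; lia].
- by move=> n [] [].
- move=> k lek n; split=> [h|[|[_ []]]].
  + case: h => -[j ltj ->].
      have [ltjk|->] : j < k \/ j = k by lia.
        by left; apply/f0.
      right; split; first by rewrite f0; lia.
      left; exists k; split=> //; case: (k) => [|i]; [by left | right; exists i; split=> //].
      by apply/f0.
    have [ltjk|->] : j < k \/ j = k by lia.
      by left; apply/f1; exists j.
    right; split; first by rewrite f0; lia.
    right; exists (cns k (s g)); split=> //; case: (k) => [|i].
      by left; rewrite /cns mul1n.
    right; exists (cns i (s g)); split=> //; apply/f1; by exists i.
  + by case=> -[j ltj ->]; [left | right]; exists j => //; apply: ltnW.
  + case=> m [-> [->|[i [-> /f0 ik]]]]; apply/f0 => //.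
  + case=> m [-> [->|[i [-> /f1[j jk ->]]]]]; apply/f1; first by exists 0; rewrite // /cns mul1n.
    by exists j.+1.
- by move=> n [] []; apply/f0.
Qed.

Lemma gr_cns (G : ctx) (x s : G -> nat) : gr x -> gr s -> gr (fun g => cns (x g) (s g)).
Proof. exact: (@gr_fun2 cns crel_cns0). Qed.

Lemma gr_code_cons (G : ctx) (x : G -> nat) (s : G -> seq nat) :
  gr x -> gr (fun g => code (s g)) -> gr (fun g => code (x g :: s g)).
Proof. exact: gr_cns. Qed.

Ltac gr_atoms2 :=
  lazymatch goal with
  | |- @gr ?G (fun g => cns (@?x g) (@?y g)) => apply (@gr_cns G x y)
  | |- @gr ?G (fun g => CodeSeq.code ((@?x g) :: (@?y g))) => apply (@gr_code_cons G x y)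
  | |- _ => gr_atoms1
  end.
Ltac gr_user ::= gr_atoms2; cbn beta.

(* Unification must not evaluate 2 ^ x. *)
Opaque cns.

(** * Recursion along well-founded relations *)

Definition wk (D G : ctx) (pi : D -> G) : Prop :=
  forall X : G -> nat -> Prop, cset X -> cset (fun d => X (pi d)).

Lemma wk_id (G : ctx) : wk (fun g : G => g).
Proof. by move=> X. Qed.

Lemma wk_n (D G : ctx) (pi : D -> G) : wk pi -> wk (D := xn D) (fun d => pi d.1).
Proof. by move=> h X /h hX; apply: (cset_wkn (X := fun d => X (pi d))). Qed.

Lemma wk_f (D G : ctx) (pi : D -> G) : wk pi -> wk (D := xf D) (fun d => pi d.1).
Proof. by move=> h X /h hX; apply: (cset_wkf (X := fun d => X (pi d))). Qed.

(** Computability uniform in the set argument: Y ranges over the computable sets of every extension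
    of G, because inside an induction that argument is the new function variable. *)
Definition cop (G : ctx) (H : G -> op) : Prop :=
  forall (D : ctx) (pi : D -> G) (Y : D -> nat -> Prop) (n : D -> nat),
    wk pi -> cset Y -> gr n -> crel (fun d => H (pi d) (Y d) (n d)).

Definition crel2 (A : nat -> nat -> Prop) : Prop :=
  forall (G : ctx) (x y : G -> nat), gr x -> gr y -> crel (fun g => A (x g) (y g)).

Lemma cset_Ifix (G : ctx) (H : G -> op) : cop H -> cset (fun g => Ifix (H g)).
Proof.
move=> hH; apply: (@crel_Ifix (xn G) (fun g => H g.1)); last by cterm.
apply: (hH (xf (xn G)) (fun d => d.1.1) (fun d => hset d.2) (fun d => d.2 0)); try ctac.
exact: (@wk_f (xn G) G (fun d => d.1) (wk_n (@wk_id G))).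
Qed.

(** H may use its argument negatively, so x can be decided only after all its predecessors. Negative
    answers must be recorded too, to show that a predecessor is settled. *)
Lemma cset_rec (prec : nat -> nat -> Prop) (G : ctx) (H : G -> op) (R : G -> nat -> Prop) :
  well_founded prec -> crel2 prec -> cop H ->
  (forall g x, R g x <-> H g (fun y => prec y x /\ R g y) x) -> cset R.
Proof.
move=> wf cprec hH hR.
(* cns 0 x (cns 1 x) records that R g x holds (fails) *)
pose K g : op := fun X z => exists x,
  (forall y, prec y x -> X (cns 0 y) \/ X (cns 1 y)) /\
  ((z = cns 0 x /\ H g (fun y => prec y x /\ X (cns 0 y)) x) \/
   (z = cns 1 x /\ ~ H g (fun y => prec y x /\ X (cns 0 y)) x)).
have cK : cop K.
  move=> D pi Y n wpi hY hn.
  have h : crel (G := xn D)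
      (fun d => H (pi d.1) (fun y => prec y d.2 /\ Y d.1 (cns 0 y)) d.2).
    apply: (hH (xn D) (fun d => pi d.1) (fun d y => prec y d.2 /\ Y d.1 (cns 0 y)) snd); [exact: wk_n | | by ctac].
    change (crel (G := xn (xn D)) (fun d => prec d.2 d.1.2 /\ Y d.1.1 (cns 0 d.2))).
    by crel1; [apply: cprec; ctac | ctac].
  rewrite /K; crel1; crel1; last by ctac.
  by apply: crel_all; crel1; [apply: cprec; ctac | ctac].
have hc := cset_Ifix cK.
have : crel (G := xn G) (fun g => Ifix (K g.1) (cns 0 g.2)) by ctac.
apply: crel_ext => -[g x] /=.
have sound : forall x, (Ifix (K g) (cns 0 x) -> R g x) /\ (Ifix (K g) (cns 1 x) -> ~ R g x).
  apply: (@Ifix_ind (K g)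
    (fun X => forall x, (X (cns 0 x) -> R g x) /\ (X (cns 1 x) -> ~ R g x))).
    by move=> A X hX y; split=> -[a]; case: (hX a y) => h1 h2; auto.
  move=> X hX y.
  have aux z : (forall y, prec y z -> X (cns 0 y) \/ X (cns 1 y)) ->
      H g (fun y => prec y z /\ X (cns 0 y)) z <-> R g z.
    move=> dec; rewrite hR (_ : (fun _ => _ /\ X _) = fun y => prec y z /\ R g y) //.
    apply: funext => u; apply: propext; split=> -[pu hu]; split=> //; first by case: (hX u); auto.
    by case: (dec _ pu) => // /(proj2 (hX u)).
  split; case.
  - exact: (proj1 (hX y)).
  - by case=> z [dec [[/cns_inj[_ ->] /(aux _ dec)//]|[/cns_inj[]]]].
  - exact: (proj2 (hX y)).
  - by case=> z [dec [[/cns_inj[]//]|[/cns_inj[_ ->] h /(aux _ dec)]]].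
split; first by case: (sound x).
move=> Rx; suff : forall y, Ifix (K g) (cns 0 y) \/ Ifix (K g) (cns 1 y).
  by case/(_ x) => // /(proj2 (sound x)).
move=> {x Rx}; elim/(well_founded_ind wf) => x IH.
case: (pselect (H g (fun y => prec y x /\ Ifix (K g) (cns 0 y)) x)) => h.
  by left; apply: Ifix_closed; exists x; split=> //; left.
by right; apply: Ifix_closed; exists x; split=> //; right.
Qed.

(** For recursions on a code in the first component whose other components are parameters that may
    change arbitrarily. *)
Definition fstlt (p q : nat) : Prop :=
  exists a b a' b', q = cns a b /\ p = cns a' b' /\ a' < a.

Lemma fstlt_wf : well_founded fstlt.
Proof.
have h n : forall a b, a < n -> Acc fstlt (cns a b).
  elim: n => [|n IH] a b an; first by [].
  constructor => p [a1 [b1 [a' [b' [/cns_inj[ea _] [-> lt]]]]]].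
  by apply: IH; move: lt an; rewrite ea ltnS; apply: leq_trans.
by move=> q; constructor => p [a [b [a' [b' [_ [-> _]]]]]]; exact: (h a'.+1 a' b' (ltnSn a')).
Qed.

Lemma crel_fstlt : crel2 fstlt.
Proof. by move=> G x y hx hy; rewrite /fstlt; ctac. Qed.

(** * Coded finite sequences *)

Definition Nth (s i x : nat) : Prop := i < size (decode s) /\ nth 0 (decode s) i = x.

Lemma Nth_cns y s i x :
  Nth (cns y s) i x <-> (i = 0 /\ x = y) \/ exists j, i = j.+1 /\ Nth s j x.
Proof.
rewrite /Nth decode_cns; case: i => [|i] /=.
  by split=> [[_ ->]|[[_ ->]//|[j []//]]]; left.
by split=> [h|[[]//|[j [[->]]]]//]; right; exists i.
Qed.

Lemma cns_cases s : s = 0 \/ exists x t, s = cns x t.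
Proof.
rewrite -(CodeSeq.decodeK s); case: (decode s) => [|x t]; first by left.
by right; exists x, (code t).
Qed.

Lemma crel_Nth (G : ctx) (s i x : G -> nat) : gr s -> gr i -> gr x ->
  crel (fun g => Nth (s g) (i g) (x g)).
Proof.
move=> hs hi hx.
pose R (g : G) q := exists s i x, q = cns s (cns i x) /\ Nth s i x.
have cR : cset R.
  pose H (g : G) : op := fun X q => exists s i x, q = cns s (cns i x) /\
    exists y t, s = cns y t /\
      ((i = 0 /\ x = y) \/ exists j, i = j.+1 /\ X (cns t (cns j x))).
  apply: (@cset_rec fstlt _ H); [exact: fstlt_wf | exact: crel_fstlt | |].
    by move=> D pi Y n _ hY hn; rewrite /H; ctac.
  move=> g q; rewrite /R /H; split.
    case=> s1 [i1 [x1 [-> h]]]; exists s1, i1, x1; split=> //.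
    case: (cns_cases s1) h => [->|[y [t ->]]]; first by case.
    case/Nth_cns=> [[-> ->]|[j [-> h]]]; exists y, t; split=> //; first by left.
    right; exists j; split=> //; split; last by exists t, j, x1.
    by exists (cns y t), (cns j.+1 x1), t, (cns j x1); split=> //; split=> //; apply: ltn_cns2.
  case=> s1 [i1 [x1 [-> [y [t [-> h]]]]]]; exists (cns y t), i1, x1; split=> //.
  apply/Nth_cns; case: h => [|[j [-> [_ [t' [j' [x' [/cns_inj[-> /cns_inj[-> ->]] h]]]]]]]].
    by left.
  by right; exists j'.
have : crel (fun g => R g (cns (s g) (cns (i g) (x g)))) by ctac.
apply: crel_ext => g; split=> [[s' [i' [x' [/cns_inj[-> /cns_inj[-> ->]]]]]]//|h].
by exists (s g), (i g), (x g).
Qed.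

Definition Size (s n : nat) : Prop := forall i, i < n <-> exists x, Nth s i x.

Lemma SizeP s n : Size s n <-> n = size (decode s).
Proof.
have h i : (exists x, Nth s i x) <-> i < size (decode s).
  by split=> [[x []]|hi] //; exists (nth 0 (decode s) i).
split=> [hS|-> i]; last by rewrite h.
by have := hS n; have := hS (size (decode s)); rewrite !h; lia.
Qed.

Lemma eq_Nth s t :
  s = t <-> forall i x, Nth s i x <-> Nth t i x.
Proof.
split=> [->//|h]; rewrite -(CodeSeq.decodeK s) -(CodeSeq.decodeK t); congr code.
have es : size (decode s) = size (decode t).
  apply/SizeP => i; have /SizeP/(_ i) -> : size (decode s) = size (decode s) by [].
  by split=> -[x /h hx]; exists x.
apply: (@eq_from_nth _ 0) => // i hi.
by have /h[] : Nth s i (nth 0 (decode s) i) by [].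
Qed.

Ltac crel_atoms1 :=
  lazymatch goal with
  | |- @crel ?G (fun g => Nth (@?s g) (@?i g) (@?x g)) => apply (@crel_Nth G s i x)
  end.
Ltac crel_user ::= crel_atoms1; cbn beta.

(** * Computing indices *)

Lemma Nth_code l k x : Nth (code l) k x <-> k < size l /\ nth 0 l k = x.
Proof. by rewrite /Nth CodeSeq.codeK. Qed.

Lemma eq_codeP y l :
  y = code l <-> forall k x, Nth y k x <-> k < size l /\ nth 0 l k = x.
Proof. by rewrite eq_Nth; split=> h k x; have := h k x; rewrite Nth_code. Qed.

Lemma gr_perml (G : ctx) (i n : G -> nat) :
  gr i -> gr n -> gr (fun g => code (perml (i g) (n g))).
Proof.
move=> hi hn; rewrite /gr.
have : crel (G := xn G) (fun g => forall k x, Nth g.2 k x <->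
   (i g.1 = 0 /\ k < n g.1 /\ x = k) \/
   exists j, i g.1 = j.+1 /\ ((k < j /\ x = k) \/
     (j <= k /\ ((k.+1 < n g.1 /\ x = k.+1) \/
       (x = j /\ ((n g.1 <= j.+1 /\ k = j) \/ (j.+1 < n g.1 /\ k.+1 = n g.1))))))) by ctac.
apply: crel_ext => -[g y] /=; rewrite eq_codeP.
have eqf (k x : nat) : (k < size (perml (i g) (n g)) /\ nth 0 (perml (i g) (n g)) k = x) <->
   (i g = 0 /\ k < n g /\ x = k) \/
   exists j, i g = j.+1 /\ ((k < j /\ x = k) \/
     (j <= k /\ ((k.+1 < n g /\ x = k.+1) \/
       (x = j /\ ((n g <= j.+1 /\ k = j) \/ (j.+1 < n g /\ k.+1 = n g)))))).
  case: (i g) => [|j]; rewrite /perml.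
    rewrite size_iota; split=> [[lt]|[[_ [lt ->]]|[j [//]]]].
      by rewrite nth_iota // => <-; left.
    by rewrite nth_iota.
  rewrite !size_cat !size_iota /=; split=> [[lt]|[[//]|[_ [[<-] h]]]].
    rewrite !nth_cat !size_iota => h; right; exists j; split=> //; move: h.
    case: ltnP => kj; first by rewrite nth_iota // => <-; left; rewrite add0n.
    case: ltnP => kn; first by rewrite nth_iota // => <-; right; lia.
    by rewrite (_ : k - j - (n g - j.+1) = 0) /=; lia.
  split; first lia.
  rewrite !nth_cat !size_iota; case: ltnP => kj; first by rewrite nth_iota //; lia.
  case: ltnP => kn; first by rewrite nth_iota //; lia.
  by rewrite (_ : k - j - (n g - j.+1) = 0) /=; lia.
by split=> h k x; rewrite h eqf.
Qed.

(** S6 wants permutations of full length: s, a permutation of an initial segment, is continued by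
    the identity. *)
Definition ext (s l : nat) : seq nat :=
  decode s ++ iota (size (decode s)) (l - size (decode s)).

Lemma gr_ext (G : ctx) (s l : G -> nat) :
  gr s -> gr l -> gr (fun g => code (ext (s g) (l g))).
Proof.
move=> hs hl; rewrite /gr.
have : crel (G := xn G) (fun g => forall k x, Nth g.2 k x <->
   Nth (s g.1) k x \/ (~ (exists y, Nth (s g.1) k y) /\ k < l g.1 /\ x = k)) by ctac.
apply: crel_ext => -[g y] /=; rewrite eq_codeP.
have eqf (k x : nat) : (k < size (ext (s g) (l g)) /\ nth 0 (ext (s g) (l g)) k = x) <->
   Nth (s g) k x \/ (~ (exists y, Nth (s g) k y) /\ k < l g /\ x = k).
  have -> : (exists y, Nth (s g) k y) = (k < size (decode (s g))).
    by apply: propext; split=> [[z []]//|h]; exists (nth 0 (decode (s g)) k).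
  rewrite /Nth /ext size_cat size_iota nth_cat.
  case: (ltnP k (size (decode (s g)))) => ks.
    by split=> [[_ <-]|[[_ <-]|[]//]]; [left | split=> //; lia].
  split=> [[lt]|[[//]|[_ [lt ->]]]]; rewrite nth_iota; by [right; lia | lia].
by split=> h k x; rewrite h eqf.
Qed.

(** Index expressions as data: from the code of p a program can check which index p denotes at its
    own arity. *)
Fixpoint enc (p : pr) : nat :=
  match p with
  | PC c => code [:: 0; c]
  | PL => code [:: 1]
  | PM => code [:: 2]
  | PpL i => code [:: 3; i]
  | PpM i => code [:: 4; i]
  | PCns p q => code [:: 5; enc p; enc q]
  | PShL p => code [:: 6; enc p]
  | PShM p => code [:: 7; enc p]
  end.

Lemma enc_inj : injective enc.
Proof.
elim=> [c|||i|i|p IHp q IHq|p IHp|p IHp] [c'|||i'|i'|p' q'|p'|p'] /(can_inj CodeSeq.codeK) //.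
- by case=> ->.
- by case=> ->.
- by case=> ->.
- by case=> /IHp-> /IHq->.
- by case=> /IHp->.
- by case=> /IHp->.
Qed.

Definition Gev (z l m y : nat) : Prop := exists2 p, z = enc p & y = ev p l m.

Ltac gr_atoms3 :=
  lazymatch goal with
  | |- @gr ?G (fun g => CodeSeq.code (perml (@?x g) (@?y g))) => apply (@gr_perml G x y)
  | |- @gr ?G (fun g => CodeSeq.code (ext (@?x g) (@?y g))) => apply (@gr_ext G x y)
  | |- _ => gr_atoms2
  end.
Ltac gr_user ::= gr_atoms3; cbn beta.

Lemma crel_Gev (G : ctx) (z l m y : G -> nat) : gr z -> gr l -> gr m -> gr y ->
  crel (fun g => Gev (z g) (l g) (m g) (y g)).
Proof.
move=> hz hl hm hy.
pose R (g : G) q := exists z l m y, q = cns z (cns l (cns m y)) /\ Gev z l m y.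
have cR : cset R.
  pose H (g : G) : op := fun X q => exists z l m y, q = cns z (cns l (cns m y)) /\
    ((exists c, z = code [:: 0; c] /\ y = c) \/
     (z = code [:: 1] /\ y = l) \/ (z = code [:: 2] /\ y = m) \/
     (exists i, z = code [:: 3; i] /\ y = code (perml i l)) \/
     (exists i, z = code [:: 4; i] /\ y = code (perml i m)) \/
     (exists a b u v, z = code [:: 5; a; b] /\ y = cns u v /\
        X (cns a (cns l (cns m u))) /\ X (cns b (cns l (cns m v)))) \/
     (exists a, z = code [:: 6; a] /\ X (cns a (cns l.+1 (cns m y)))) \/
     (exists a, z = code [:: 7; a] /\ X (cns a (cns l (cns m.+1 y))))).
  apply: (@cset_rec fstlt _ H); [exact: fstlt_wf | exact: crel_fstlt | |].
    by move=> D pi Y n _ hY hn; rewrite /H; ctac.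
  have lt1 k a b : a < code [:: k, a & b].
    by rewrite !code_cons; apply: ltn_trans (ltn_cns1 _ _) (ltn_cns2 _ _).
  have lt2 k a b : b < code [:: k; a; b].
    by apply: ltn_trans (lt1 a b [::]) _; rewrite [code _ in X in _ < X]code_cons; apply: ltn_cns2.
  move=> g q; rewrite /R /H; split.
    case=> z1 [l1 [m1 [y1 [-> [p -> ->]]]]].
    exists (enc p), l1, m1, (ev p l1 m1); split=> //.
    have Xp r u v a b : enc r < a ->
        fstlt (cns (enc r) (cns u (cns v (ev r u v)))) (cns a b) /\
        exists z l m y, cns (enc r) (cns u (cns v (ev r u v))) = cns z (cns l (cns m y)) /\
          Gev z l m y.
      move=> lt; split; last by exists (enc r), u, v, (ev r u v); split=> //; exists r.
      by exists a, b, (enc r), (cns u (cns v (ev r u v))).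
    case: p => [c|||i|i|p r|p|p].
    - by left; exists c.
    - by right; left.
    - by do 2 right; left.
    - by do 3 right; left; exists i.
    - by do 4 right; left; exists i.
    - do 5 right; left; exists (enc p), (enc r), (ev p l1 m1), (ev r l1 m1); do 2 split=> //.
      by split; apply: Xp; [apply: lt1 | apply: lt2].
    - by do 6 right; left; exists (enc p); split=> //; apply: Xp; apply: lt1.
    - by do 7 right; exists (enc p); split=> //; apply: Xp; apply: lt1.
  case=> z1 [l1 [m1 [y1 [-> h]]]]; exists z1, l1, m1, y1; split=> //.
  have Xq r u v w t : fstlt (cns r (cns u (cns v w))) t /\
        (exists z l m y, cns r (cns u (cns v w)) = cns z (cns l (cns m y)) /\
          Gev z l m y) -> Gev r u v w.
    by case=> _ [z2 [l2 [m2 [y2 [/cns_inj[-> /cns_inj[-> /cns_inj[-> ->]]]]]]]].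
  case: h => [[c [-> ->]]|[[-> ->]|[[-> ->]|[[i [-> ->]]|[[i [-> ->]]|[|[|]]]]]]].
  - by exists (PC c).
  - by exists PL.
  - by exists PM.
  - by exists (PpL i).
  - by exists (PpM i).
  - case=> a [b [u [v [-> [-> [/Xq[p -> ->] /Xq[r -> ->]]]]]]].
    by exists (PCns p r).
  - by case=> a [-> /Xq[p -> ->]]; exists (PShL p).
  - by case=> a [-> /Xq[p -> ->]]; exists (PShM p).
have : crel (fun g => R g (cns (z g) (cns (l g) (cns (m g) (y g))))) by ctac.
apply: crel_ext => g; split.
  by case=> z' [l' [m' [y' [/cns_inj[-> /cns_inj[-> /cns_inj[-> ->]]]]]]].
by move=> h; exists (z g), (l g), (m g), (y g).
Qed.

(** * Lazy calls of an index *)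

(** The first entry of an index e is the number of its scheme, so the table has one program for each
    scheme. *)
Definition sel (zs : seq pr) (e : nat) : pr := nth (PC 0) zs (head 0 (decode e)).

(* y is the index that calls the entry of the table z selected by d after
   permuting the functions by s and moving the first function to the end. *)
Definition call_index (z d s l m y : nat) : Prop :=
  exists i k r p, [/\ d = cns k r, Nth z k p, Gev p l m i &
    y = code [:: 6; code [:: 6; i; code (ext s l); code (perml 0 m)];
                 code (perml 1 l); code (perml 0 m)] ].

Ltac crel_atoms2 :=
  lazymatch goal with
  | |- @crel ?G (fun g => Gev (@?s g) (@?i g) (@?x g) (@?y g)) => apply (@crel_Gev G s i x y)
  | |- _ => crel_atoms1
  end.
Ltac crel_user ::= crel_atoms2; cbn beta.

Lemma crel_call_index (G : ctx) (z d s l m y : G -> nat) :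
  gr z -> gr d -> gr s -> gr l -> gr m -> gr y ->
  crel (fun g => call_index (z g) (d g) (s g) (l g) (m g) (y g)).
Proof.
move=> hz hd hs hl hm hy.
have : crel (fun g => exists i k r p, d g = cns k r /\ Nth (z g) k p /\
   Gev p (l g) (m g) i /\
   y g = code [:: 6; code [:: 6; i; code (ext (s g) (l g)); code (perml 0 (m g))];
                 code (perml 1 (l g)); code (perml 0 (m g))]) by ctac.
apply: crel_ext => g; split=> -[i [k [r [p]]]] h; exists i, k, r, p.
  by case: h => h1 [h2 [h3 h4]].
by case: h.
Qed.

Ltac crel_atoms3 :=
  lazymatch goal with
  | |- @crel ?G (fun g => call_index (@?z g) (@?d g) (@?s g) (@?l g) (@?m g) (@?y g)) =>
      apply (@crel_call_index G z d s l m y)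
  | |- _ => crel_atoms2
  end.
Ltac crel_user ::= crel_atoms3; cbn beta.

Lemma call_indexE zs d s l m y : head 0 (decode d) < size zs ->
  0 < d ->
  call_index (code (map enc zs)) d s l m y <->
  y = code [:: 6; code [:: 6; ev (sel zs d) l m; code (ext s l); code (perml 0 m)];
               code (perml 1 l); code (perml 0 m)].
Proof.
move=> ltd; case: (cns_cases d) => [->//|[k [r ed]]] _.
rewrite /sel; rewrite ed decode_cns /= in ltd *; split=> [[i [k' [r' [p [e h1 h2 ->]]]]]|->].
  have [ek _] := cns_inj e; rewrite -{k' r' e}ek in h1.
  move: h1 => /Nth_code[_]; rewrite (nth_map (PC 0)) // => ep.
  by case: h2 => q; rewrite -ep => /enc_inj-> ->.
exists (ev (nth (PC 0) zs k) l m), k, r, (enc (nth (PC 0) zs k)); split=> //.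
  by apply/Nth_code; rewrite size_map (nth_map (PC 0)).
by exists (nth (PC 0) zs k).
Qed.

Lemma run4 (G : ctx) (z d x c i : G -> nat) :
  comp z -> comp d -> comp x -> comp c -> comp i ->
  exists q, forall (g : G) fs a v,
    kleene (i g) (fa g ++ fs) (z g :: d g :: x g :: c g :: na g ++ a) v ->
    kleene (ev q (size (fa g ++ fs)) (size (na g ++ a))) (fa g ++ fs) (na g ++ a) v.
Proof.
move=> hz hd hx hc hi.
have push (D : ctx) (t : D -> nat) q : comp t -> exists q', forall (g : D) fs a v,
    kleene (ev q (size (fa g ++ fs)) (size (na g ++ a)).+1) (fa g ++ fs)
      (t g :: na g ++ a) v ->
    kleene (ev q' (size (fa g ++ fs)) (size (na g ++ a))) (fa g ++ fs) (na g ++ a) v.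
  case=> p hp; exists (PList [:: PC 4; PShM q; p]) => g fs a v h.
  by rewrite ev_PList; apply: S4 (hp _ _ _) h.
have [q1 h1] := push (xn (xn (xn (xn G)))) (fun g => i g.1.1.1.1) (PC (code [:: 9]))
  ltac:(cterm).
have [q2 h2] := push (xn (xn (xn G))) (fun g => z g.1.1.1) q1 ltac:(cterm).
have [q3 h3] := push (xn (xn G)) (fun g => d g.1.1) q2 ltac:(cterm).
have [q4 h4] := push (xn G) (fun g => x g.1) q3 ltac:(cterm).
have [q5 h5] := push G c q4 hc.
exists q5 => g fs a v h; apply: h5; apply: (h4 (g, c g)); apply: (h3 (g, c g, x g)).
apply: (h2 (g, c g, x g, d g)); apply: (h1 (g, c g, x g, d g, z g)).
exact: S9.
Qed.

Lemma permute_ext (F : seq baire) s (d0 : baire) :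
  size (decode s) <= size F ->
  [seq nth d0 F i | i <- ext s (size F)] =
  [seq nth d0 F i | i <- decode s] ++ drop (size (decode s)) F.
Proof.
move=> ss; rewrite map_cat; congr (_ ++ _).
apply: (@eq_from_nth _ d0) => [|i]; first by rewrite size_map size_iota size_drop.
rewrite size_map size_iota => lt; rewrite (nth_map 0) ?size_iota // nth_iota //.
by rewrite nth_drop.
Qed.

Lemma ext_perm s l : size (decode s) <= l ->
  perm_eq (decode s) (iota 0 (size (decode s))) -> perm_eq (ext s l) (iota 0 l).
Proof.
by move=> sl h; rewrite /ext -{2}(subnKC sl) iotaD add0n perm_cat2r.
Qed.

(** In the body of S8 the stage is the first function. It is moved to the end, so that the callee
    finds its own functions in front and the stage among the trailing ones. *)
Lemma kleene_shift i s (h : baire) F A v (l := (size F).+1) (m := size A) :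
  size (decode s) <= size F ->
  perm_eq (decode s) (iota 0 (size (decode s))) ->
  kleene i ([seq nth (fun=> 0) (F ++ [:: h]) i | i <- decode s] ++
            drop (size (decode s)) (F ++ [:: h])) A v ->
  kleene (code [:: 6; code [:: 6; i; code (ext s l); code (perml 0 m)];
                 code (perml 1 l); code (perml 0 m)]) (h :: F) A v.
Proof.
move=> ss sp hk; apply: S6; [exact: perml_perm | exact: perml_perm |].
rewrite !perml_nth // [permute 1 _]/= [permute 0 _]/= drop0 take0.
have el : l = size (F ++ [:: h]) by rewrite size_cat addn1.
rewrite el; apply: S6.
- by apply: ext_perm => //; rewrite size_cat (leq_trans ss) // leq_addr.
- exact: perml_perm.
by rewrite perml_nth // permute_ext // size_cat (leq_trans ss) // leq_addr.
Qed.

(* The number n of an induction is a guess for the index to be called, less 2;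
   for a wrong guess the index S1, which is 2, is run instead. *)
Lemma crel_call (G : ctx) (cond v : G -> Prop) (z d x c s : G -> nat) :
  crel cond -> comp z -> comp d -> comp x -> comp c -> gr s ->
  (forall g, cond g -> exists zs, [/\ z g = code (map enc zs),
     0 < d g /\ head 0 (decode (d g)) < size zs,
     size (decode (s g)) <= size (fa g),
     perm_eq (decode (s g)) (iota 0 (size (decode (s g)))) &
     forall fs a,
       kleene (ev (sel zs (d g)) (size (fa g ++ fs)) (size a).+4)
         ([seq nth (fun=> 0) (fa g) i | i <- decode (s g)] ++
            drop (size (decode (s g))) (fa g) ++ fs)
         [:: z g, d g, x g, c g & a] `[< v g >] ]) ->
  crel (fun g => cond g /\ v g).
Proof.
move=> hcond hz hd hx hc hs hrun.
pose hit l m g n := cond g /\ call_index (z g) (d g) (s g) l m n.+2.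
(* A hit propagates down to 1, while 0 is kept out of every stage. The callee sees one more
   function, the stage, and five more numbers: z, d, x, c and the bit [beta]. *)
pose H (l m : nat) (g : G) : op :=
  fun X n => 0 < n /\ ((hit l.+1 (5 + m) g n /\ v g) \/ X n.+1).
(* At these points the function n^f has value n at 0 and value 0 at 1. Evaluating it at the bit
   [beta] and adding 2 therefore selects the guessed index n.+2 or the index 2. *)
pose D := @Ctx {u : G * baire | u.2 1 = 0} (fun u => fa (c := xf G) (sval u))
               (fun u => na (c := xf G) (sval u)).
have toD (t : xf G -> nat) : comp t -> comp (G := D) (fun u => t (sval u)).
  by apply: (@rcomp_permute (xf G) D sval 0 0) => u w; split=> //; exists w.
have toD1 (t : G -> nat) : comp t -> comp (G := xn D) (fun u => t (sval u.1).1).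
  by move=> t0; apply: (@comp_wkn D _ (toD (fun u => t u.1) (comp_wkf t0))).
pose n0 (u : D) := (sval u).2 0.
have cn0 : comp n0 by apply: (toD (fun u => u.2 0)); cterm.
pose beta l m (u : D) : nat := `[< ~ hit l (5 + m) (sval u).1 (n0 u) >].
have cbeta : rcomp beta.
  have h : crel (G := xn (xn (xf G))) (fun u => ~ (cond u.1.1.1 /\
      call_index (z u.1.1.1) (d u.1.1.1) (s u.1.1.1) u.1.2 u.2 (u.1.1.2 0).+2)).
    have gz := gr_comp hz; have gd := gr_comp hd.
    apply: crel_not; apply: crel_and.
      exact: (@comp_wkn (xn (xf G)) _ (@comp_wkn (xf G) _ (comp_wkf hcond))).
    by ctac.
  have h' : comp (G := xn (xn D)) (fun u => `[< ~ hit u.1.2 u.2 (sval u.1.1).1 (n0 u.1.1) >]).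
    apply: (@rcomp_permute (xn (xn (xf G))) (xn (xn D)) (fun u => (sval u.1.1, u.1.2, u.2)) 0 0) h.
      by move=> u w; split=> //; exists w.
    by move=> u w; split=> //; exists w.
  have hL : rcomp (fun l m (_ : D) => l) := rcomp_cst D PL.
  have hM : rcomp (fun l m (_ : xn D) => 4 + m) := rcomp_cst (xn D) (PShM (PShM (PShM (PShM PM)))).
  have [p hp] := rcomp_let hL (rcomp_let hM h').
  exists p => u fs a l m; rewrite /beta /=.
  have := hp u fs a; rewrite -/l -/m /=.
  by rewrite (_ : 4 + m.+1 = 5 + m) //; lia.
have [pbeta hbeta] := cbeta.
have [q hq] : exists q, forall (u : xn D) fs a w,
    kleene ((sval u.1).2 u.2).+2 (fa u ++ fs)
       [:: z (sval u.1).1, d (sval u.1).1, x (sval u.1).1, c (sval u.1).1 & na u ++ a] w ->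
    kleene (ev q (size (fa u ++ fs)) (size (na u ++ a))) (fa u ++ fs) (na u ++ a) w.
  apply: (@run4 (xn D) (fun u => z (sval u.1).1) (fun u => d (sval u.1).1)
    (fun u => x (sval u.1).1) (fun u => c (sval u.1).1) (fun u => ((sval u.1).2 u.2).+2)).
  - exact: toD1.
  - exact: toD1.
  - exact: toD1.
  - exact: toD1.
  - do 2 apply: comp_succ.
    by apply: (@rcomp_hd (xn D) (fun u => (sval u.1).2) (fun u => fa (sval u.1).1)
      (fun _ _ u => u.2)) => //; cterm.
have [pt ht] : comp (G := xn (xn D)) (fun u : xn (xn D) => `[< 0 < n0 u.1.1 /\
    ((u.1.2 = 0 /\ 0 < u.2) \/ hset (sval u.1.1).2 (n0 u.1.1).+1) >]).
  have h : crel (G := xn (xn (xf G))) (fun u => 0 < u.1.1.2 0 /\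
    ((u.1.2 = 0 /\ 0 < u.2) \/ hset u.1.1.2 (u.1.1.2 0).+1)) by ctac.
  apply: (@rcomp_permute (xn (xn (xf G))) (xn (xn D)) (fun u => (sval u.1.1, u.1.2, u.2)) 0 0) h.
    by move=> u w; split=> //; exists w.
  by move=> u w; split=> //; exists w.
pose T l m (u : D) : nat := `[< 0 < n0 u /\
    ((hit l (5 + m) (sval u).1 (n0 u) /\ v (sval u).1) \/ hset (sval u).2 (n0 u).+1) >].
have cT : rcomp T.
  have [p1 hp1] : exists p1, forall l m, ev p1 l m = code [:: 4; ev pt l m.+1; ev q l m].
    by exists (PList [:: PC 4; PShM pt; q]) => l m; rewrite ev_PList.
  exists (PList [:: PC 4; PShM p1; pbeta]) => u fs a l m.
  rewrite ev_PList /=; apply: S4 (hbeta _ _ _) _; rewrite -/l -/m.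
  (* After a wrong guess S1 returns the successor of the first number, the table z; this value is
     then discarded because the bit is 1. *)
  pose w : nat := if beta l m u == 0 then nat_of_bool `[< v (sval u).1 >] else (z (sval u).1).+1.
  rewrite hp1; apply: (S4 (b := w)); last first.
    have := ht (u, beta l m u, w) fs a; rewrite /= -/l -/m.
    congr kleene; congr nat_of_bool; congr asbool; congr (_ /\ (_ \/ _)).
    rewrite /w /beta; case: asboolP => h; last first.
      move/contrapT: h => h /=; apply: propext; by case: asboolP => hv; [split | split=> [[]//|[_ /hv]]].
    by apply: propext; split=> [[]|[]].
  apply: (hq (u, beta l m u)) => /=; rewrite /w /beta.
  case: asboolP => [nh|/contrapT[cg hi]] /=; first by rewrite (svalP u); apply: S1.
  have [zs [ez [d0 ltd] ss sp hk]] := hrun _ cg.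
  move: hi; rewrite {1}ez call_indexE // => ei; rewrite -/(n0 u) ei.
  have h := @kleene_shift (ev (sel zs (d (sval u).1)) l (5 + m)) (s (sval u).1)
    (sval u).2 (fa (sval u).1 ++ fs).
  apply: (h [:: _, _, _, _, _ & na u ++ a]) => //=.
    by rewrite size_cat (leq_trans ss) ?leq_addr.
  have := hk (fs ++ [:: (sval u).2]) (0 :: na u ++ a).
  rewrite /= !catA; congr kleene.
    by congr ev; rewrite ?size_cat /= /l /= ?size_cat; lia.
  rewrite -!catA; congr (_ ++ _); last by rewrite drop_cat; case: ltngtP ss => // ->; rewrite subnn drop0 drop_size.
  apply/eq_in_map => j; rewrite (perm_mem sp) mem_iota add0n => /andP[_ js].
  by rewrite nth_cat (leq_trans js ss).
have hI : rcomp (fun l m g => `[< Ifix (H l m g) 1 >]).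
  apply: (@rcomp_Ifix G D (fun u => (sval u).1) (fun u => (sval u).2) T (fun _ _ _ => 1) H) => //.
    exact: comp_cst.
  move=> l m g y n.
  have h0 : ~ stg (H l m g) y 0.
    by apply: (@stg_ind (H l m g) (fun X => ~ X 0)) => [A X hX [a /hX]|X hX [/hX|[]]].
  have h1 : consB n (bset (stg (H l m g) y)) 1 = 0 by rewrite /= /bset asboolF.
  exists (exist _ (g, consB n (bset (stg (H l m g) y))) h1); split=> //=.
  by rewrite /T /= hset_consB /H; case: asbool.
have [p hp] := hI; exists p => g fs a l m.
have := hp g fs a; rewrite -/l -/m; congr kleene; congr nat_of_bool; congr asbool.
apply: propext; split.
  suff: forall n, Ifix (H l m g) n -> cond g /\ v g by apply.
  apply: (@Ifix_ind (H l m g) (fun X => forall n, X n -> cond g /\ v g)).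
    by move=> A X hX n [b /hX].
  by move=> X hX n [/hX//|[_ [[[cg _] vg]|/hX]]].
case=> cg vg; have [zs [ez [d0 ltd] _ _ _]] := hrun _ cg.
pose y := code [:: 6; code [:: 6; ev (sel zs (d g)) l.+1 (5 + m); code (ext (s g) l.+1);
   code (perml 0 (5 + m))]; code (perml 1 l.+1); code (perml 0 (5 + m))].
have y3 : 3 <= y.
  by apply: leq_trans (_ : 6 < y); rewrite // /y code_cons; apply: ltn_cns1.
have hy : hit l.+1 (5 + m) g (y - 2).
  split=> //; rewrite ez call_indexE // -/y; lia.
suff h k : k < y - 2 -> Ifix (H l m g) (y - 2 - k).
  by have := h (y - 3); rewrite (_ : y - 2 - (y - 3) = 1); [apply; lia | lia].
elim: k => [|k IH] lt; apply: Ifix_closed; split; try lia; first by left; rewrite subn0.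
by right; rewrite (_ : (y - 2 - k.+1).+1 = y - 2 - k); [apply: IH; lia | lia].
Qed.

(** * Simulation of arbitrary computations *)

Section KleeneInd.
Variable P : nat -> seq baire -> seq nat -> nat -> Prop.
Let K' d fs a := fun h m => kleene d (h :: fs) a m /\ P d (h :: fs) a m.
Hypothesis h1 : forall fs a1 a, P (code [:: 1]) fs (a1 :: a) a1.+1.
Hypothesis h2 : forall q fs a, P (code [:: 2; q]) fs a q.
Hypothesis h3 : forall fs a1 a, P (code [:: 3]) fs (a1 :: a) a1.
Hypothesis h4 : forall e1 e2 fs a b c, kleene e2 fs a b -> P e2 fs a b ->
  kleene e1 fs (b :: a) c -> P e1 fs (b :: a) c -> P (code [:: 4; e1; e2]) fs a c.
Hypothesis h6 : forall d s t fs a c,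
  perm_eq s (iota 0 (size fs)) -> perm_eq t (iota 0 (size a)) ->
  P d [seq nth (fun=> 0) fs i | i <- s] [seq nth 0 a i | i <- t] c ->
  P (code [:: 6; d; code s; code t]) fs a c.
Hypothesis h7 : forall f1 fs a1 a, P (code [:: 7]) (f1 :: fs) (a1 :: a) (f1 a1).
Hypothesis h8 : forall d fs b a g,
  nmind (FG (K' d fs a)) g -> P (code [:: 8; 3; d]) fs (b :: a) (g b).
Hypothesis h9 : forall d fs a c, P d fs a c -> P (code [:: 9]) fs (d :: a) c.

(** The generated principle has no induction hypothesis for the computations nested in S8;
    [nmind_mono] carries it through the derivation of the induction. *)
Lemma kleene_nested_ind e fs a c : kleene e fs a c -> P e fs a c.
Proof.
move: e fs a c; fix IH 5 => e fs a c [].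
- by move=> *; apply: h1.
- by move=> *; apply: h2.
- by move=> *; apply: h3.
- by move=> e1 e2 fs0 a0 b c0 k2 k1; apply: (h4 k2 _ k1); apply: IH.
- by move=> d s t fs0 a0 c0 ps pt k; apply: h6 => //; apply: IH.
- by move=> *; apply: h7.
- move=> d fs0 b a0 g s; apply: h8.
  refine (nmind_mono (fun f k hfk n => _) s).
  exact (match hfk n with
         | ex_intro2 m km e1 => ex_intro2 _ _ m (conj km (IH _ _ _ _ km)) e1 end).
- by move=> d fs0 a0 c0 k; apply: h9; apply: IH.
Qed.
End KleeneInd.

(* [Cl zs e fs a c]: the table zs answers whether {e}(fs, a) = c', whatever
   arguments are appended. *)
Definition Cl (zs : seq pr) e fs a c : Prop :=
  (0 < e /\ head 0 (decode e) < size zs) /\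
  forall c' fs' a', kleene (ev (sel zs e) (size (fs ++ fs')) (size a').+4) (fs ++ fs')
    [:: code (map enc zs), e, code a, c' & a'] `[< c = c' >].

Record sdat := Sdat
  { d_zs : seq pr; d_e : nat; d_fs : seq baire; d_a : seq nat; d_c : nat; d_y : nat }.

(** The points are the questions to the simulator that fall under one scheme, [d_y] being the
    proposed value. X holds further data, such as subindices and intermediate values, which are not
    passed as arguments and are guessed where needed. *)
Definition sctx (X : Type) (Q : sdat -> X -> Prop) : ctx :=
  @Ctx {w : sdat * X | Q w.1 w.2} (fun w => d_fs (sval w).1)
    (fun w => let u := (sval w).1 in
       [:: code (map enc (d_zs u)); d_e u; code (d_a u); d_y u]).

Lemma comp_na_hd (G : ctx) (hd : G -> nat) (tl : G -> seq nat) :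
  (forall g, na g = hd g :: tl g) -> comp hd.
Proof. by move=> e; exists (PList [:: PC 3]) => g fs a l m; rewrite ev_PList e; apply: S3. Qed.

Lemma comp_na_tl (G : ctx) (hd : G -> nat) (tl : G -> seq nat) (t : G -> nat) :
  (forall g, na g = hd g :: tl g) -> comp (G := @Ctx G fa tl) t -> comp t.
Proof.
move=> e; apply: (@rcomp_permute (@Ctx G fa tl) G id 0 1) => d s.
  by split=> //; exists s.
by rewrite e /=; split=> //; rewrite take0 drop0; exists (s ++ [:: hd d]); rewrite catA.
Qed.

Section SimCtx.
Variables (X : Type) (Q : sdat -> X -> Prop).
Let G := sctx Q.

Lemma sctx_z : comp (fun w : G => code (map enc (d_zs (sval w).1))).
Proof. exact: comp_na_hd. Qed.

Lemma sctx_e : comp (fun w : G => d_e (sval w).1).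
Proof. by apply: comp_na_tl => //; apply: comp_na_hd. Qed.

Lemma sctx_a : comp (fun w : G => code (d_a (sval w).1)).
Proof. by do 2 (apply: comp_na_tl => //); apply: comp_na_hd. Qed.

Lemma sctx_y : comp (fun w : G => d_y (sval w).1).
Proof. by do 3 (apply: comp_na_tl => //); apply: comp_na_hd. Qed.

End SimCtx.

Definition prog (X : Type) (Q : sdat -> X -> Prop) : Prop :=
  crel (G := sctx Q) (fun w => d_c (sval w).1 = d_y (sval w).1).

Lemma progP (X : Type) (Q : sdat -> X -> Prop) : prog Q ->
  exists p, forall zs e fs a c x, 0 < e -> head 0 (decode e) < size zs ->
    sel zs e = p -> (forall y, Q (Sdat zs e fs a c y) x) -> Cl zs e fs a c.
Proof.
case=> p hp; exists p => zs e fs a c x e0 lte es hQ; split=> // y fs' a'.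
by have := hp (exist _ (Sdat zs e fs a c y, x) (hQ y)) fs' a'; rewrite /= es.
Qed.

(** A subcall with a wrongly guessed index may be undefined, so it is made only under [cond], which
    has to imply that the simulation answers it. *)
Lemma crel_Cl (G : ctx) (cond v : G -> Prop) (z d x c s : G -> nat) :
  crel cond -> comp z -> comp d -> comp x -> comp c -> gr s ->
  (forall g, cond g -> exists zs a c0 (n := size (decode (s g))),
     [/\ z g = code (map enc zs), x g = code a,
         n <= size (fa g) /\ perm_eq (decode (s g)) (iota 0 n),
         Cl zs (d g) ([seq nth (fun=> 0) (fa g) i | i <- decode (s g)] ++ drop n (fa g)) a c0 &
         v g <-> c0 = c g]) ->
  crel (fun g => cond g /\ v g).
Proof.
move=> hcond hz hd hx hc hs h; apply: (crel_call hcond hz hd hx hc hs) => g cg.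
have [zs [a [c0 [ez ex [sn pn] [lt hk] ev_]]]] := h g cg.
exists zs; split=> // fs a'; have := hk (c g) fs a'.
rewrite ez ex -catA; rewrite (propext ev_); congr kleene.
by congr ev; rewrite !size_cat size_map size_drop; lia.
Qed.

Lemma crel_Cl0 (G : ctx) (cond v : G -> Prop) (z d x c : G -> nat) :
  crel cond -> comp z -> comp d -> comp x -> comp c ->
  (forall g, cond g -> exists zs a c0,
     [/\ z g = code (map enc zs), x g = code a, Cl zs (d g) (fa g) a c0 & v g <-> c0 = c g]) ->
  crel (fun g => cond g /\ v g).
Proof.
move=> hcond hz hd hx hc h.
apply: (crel_Cl (s := fun=> 0) hcond hz hd hx hc) => [|g cg]; first by ctac.
have [zs [a [c0 [ez ex hk ev_]]]] := h g cg.
by exists zs, a, c0; split=> //=; rewrite drop0.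
Qed.

Local Notation xn2 G := (xn (xn G)).
Local Notation xn4 G := (xn (xn (xn (xn G)))).

Definition Q1 (u : sdat) (_ : unit) : Prop :=
  exists x r, d_a u = x :: r /\ d_c u = x.+1.

Lemma prog1 : prog Q1.
Proof.
have ha := sctx_a Q1; have hy := sctx_y Q1.
have : crel (G := sctx Q1) (fun w => exists x r, code (d_a (sval w).1) = cns x r /\
  d_y (sval w).1 = x.+1) by ctac.
apply: crel_ext => -[[u []] /= [x [r [-> ->]]]]; rewrite code_cons.
by split=> [[_ [_ [/cns_inj[<- _] ->]]]|<-] //; exists x, (code r).
Qed.

Definition Q2 (u : sdat) (_ : unit) : Prop := d_e u = code [:: 2; d_c u].

Lemma prog2 : prog Q2.
Proof.
have he := sctx_e Q2; have hy := sctx_y Q2.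
have : crel (G := sctx Q2) (fun w => d_e (sval w).1 = code [:: 2; d_y (sval w).1]) by ctac.
apply: crel_ext => -[[u []] /= ->]; split=> [/(can_inj CodeSeq.codeK)[]|->] //.
Qed.

Definition Q3 (u : sdat) (_ : unit) : Prop :=
  exists r, d_a u = d_c u :: r.

Lemma prog3 : prog Q3.
Proof.
have ha := sctx_a Q3; have hy := sctx_y Q3.
have : crel (G := sctx Q3) (fun w => exists r, code (d_a (sval w).1) = cns (d_y (sval w).1) r)
  by ctac.
apply: crel_ext => -[[u []] /= [r ->]]; rewrite code_cons.
by split=> [[_ /cns_inj[]]|<-] //; exists (code r).
Qed.

Definition Q4 (u : sdat) (x : nat * nat * nat) : Prop :=
  [/\ d_e u = code [:: 4; x.1.1; x.1.2], Cl (d_zs u) x.1.2 (d_fs u) (d_a u) x.2 &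
      Cl (d_zs u) x.1.1 (d_fs u) (x.2 :: d_a u) (d_c u)].

Lemma prog4 : prog Q4.
Proof.
have hz := sctx_z Q4; have he := sctx_e Q4; have ha := sctx_a Q4; have hy := sctx_y Q4.
(* Guessed are both subindices, the intermediate value b and the code of the extended argument list.
   The second call is made only after the first has confirmed b. *)
pose cond (w : xn4 (sctx Q4)) := d_e (sval w.1.1.1.1).1 = code [:: 4; w.1.1.1.2; w.1.1.2] /\
  w.2 = cns w.1.2 (code (d_a (sval w.1.1.1.1).1)).
have h1 : crel (G := xn4 (sctx Q4)) (fun w => cond w /\ (sval w.1.1.1.1).2.2 = w.1.2).
  apply: (@crel_Cl0 (xn4 (sctx Q4)) cond _ (fun w => code (map enc (d_zs (sval w.1.1.1.1).1)))
    (fun w => w.1.1.2) (fun w => code (d_a (sval w.1.1.1.1).1)) (fun w => w.1.2)); try by cterm.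
    by rewrite /cond; ctac.
  case=> -[] [] [] [[u [[e1 e2] b]] /= [Qe k2 k1]] e1' e2' b' y [/= ee ey].
  move: ee; rewrite Qe => /(can_inj CodeSeq.codeK)[? ?]; subst e1' e2'.
  by exists (d_zs u), (d_a u), b; split.
have h2 : crel (G := xn4 (sctx Q4)) (fun w => (cond w /\ (sval w.1.1.1.1).2.2 = w.1.2) /\
    d_c (sval w.1.1.1.1).1 = d_y (sval w.1.1.1.1).1).
  apply: (@crel_Cl0 (xn4 (sctx Q4)) _ _ (fun w => code (map enc (d_zs (sval w.1.1.1.1).1)))
    (fun w => w.1.1.1.2) (fun w => w.2) (fun w => d_y (sval w.1.1.1.1).1) h1); try by cterm.
  case=> -[] [] [] [[u [[e1 e2] b]] /= [Qe k2 k1]] e1' e2' b' y [[/= ee ->] <-].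
  move: ee; rewrite Qe => /(can_inj CodeSeq.codeK)[? ?]; subst e1' e2'.
  by exists (d_zs u), (b :: d_a u), (d_c u); split.
have h3 : crel (G := sctx Q4) (fun w => exists e1 e2 b y,
    (cond (w, e1, e2, b, y) /\ (sval w).2.2 = b) /\ d_c (sval w).1 = d_y (sval w).1).
  by do 4 apply: crel_ex.
apply: crel_ext h3 => -[[u [[e1 e2] b]] /= [Qe k2 k1]].
split=> [[_ [_ [_ [_ [_ //]]]]]|ec]; exists e1, e2, b, (cns b (code (d_a u))).
by rewrite /cond /= Qe.
Qed.

Definition Q6 (u : sdat) (x : nat * seq nat * seq nat) : Prop :=
  [/\ d_e u = code [:: 6; x.1.1; code x.1.2; code x.2],
      perm_eq x.1.2 (iota 0 (size (d_fs u))), perm_eq x.2 (iota 0 (size (d_a u))) &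
      Cl (d_zs u) x.1.1 [seq nth (fun=> 0) (d_fs u) i | i <- x.1.2]
         [seq nth 0 (d_a u) i | i <- x.2] (d_c u)].

(** The simulated numbers are permuted inside their code; the functions are genuine arguments and
    are permuted by the call itself. *)
Lemma prog6 : prog Q6.
Proof.
have hz := sctx_z Q6; have he := sctx_e Q6; have ha := sctx_a Q6; have hy := sctx_y Q6.
pose cond (w : xn4 (sctx Q6)) :=
  d_e (sval w.1.1.1.1).1 = code [:: 6; w.1.1.1.2; w.1.1.2; w.1.2] /\
  forall k x, Nth w.2 k x <-> exists i, Nth w.1.2 k i /\ Nth (code (d_a (sval w.1.1.1.1).1)) i x.
have h2 : crel (G := xn4 (sctx Q6)) (fun w => cond w /\
    d_c (sval w.1.1.1.1).1 = d_y (sval w.1.1.1.1).1).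
  apply: (@crel_Cl (xn4 (sctx Q6)) cond _ (fun w => code (map enc (d_zs (sval w.1.1.1.1).1)))
    (fun w => w.1.1.1.2) (fun w => w.2) (fun w => d_y (sval w.1.1.1.1).1) (fun w => w.1.1.2));
    try by cterm.
  - by rewrite /cond; ctac.
  - by ctac.
  case=> -[] [] [] [[u [[d s] t]] /= [Qe ps pt k]] d' s' t' y [/= ee ey].
  move: ee; rewrite Qe => /(can_inj CodeSeq.codeK)[? ? ?]; subst d' s' t'.
  exists (d_zs u), [seq nth 0 (d_a u) i | i <- t], (d_c u).
  have ss : size s = size (d_fs u) by rewrite (perm_size ps) size_iota.
  rewrite !CodeSeq.codeK ss drop_size cats0; split=> //.
  apply/eq_codeP => j x; rewrite ey size_map; split.
    case=> i [/Nth_code[jt <-] /Nth_code[lt <-]]; split=> //.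
    by rewrite (nth_map 0).
  case=> jt <-; exists (nth 0 t j); split; first exact/Nth_code.
  rewrite (nth_map 0) //; apply/Nth_code; split=> //.
  by have := mem_nth 0 jt; rewrite (perm_mem pt) mem_iota.
have h3 : crel (G := sctx Q6) (fun w => exists d s t y,
    cond (w, d, s, t, y) /\ d_c (sval w).1 = d_y (sval w).1).
  by do 4 apply: crel_ex.
apply: crel_ext h3 => -[[u [[d s] t]] /= [Qe ps pt k]].
split=> [[_ [_ [_ [_ [_ //]]]]]|ec].
exists d, (code s), (code t), (code [seq nth 0 (d_a u) i | i <- t]).
rewrite /cond /= Qe; split=> //; split=> // j x.
rewrite Nth_code size_map; split=> [[jt <-]|].
  exists (nth 0 t j); split; first exact/Nth_code.
  rewrite (nth_map 0) //; apply/Nth_code; split=> //.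
  by have := mem_nth 0 jt; rewrite (perm_mem pt) mem_iota.
case=> i [/Nth_code[jt <-] /Nth_code[lt <-]]; split=> //.
by rewrite (nth_map 0).
Qed.

Definition Q7 (u : sdat) (x : baire * seq baire * nat) : Prop :=
  d_fs u = x.1.1 :: x.1.2 /\ exists r, d_a u = x.2 :: r /\ d_c u = x.1.1 x.2.

Lemma prog7 : prog Q7.
Proof.
have ha := sctx_a Q7; have hy := sctx_y Q7.
have hf : comp (G := xn2 (sctx Q7)) (fun w => (sval w.1.1).2.1.1 w.1.2).
  apply: (@rcomp_hd (xn2 (sctx Q7)) (fun w => (sval w.1.1).2.1.1)
    (fun w => (sval w.1.1).2.1.2) (fun _ _ w => w.1.2)); last exact: (@comp_wkn (xn (sctx Q7)) _ (comp_var _)).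
  by move=> w /=; case: (svalP w.1.1).
have : crel (G := sctx Q7) (fun w => exists x r, code (d_a (sval w).1) = cns x r /\
  (sval w).2.1.1 x = d_y (sval w).1) by do 2 apply: crel_ex; ctac.
apply: crel_ext => -[[u [[f fs] x]] /= [_ [r /= [-> ->]]]]; rewrite code_cons.
by split=> [[_ [_ [/cns_inj[<- _] ->]]]|<-] //; exists x, (code r).
Qed.

Definition Q9 (u : sdat) (x : nat * seq nat) : Prop :=
  d_a u = x.1 :: x.2 /\ Cl (d_zs u) x.1 (d_fs u) x.2 (d_c u).

Lemma prog9 : prog Q9.
Proof.
have hz := sctx_z Q9; have ha := sctx_a Q9; have hy := sctx_y Q9.
pose cond (w : xn2 (sctx Q9)) := code (d_a (sval w.1.1).1) = cns w.1.2 w.2.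
have h2 : crel (G := xn2 (sctx Q9)) (fun w => cond w /\
    d_c (sval w.1.1).1 = d_y (sval w.1.1).1).
  apply: (@crel_Cl0 (xn2 (sctx Q9)) cond _ (fun w => code (map enc (d_zs (sval w.1.1).1)))
    (fun w => w.1.2) (fun w => w.2) (fun w => d_y (sval w.1.1).1)); try by cterm.
    by rewrite /cond; ctac.
  case=> -[] [[u [d r]] /= [ea k]] d' r'; rewrite /cond /= ea code_cons => /cns_inj[<- <-].
  by exists (d_zs u), r, (d_c u).
have h3 : crel (G := sctx Q9) (fun w => exists d r,
    cond (w, d, r) /\ d_c (sval w).1 = d_y (sval w).1) by do 2 apply: crel_ex.
apply: crel_ext h3 => -[[u [d r]] /= [ea k]].
split=> [[_ [_ [_ //]]]|ec]; exists d, (code r).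
by rewrite /cond /= ea.
Qed.

Definition Q8 (u : sdat) (x : nat * nat * seq nat * cantor) : Prop :=
  [/\ d_e u = code [:: 8; 3; x.1.1.1], d_a u = x.1.1.2 :: x.1.2, d_c u = x.2 x.1.1.2 &
      nmind (FG (fun h m => Cl (d_zs u) x.1.1.1 (h :: d_fs u) x.1.2 m)) x.2].

Lemma prog8 : prog Q8.
Proof.
have hz := sctx_z Q8; have he := sctx_e Q8; have ha := sctx_a Q8; have hy := sctx_y Q8.
(* d, r, b are guessed; for a wrong guess the induction is that of the constant 0 *)
pose cond (w : xn (xn2 (sctx Q8))) := d_e (sval w.1.1.1).1 = code [:: 8; 3; w.1.1.2] /\
  code (d_a (sval w.1.1.1).1) = cns w.2 w.1.2.
have hcond : crel cond by rewrite /cond; ctac.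
have condP w : cond w -> w.1.1.2 = (sval w.1.1.1).2.1.1.1 /\
    w.1.2 = code (sval w.1.1.1).2.1.2 /\ w.2 = (sval w.1.1.1).2.1.1.2.
  case: w => -[] [] [[u [[[d b] r] g]] /= [Qe ea ec k]] d' r' b'; rewrite /cond /= ea Qe.
  by case=> /(can_inj CodeSeq.codeK)[/= <-]; rewrite code_cons => /cns_inj[/= <- <-].
pose DP (v : xn (xn2 (sctx Q8)) * (baire * nat)) := cond v.1 ->
    Cl (d_zs (sval v.1.1.1.1).1) (sval v.1.1.1.1).2.1.1.1 (v.2.1 :: d_fs (sval v.1.1.1.1).1)
      (sval v.1.1.1.1).2.1.2 v.2.2.
pose D := @Ctx {v | DP v} (fun v => (sval v).2.1 :: fa (sval v).1)
  (fun v => na (sval v).1).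
have toD (t : xn (xn2 (sctx Q8)) -> nat) : comp t -> comp (G := D) (fun v => t (sval v).1).
  move=> /rcomp_wkf; apply: (@rcomp_permute (xf (xn (xn2 (sctx Q8)))) D
    (fun v => ((sval v).1, (sval v).2.1)) 0 0) => v s; by split=> //; exists s.
(* [FG] depends only on whether a value of the body is 0, so one question with proposed value 0
   determines the operator. *)
have ht : crel (G := D) (fun v => cond (sval v).1 /\ ~ (cond (sval v).1 /\ (sval v).2.2 = 0)).
  have hcD : crel (G := D) (fun v => cond (sval v).1) by apply: toD hcond.
  apply: crel_and => //; apply: crel_not.
  apply: (@crel_Cl0 D _ _ (fun v => code (map enc (d_zs (sval (sval v).1.1.1.1).1)))
    (fun v => (sval v).1.1.1.2) (fun v => (sval v).1.1.2) (fun=> 0) hcD).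
  - by apply: (toD (fun w => code (map enc (d_zs (sval w.1.1.1).1)))); cterm.
  - by apply: (toD (fun w => w.1.1.2)); cterm.
  - by apply: (toD (fun w => w.1.2)); cterm.
  - exact: comp_cst.
  case=> v hv /= cv; have := hv cv; have [-> [-> _]] := condP _ cv => k.
  by exists (d_zs (sval v.1.1.1.1).1), (sval v.1.1.1.1).2.1.2, v.2.2.
pose g (w : xn (xn2 (sctx Q8))) : cantor :=
  if pselect (cond w) is left _ then (sval w.1.1.1).2.2 else bset (Ifix (fun _ _ => False)).
have hg : comp (G := xn (xn2 (sctx Q8))) (fun w => g w w.2).
  apply: (@rcomp_S8 _ D (fun v => (sval v).1) (fun v => (sval v).2.1) _
    (fun _ _ w => w.2) (fun _ _ => g) _ _ ht) => //; first by cterm.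
  move=> _ _ w; rewrite /g; case: pselect => [cw|ncw].
    have : nmind (FG (fun h m => Cl (d_zs (sval w.1.1.1).1) (sval w.1.1.1).2.1.1.1
        (h :: d_fs (sval w.1.1.1).1) (sval w.1.1.1).2.1.2 m)) (sval w.1.1.1).2.2.
      by case: (svalP w.1.1.1).
    apply: nmind_mono => f k hfk n; have [m hm ->] := hfk n.
    exists (nat_of_bool (m != 0)); last by case: (m) => // j; rewrite minnSS minn0.
    exists (exist DP (w, (consB n f, m)) (fun _ => hm)); split=> //=.
    by congr nat_of_bool; apply/asboolP/idP => [[_ h]|m0]; [apply/eqP => e; apply: h |
      split=> // -[_ e]; rewrite e in m0].
  apply: nmind_Ifix => y n; exists 0; last by rewrite /bset asboolF.
  have nc : cond w -> Cl (d_zs (sval w.1.1.1).1) (sval w.1.1.1).2.1.1.1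
     (consB n (bset (stg (fun _ _ => False) y)) :: d_fs (sval w.1.1.1).1)
     (sval w.1.1.1).2.1.2 0 by [].
  exists (exist DP (w, (consB n (bset (stg (fun _ _ => False) y)), 0)) nc); split=> //=.
  by rewrite asboolF // => -[].
have h3 : crel (G := sctx Q8) (fun w => exists d r b,
    cond (w, d, r, b) /\ nat_of_bool (g (w, d, r, b) b) = d_y (sval w).1).
  by do 3 apply: crel_ex; apply: crel_and => //; apply: crel_eq; cterm.
apply: crel_ext h3 => -[[u [[[d b] r] f]] /= hQ].
have gE (w := exist _ (u, (d, b, r, f)) hQ : sctx Q8) d' r' b' :
    cond (w, d', r', b') -> nat_of_bool (g (w, d', r', b') b') = d_c u.
  move=> cw; rewrite /g; case: pselect => // _ /=; have [_ [_ /= ->]] := condP _ cw.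
  by case: (hQ) => _ _ /= ->.
split=> [[d' [r' [b' [/gE->]]]]//|<-]; exists d, (code r), b.
suff cw : cond (exist _ (u, (d, b, r, f)) hQ, d, code r, b) by split=> //; apply: gE.
by rewrite /cond /=; case: (hQ) => /= -> ->.
Qed.

Theorem simulation : exists zs, forall e fs a c, kleene e fs a c -> Cl zs e fs a c.
Proof.
have [p1 h1] := progP prog1; have [p2 h2] := progP prog2; have [p3 h3] := progP prog3.
have [p4 h4] := progP prog4; have [p6 h6] := progP prog6; have [p7 h7] := progP prog7.
have [p8 h8] := progP prog8; have [p9 h9] := progP prog9.
(* The entries at positions 0 and 5 are fillers: no index begins with these numbers. *)
exists [:: PL; p1; p2; p3; p4; PL; p6; p7; p8; p9] => e fs a c.
have hd x s : 0 < code (x :: s) /\ head 0 (decode (code (x :: s))) = x.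
  by rewrite CodeSeq.codeK code_cons cns_gt0.
elim/kleene_nested_ind => {e fs a c}.
- move=> fs x a; have [e0 eh] := hd 1 [::].
  by apply: (h1 _ _ _ _ _ tt) => //; rewrite /sel ?eh // => y; exists x, a.
- move=> q fs a; have [e0 eh] := hd 2 [:: q].
  by apply: (h2 _ _ _ _ _ tt) => //; rewrite /sel ?eh.
- move=> fs x a; have [e0 eh] := hd 3 [::].
  by apply: (h3 _ _ _ _ _ tt) => //; rewrite /sel ?eh // => y; exists a.
- move=> e1 e2 fs a b c _ k2 _ k1; have [e0 eh] := hd 4 [:: e1; e2].
  by apply: (h4 _ _ _ _ _ (e1, e2, b)) => //; rewrite /sel ?eh.
- move=> d s t fs a c ps pt k; have [e0 eh] := hd 6 [:: d; code s; code t].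
  by apply: (h6 _ _ _ _ _ (d, s, t)) => //; rewrite /sel ?eh.
- move=> f fs x a; have [e0 eh] := hd 7 [::].
  apply: (h7 _ _ _ _ _ (f, fs, x)) => //; rewrite /sel ?eh // => y.
  by split=> //; exists a.
- move=> d fs b a g k; have [e0 eh] := hd 8 [:: 3; d].
  apply: (h8 _ _ _ _ _ (d, b, a, g)) => //; rewrite /sel ?eh // => y; split=> //=.
  by apply: nmind_mono k => f g' h n; have [m [_ hm] e] := h n; exists m.
- move=> d fs a c k; have [e0 eh] := hd 9 [::].
  by apply: (h9 _ _ _ _ _ (d, a)) => //; rewrite /sel ?eh.
Qed.

Lemma computable_graph (f : baire) : computable f ->
  forall (G : ctx) (x y : G -> nat), gr x -> gr y -> crel (fun g => f (x g) = y g).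
Proof.
case=> e he; have [zs hzs] := simulation.
apply: (@crel_gr2 (fun x y => f x = y)) => G x y hx hy.
have h : crel (G := xn G) (fun w => w.2 = code [:: x w.1] /\ f (x w.1) = y w.1).
  apply: (@crel_call (xn G) _ _ (fun=> code (map enc zs)) (fun=> e) (fun w => w.2)
    (fun w => y w.1) (fun=> 0)); try by ctac.
  move=> w ->; have [[e0 eh] hk] := hzs _ _ _ _ (he (x w.1)).
  by exists zs; split=> // fs a; rewrite /= drop0; apply: hk.
apply: crel_ext (crel_ex (P := fun g n => n = code [:: x g] /\ f (x g) = y g) h) => g.
by split=> [[_ [_ ->]]|e0] //; exists (code [:: x g]).
Qed.

(** * Inductions that extend a well-ordering by one element at each stage *)

Definition Af (f : nat -> Prop) (x : nat) : Prop := f (code [:: x; x]).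

Section Run.
Variables N T : (nat -> Prop) -> nat -> Prop.
Hypothesis Nfun : forall f w w', N f w -> N f w' -> w = w'.
Hypothesis Nnew : forall f w, N f w -> ~ Af f w.

(** A stage holds two kinds of codes, told apart by length: pairs for the reflexive order, in which
    w becomes the last element, and triples, closed by 0, for the truth predicate attached to w. *)
Definition grow : op := fun f p => exists w, N f w /\
  ((exists x, p = code [:: x; w] /\ (x = w \/ Af f x)) \/
   (exists s, p = code [:: w; s; 0] /\ T f s)).

Local Notation st := (stg grow).
Local Notation gam := (clord grow).

Lemma st_le d x y : is_ord d ->
  st d (code [:: x; y]) <-> exists2 e, memV e d & N (st e) y /\ (x = y \/ Af (st e) x).
Proof.
move=> od; rewrite stg_ord //; split=> -[e ed].
  by case=> w [Nw [[x' [/(can_inj CodeSeq.codeK)[-> ->] h]]|[s [/(can_inj CodeSeq.codeK)]]]] //; exists e.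
by case=> Ny h; exists e => //; exists y; split=> //; left; exists x.
Qed.

Lemma st_A d x : is_ord d -> Af (st d) x <-> exists2 e, memV e d & N (st e) x.
Proof.
move=> od; rewrite /Af st_le //; split=> -[e ed]; first by case=> Nx _; exists e.
by exists e => //; split=> //; left.
Qed.

Lemma st_T d w s : is_ord d ->
  st d (code [:: w; s; 0]) <-> exists2 e, memV e d & N (st e) w /\ T (st e) s.
Proof.
move=> od; rewrite stg_ord //; split=> -[e ed].
  by case=> w' [Nw [[x' [/(can_inj CodeSeq.codeK)]]|[s' [/(can_inj CodeSeq.codeK)[-> ->] h]]]] //; exists e.
by case=> Nw h; exists e => //; exists w; split=> //; right; exists s.
Qed.

Lemma N_ex d : memV d gam -> exists w, N (st d) w.
Proof. by move=> /clord_least[n [[w [Nw _]] _]]; exists w. Qed.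

Lemma N_end w : ~ N (st gam) w.
Proof.
move=> Nw; apply: (Nnew Nw); apply: Ifix_closed; exists w; split=> //.
by left; exists w; split=> //; left.
Qed.

Lemma N_inj d e w : is_ord d -> is_ord e -> N (st d) w -> N (st e) w -> eqV d e.
Proof.
move=> od oe Nd Ne; case: (ord_trichotomy od oe) => // h.
  by case: (Nnew Ne); apply/st_A => //; exists d.
by case: (Nnew Nd); apply/st_A => //; exists e.
Qed.

Definition rk (w : nat) : V :=
  if pselect (exists d, is_ord d /\ N (st d) w) is left h then projT1 (cid h) else gam.

Lemma rkP d w : is_ord d -> N (st d) w -> eqV (rk w) d.
Proof.
move=> od Nd; rewrite /rk; case: pselect => [h|[]]; last by exists d.
by case: (cid h) => e [oe Ne] /=; apply: N_inj Ne Nd.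
Qed.

Definition initial (d : V) : Prop := is_ord d /\ forall e, memV e d -> memV e gam.

Lemma initial_gam : initial gam.
Proof. by split=> //; apply: clord_ord. Qed.

Lemma initial_mem d e : initial d -> memV e d -> initial e.
Proof.
move=> [od hd] ed; split=> [|e' e'e]; first exact: is_ord_mem ed.
by apply: hd; apply: ord_trans e'e.
Qed.

(** Each stage below d chooses exactly one element and none is chosen twice, so sending an element
    to its stage is an isomorphism of the recorded order onto d. *)
Lemma codes_st (f : baire) d : initial d ->
  (forall x y, code_le f x y <-> st d (code [:: x; y])) -> codes f d.
Proof.
move=> [od hd] hf.
have domP x : code_dom f x <-> exists2 e, memV e d & N (st e) x.
  by rewrite /code_dom hf -st_A.
have rk_mem x : code_dom f x -> memV (rk x) d.
  move=> /domP[e ed Ne]; exact: memV_eqL (rkP (is_ord_mem od ed) Ne) ed.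
have leP x y : code_dom f x -> code_dom f y ->
    code_le f x y <-> memV (rk x) (rk y) \/ eqV (rk x) (rk y).
  move=> /domP[ex xd Nx] /domP[ey yd Ny].
  have ox := is_ord_mem od xd; have oy := is_ord_mem od yd.
  have rx := rkP ox Nx; have ry := rkP oy Ny.
  rewrite hf st_le //; split.
    case=> e ed [Ne [->|]]; first by right; apply: eqV_refl.
    have oe := is_ord_mem od ed; case/st_A => // e' e'e Ne'; left.
    apply: memV_eqL rx _; apply: memV_eqR (_ : memV ex ey) (eqV_sym ry).
    apply: memV_eqL (N_inj ox (is_ord_mem oe e'e) Nx Ne') _.
    exact: memV_eqR e'e (N_inj oe oy Ne Ny).
  case=> h; exists ey => //; split=> //.
    right; apply/st_A => //; exists ex => //.
    exact: memV_eqL (eqV_sym rx) (memV_eqR h ry).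
  left; have e := eqV_trans (eqV_sym rx) (eqV_trans h ry).
  by apply: (@Nfun (st ex)) => //; rewrite (stg_eq grow e).
have eq_rk x y : code_dom f x -> code_dom f y -> eqV (rk x) (rk y) -> x = y.
  move=> /domP[ex xd Nx] /domP[ey yd Ny] h.
  have ox := is_ord_mem od xd; have oy := is_ord_mem od yd.
  have e := eqV_trans (eqV_sym (rkP ox Nx)) (eqV_trans h (rkP oy Ny)).
  by apply: (@Nfun (st ex)) => //; rewrite (stg_eq grow e).
split=> //; last first.
  exists rk; split=> // b bd; have [w Nw] := N_ex (hd _ bd).
  exists w; first by apply/domP; exists b.
  by apply: rkP Nw; apply: is_ord_mem bd.
split.
  move=> x y; rewrite hf => /st_le -/(_ od)[e ed [Ne h]].
  have dy : code_dom f y by apply/domP; exists e.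
  apply/andP; split=> //; case: h => [->//|].
  case/st_A => [|e' e'e Ne']; first exact: is_ord_mem ed.
  by apply/domP; exists e' => //; apply: ord_trans e'e.
move=> A sA [x0 Ax0].
have dA x : x \in A -> code_dom f x by move=> Ax; exact: (sA x Ax).
have [y [x [Ax exy]] hy] := @ord_least (fun y => exists x, x \in A /\ eqV y (rk x)) (rk x0)
  (ex_intro _ x0 (conj Ax0 (eqV_refl _))).
have low z : z \in A -> code_le f x z.
  move=> Az; apply/leP; [exact: dA | exact: dA |].
  have ox := is_ord_mem od (rk_mem _ (dA _ Ax)).
  have oz := is_ord_mem od (rk_mem _ (dA _ Az)).
  case: (ord_trichotomy ox oz) => h; [by left | by right |].
  case: (hy (rk z)); first exact: memV_eqR h (eqV_sym exy).
  by exists z; split=> //; apply: eqV_refl.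
exists x; split=> [|x' [Ax' low']]; first by split.
have h1 := low _ Ax'; have h2 := low' _ Ax.
apply: eq_rk; [exact: dA | exact: dA |].
move: h1 h2 => /leP -/(_ (dA _ Ax) (dA _ Ax')) h1 /leP -/(_ (dA _ Ax') (dA _ Ax)) h2.
have ox := is_ord_mem od (rk_mem _ (dA _ Ax)).
case: h1 h2 => [h1 [h2|h2]|//]; first by case: (ord_asym ox h2 h1).
exact: eqV_sym.
Qed.

End Run.

(** * Definability and the constructible hierarchy *)

(* Formulas without an arity; a variable out of range makes an atomic formula
   false. *)
Inductive rf : Type :=
| RMem of nat & nat | REq of nat & nat | RNot of rf | RAnd of rf & rf | RAll of rf | RBad.

Fixpoint renc (r : rf) : nat :=
  match r with
  | RMem i j => code [:: 0; i; j]
  | REq i j => code [:: 1; i; j]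
  | RNot p => code [:: 2; renc p]
  | RAnd p q => code [:: 3; renc p; renc q]
  | RAll p => code [:: 4; renc p]
  | RBad => 0
  end.

Definition rstep (rec : nat -> rf) (n : nat) : rf :=
  match decode n with
  | [:: 0; i; j] => RMem i j
  | [:: 1; i; j] => REq i j
  | [:: 2; p] => RNot (rec p)
  | [:: 3; p; q] => RAnd (rec p) (rec q)
  | [:: 4; p] => RAll (rec p)
  | _ => RBad
  end.

(** The entries of a coded list are smaller than its code, so fuel n.+1 suffices for n. *)
Fixpoint rdecn (k n : nat) : rf := if k is k'.+1 then rstep (rdecn k') n else RBad.

Definition rdec (n : nat) : rf := rdecn n.+1 n.

Lemma mem_decode v u : v \in decode u -> v < u.
Proof.
by move=> h; have := CodeSeq.ltn_code (decode u); rewrite CodeSeq.decodeK => /allP/(_ v h).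
Qed.

Lemma rstep_ext rec rec' n :
  (forall p, p < n -> rec p = rec' p) -> rstep rec n = rstep rec' n.
Proof.
move=> h; have {}h p : p \in decode n -> rec p = rec' p by move=> /mem_decode /h.
move: h; rewrite /rstep.
case: (decode n) => [|[|[|[|[|[|a]]]]] [|p [|q [|b s]]]] // h; rewrite !h //;
  by rewrite !inE eqxx ?orbT.
Qed.

Lemma rdecn_fuel k n : n < k -> rdecn k n = rdec n.
Proof.
rewrite /rdec; elim/ltn_ind: n k => n IH [//|k] nk /=.
apply: rstep_ext => p pn; rewrite IH //; last by lia.
by case: n IH pn {nk} => // n IH pn; rewrite [RHS]IH //; lia.
Qed.

Lemma rdecE n : rdec n = rstep rdec n.
Proof. by apply: rstep_ext => p pn; apply: rdecn_fuel. Qed.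

Lemma rencK : cancel renc rdec.
Proof.
by elim=> [i j|i j|p IH|p IHp q IHq|p IH|] //=; rewrite rdecE /rstep ?CodeSeq.codeK ?IH ?IHp ?IHq.
Qed.

Fixpoint rsat (M : V) (r : rf) (env : seq V) : Prop :=
  match r with
  | RMem i j => [/\ i < size env, j < size env & memV (nth M env i) (nth M env j)]
  | REq i j => [/\ i < size env, j < size env & eqV (nth M env i) (nth M env j)]
  | RNot p => ~ rsat M p env
  | RAnd p q => rsat M p env /\ rsat M q env
  | RAll p => forall x, memV x M -> rsat M p (x :: env)
  | RBad => False
  end.

Lemma rsat_eq M M' r env env' : eqV M M' -> size env = size env' ->
  (forall i, i < size env -> eqV (nth M env i) (nth M' env' i)) ->
  rsat M r env <-> rsat M' r env'.
Proof.
move=> MM; elim: r env env' => [i j|i j|p IH|p IHp q IHq|p IH|] env env' es he //=.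
- rewrite -es; split=> -[li lj h]; split=> //.
    exact: memV_eqR (memV_eqL (eqV_sym (he _ li)) h) (he _ lj).
  exact: memV_eqR (memV_eqL (he _ li) h) (eqV_sym (he _ lj)).
- rewrite -es; split=> -[li lj h]; split=> //.
    exact: eqV_trans (eqV_trans (eqV_sym (he _ li)) h) (he _ lj).
  exact: eqV_trans (eqV_trans (he _ li) h) (eqV_sym (he _ lj)).
- by rewrite (IH env env').
- by rewrite (IHp env env') // (IHq env env').
- split=> h x xM.
    apply/(IH (x :: env) (x :: env')); [by rewrite /= es | | ].
      by case=> [|i] /= hi; [apply: eqV_refl | apply: he].
    exact: h (memV_eqR xM (eqV_sym MM)).
  apply/(IH (x :: env) (x :: env')); [by rewrite /= es | | ].
    by case=> [|i] /= hi; [apply: eqV_refl | apply: he].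
  exact: h (memV_eqR xM MM).
Qed.

Lemma rsat_eqM M M' r env : eqV M M' -> rsat M r env <-> rsat M' r env.
Proof.
move=> MM; apply: rsat_eq => // i hi; rewrite (set_nth_default M) //; exact: eqV_refl.
Qed.

Definition fenv n (X : 'I_n -> V) : seq V := [seq X i | i <- enum 'I_n].

Lemma size_fenv n (X : 'I_n -> V) : size (fenv X) = n.
Proof. by rewrite size_map size_enum_ord. Qed.

Lemma nth_fenv n (X : 'I_n -> V) M (i : 'I_n) : nth M (fenv X) i = X i.
Proof.
rewrite (nth_map i) ?size_enum_ord //; congr X; apply: val_inj.
by rewrite /= nth_enum_ord.
Qed.

Lemma fenv_cons n x (X : 'I_n -> V) : fenv (env_cons x X) = x :: fenv X.
Proof.
rewrite /fenv enum_ordSl /= -map_comp /env_cons unlift_none; congr (_ :: _).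
by apply: eq_map => i /=; rewrite liftK.
Qed.

Fixpoint form_rf n (phi : form n) : rf :=
  match phi with
  | Fmem _ i j => RMem i j
  | Feq _ i j => REq i j
  | Fnot _ p => RNot (form_rf p)
  | Fand _ p q => RAnd (form_rf p) (form_rf q)
  | Fall _ p => RAll (form_rf p)
  end.

Lemma sat_rsat M n (phi : form n) X : sat M phi X <-> rsat M (form_rf phi) (fenv X).
Proof.
elim: n / phi X => [n i j|n i j|n p IH|n p IHp q IHq|n p IH] X /=.
- by rewrite !nth_fenv size_fenv; split=> [h|[]//]; split.
- by rewrite !nth_fenv size_fenv; split=> [h|[]//]; split.
- by rewrite IH.
- by rewrite IHp IHq.
- by split=> h x /h; rewrite IH fenv_cons.
Qed.

Lemma rf_form r n : exists phi : form n,
  forall M X, sat M phi X <-> rsat M r (fenv X).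
Proof.
(* For n = 0 there is no free variable, so a contradictory formula has to quantify. *)
have [bot hbot] : exists phi : form n, forall M X, ~ sat M phi X.
  pose p := Fall (Feq (@ord0 n) ord0).
  by exists (Fand p (Fnot p)) => M X /= -[].
elim: r n bot hbot => [i j|i j|p IH|p IHp q IHq|p IH|] n bot hbot.
- case: (ltnP i n) => hi; last first.
    by exists bot => M X; split=> [/hbot//|[]]; rewrite size_fenv; lia.
  case: (ltnP j n) => hj; last first.
    by exists bot => M X; split=> [/hbot//|[]]; rewrite size_fenv; lia.
  exists (Fmem (Ordinal hi) (Ordinal hj)) => M X /=.
  rewrite size_fenv -(nth_fenv X M (Ordinal hi)) -(nth_fenv X M (Ordinal hj)).
  by split=> [h|[]//]; split.
- case: (ltnP i n) => hi; last first.
    by exists bot => M X; split=> [/hbot//|[]]; rewrite size_fenv; lia.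
  case: (ltnP j n) => hj; last first.
    by exists bot => M X; split=> [/hbot//|[]]; rewrite size_fenv; lia.
  exists (Feq (Ordinal hi) (Ordinal hj)) => M X /=.
  rewrite size_fenv -(nth_fenv X M (Ordinal hi)) -(nth_fenv X M (Ordinal hj)).
  by split=> [h|[]//]; split.
- by have [f hf] := IH n bot hbot; exists (Fnot f) => M X /=; rewrite hf.
- have [f hf] := IHp n bot hbot; have [g hg] := IHq n bot hbot.
  by exists (Fand f g) => M X /=; rewrite hf hg.
- have [f hf] := IH n.+1 (Fand (Fall (Feq (@ord0 n.+1) ord0))
    (Fnot (Fall (Feq (@ord0 n.+1) ord0)))) (fun M X => fun '(conj a b) => b a).
  by exists (Fall f) => M X /=; split=> h x /h; rewrite hf fenv_cons.
- by exists bot => M X; split=> [/hbot|].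
Qed.

(** * Definable subsets and levels up to [eqV] *)

Definition sepV (M : V) (P : V -> Prop) : V :=
  sup (fun b : {b : idx M | P (elt b)} => elt (sval b)).

Lemma memV_sep M (P : V -> Prop) x : (forall y z, eqV y z -> P y -> P z) ->
  memV x (sepV M P) <-> memV x M /\ P x.
Proof.
move=> hP; split=> [[[b Pb] /= xb]|[[b xb] Px]].
  by split; [exists b | apply: hP Pb; apply: eqV_sym].
by have Pb := hP _ _ xb Px; exists (exist _ b Pb).
Qed.

Lemma rsat_head M r env y z : eqV y z -> rsat M r (y :: env) -> rsat M r (z :: env).
Proof.
move=> yz; apply: (proj1 (@rsat_eq M M r (y :: env) (z :: env) (eqV_refl M) _ _)) => //.
by case=> [|i] hi //=; apply: eqV_refl.
Qed.

Lemma memV_def M x : memV x (defV M) <-> exists n (phi : form n.+1) (P : 'I_n -> V),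
  (forall i, memV (P i) M) /\
  forall y, memV y x <-> memV y M /\ rsat M (form_rf phi) (y :: fenv P).
Proof.
have sepE n (phi : form n.+1) (P : 'I_n -> V) y :
    memV y (sup (fun b : {b : idx M | sat M phi (env_cons (elt b) P)} => elt (sval b))) <->
    memV y M /\ rsat M (form_rf phi) (y :: fenv P).
  have -> : rsat M (form_rf phi) (y :: fenv P) <-> sat M phi (env_cons y P).
    by rewrite sat_rsat fenv_cons.
  apply: (@memV_sep M (fun y => sat M phi (env_cons y P))) => u v uv.
  by rewrite !sat_rsat !fenv_cons; apply: rsat_head.
split.
  case=> -[n [phi P]] /= xs; exists n, phi, (fun i => elt (P i)); split=> [i|y].
    exact: mem_elt.
  rewrite -sepE; split=> h; first exact: memV_eqR h xs.
  exact: memV_eqR h (eqV_sym xs).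
case=> n [phi [P [hP hx]]].
have [p hp] : exists p : 'I_n -> idx M, forall i, eqV (P i) (elt (p i)).
  by exists (fun i => projT1 (cid (hP i))) => i; case: cid.
exists (existT _ n (phi, p)); apply: eqV_ext => y /=; rewrite sepE hx.
have h : rsat M (form_rf phi) (y :: fenv P) <->
         rsat M (form_rf phi) (y :: fenv (fun i => elt (p i))).
  apply: rsat_eq => [||[|i]] /=; [exact: eqV_refl | by rewrite !size_fenv | |].
    by move=> _; apply: eqV_refl.
  rewrite ltnS size_fenv => hi.
  by rewrite (nth_fenv _ _ (Ordinal hi)) (nth_fenv _ _ (Ordinal hi)).
by rewrite h.
Qed.

Lemma defV_eq M M' : eqV M M' -> eqV (defV M) (defV M').
Proof.
move=> MM; have sub (A B : V) : eqV A B -> forall x, memV x (defV A) -> memV x (defV B).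
  move=> AB x /memV_def[n [phi [P [hP hx]]]]; apply/memV_def; exists n, phi, P.
  split=> [i|y]; first exact: memV_eqR (hP i) AB.
  rewrite hx (rsat_eqM _ _ AB); split=> -[yA h]; split=> //.
    exact: memV_eqR yA AB.
  exact: memV_eqR yA (eqV_sym AB).
by apply: eqV_ext => x; split; apply: sub => //; apply: eqV_sym.
Qed.

Lemma L_eq x y : eqV x y -> eqV (L x) (L y).
Proof.
elim: x y => A f IH [B g] [h1 h2]; apply: eqV_ext => z; rewrite /= !memV_bigcup.
split=> [[a za]|[b zb]].
  by have [b ab] := h1 a; exists b; apply: memV_eqR za (defV_eq (IH _ _ ab)).
by have [a ab] := h2 b; exists a; apply: memV_eqR zb (eqV_sym (defV_eq (IH _ _ ab))).
Qed.

Lemma memV_L x d : memV x (L d) <-> exists2 e, memV e d & memV x (defV (L e)).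
Proof.
case: d => A f /=; rewrite memV_bigcup; split=> [[a xa]|[e [/= a ea] xe]].
  by exists (f a) => //; exact: (mem_elt (x := sup f)).
by exists a; apply: memV_eqR xe (defV_eq (L_eq ea)).
Qed.

Lemma L_mono d e x : is_ord d -> memV e d -> memV x (L e) -> memV x (L d).
Proof.
move=> od ed /memV_L[e' e'e xe']; apply/memV_L; exists e' => //.
exact: ord_trans e'e.
Qed.

(** * Names of constructible sets, and truth computed from a stage *)

Definition ltf (f : nat -> Prop) (x y : nat) : Prop := f (code [:: x; y]) /\ x <> y.

(* The name code [:: c; phi; p] denotes the set defined over L_c by the formula
   phi from the parameters named by p. *)
Inductive Nm (f : nat -> Prop) : nat -> Prop :=
| Nm_intro c phi p : Af f c -> (forall i v, Nth p i v -> Nm f v) ->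
    (forall i v, Nth p i v -> exists c' r, v = cns c' r /\ ltf f c' c) ->
    Nm f (code [:: c; phi; p]).

(** If c was chosen at stage e, these are the names of the elements of L_e. *)
Definition lv (f : nat -> Prop) (c w : nat) : Prop :=
  Nm f w /\ exists c' r, w = cns c' r /\ ltf f c' c.

Definition fact (f : nat -> Prop) (c phi e : nat) : Prop :=
  f (code [:: c; cns phi e; 0]).

(** This is [renc (REq 0 1)]. *)
Definition req01 : nat := code [:: 1; 0; 1].

(** The level of w may exceed that of u, whereas truth of the formula of u is recorded only for
    names below its head c'. So w is replaced by such a name w', equal to it by the truth recorded
    at c. *)
Definition memat (f : nat -> Prop) (c w u : nat) : Prop :=
  exists c' chi r w', u = code [:: c'; chi; r] /\ lv f c' w' /\
    fact f c req01 (code [:: w; w']) /\ fact f c' chi (cns w' r).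

(** Extensionality, tested at a level c not below the levels of u and v, where all elements of both
    sets have names. *)
Definition Qf (f : nat -> Prop) (u v : nat) : Prop :=
  exists c, Af f c /\ (exists c1 r1, u = cns c1 r1 /\ f (code [:: c1; c])) /\
    (exists c2 r2, v = cns c2 r2 /\ f (code [:: c2; c])) /\
    forall w, lv f c w -> (memat f c w u <-> memat f c w v).

Definition Ef (f : nat -> Prop) (u v : nat) : Prop :=
  exists c chi r u', v = code [:: c; chi; r] /\ lv f c u' /\ Qf f u u' /\
    fact f c chi (cns u' r).

Fixpoint tsat (f : nat -> Prop) (r : rf) (e : nat) : Prop :=
  match r with
  | RMem i j => exists u v, Nth e i u /\ Nth e j v /\ Ef f u v
  | REq i j => exists u v, Nth e i u /\ Nth e j v /\ Qf f u v
  | RNot p => ~ tsat f p e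
  | RAnd p q => tsat f p e /\ tsat f q e
  | RAll p => forall u, Nm f u -> tsat f p (cns u e)
  | RBad => False
  end.

Definition Tr (f : nat -> Prop) (s : nat) : Prop :=
  exists phi e, s = cns phi e /\ tsat f (rdec phi) e.

(** * Correctness of the truth computed from a stage *)

Section Truth.
Variable N : (nat -> Prop) -> nat -> Prop.
Hypothesis Nfun : forall f w w', N f w -> N f w' -> w = w'.
Hypothesis Nnew : forall f w, N f w -> ~ Af f w.

Local Notation st := (stg (grow N Tr)).
Local Notation gam := (clord (grow N Tr)).
Local Notation rk := (rk N Tr).
Local Notation initial := (initial N Tr).

Definition vstep (rec : nat -> V) (u : nat) : V :=
  match decode u with
  | [:: c; phi; p] =>
      sepV (L (rk c)) (fun x => rsat (L (rk c)) (rdec phi) (x :: [seq rec v | v <- decode p]))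
  | _ => sup (fun v : void => match v with end)
  end.

Fixpoint valn (k u : nat) : V :=
  if k is k'.+1 then vstep (valn k') u else sup (fun v : void => match v with end).

Definition val (u : nat) : V := valn u.+1 u.

Lemma vstep_ext rec rec' u :
  (forall v, v < u -> rec v = rec' v) -> vstep rec u = vstep rec' u.
Proof.
rewrite /vstep => h; case e : (decode u) => [|c [|phi [|p [|? ?]]]] //.
have pu : p < u by apply: mem_decode; rewrite e !inE eqxx !orbT.
have -> // : [seq rec v | v <- decode p] = [seq rec' v | v <- decode p].
by apply/eq_in_map => v /mem_decode vp; apply: h; apply: ltn_trans pu.
Qed.

Lemma valn_fuel k u : u < k -> valn k u = val u.
Proof.
rewrite /val; elim/ltn_ind: u k => u IH [//|k] uk /=.
apply: vstep_ext => v vu; rewrite IH //; last by lia.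
by case: u IH vu {uk} => // u IH vu; rewrite [RHS]IH //; lia.
Qed.

Lemma val_code c phi p : val (code [:: c; phi; p]) =
  sepV (L (rk c)) (fun x => rsat (L (rk c)) (rdec phi) (x :: [seq val v | v <- decode p])).
Proof.
have -> : val (code [:: c; phi; p]) = vstep val (code [:: c; phi; p]).
  by apply: vstep_ext => v vu; apply: valn_fuel.
by rewrite /vstep CodeSeq.codeK.
Qed.

(** The names seen from outside: levels are measured by the ordinals at which their heads are
    chosen, not by the order in a stage. *)
Inductive NM : V -> nat -> Prop :=
| NM_intro d e c phi p : memV e d -> N (st e) c ->
    (forall v, v \in decode p -> NM e v) -> NM d (code [:: c; phi; p]).

Lemma NM_inv d u : NM d u -> exists e c phi p, [/\ u = code [:: c; phi; p], memV e d,
  N (st e) c & forall v, v \in decode p -> NM e v].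
Proof. by case=> d' e c phi p ed Nc hp; exists e, c, phi, p. Qed.

Lemma NM_eq d d' u : eqV d d' -> NM d u -> NM d' u.
Proof.
move=> dd /NM_inv[e [c [phi [p [-> ed Nc hp]]]]].
exact: NM_intro _ (memV_eqR ed dd) Nc hp.
Qed.

Lemma NM_mono d e u : is_ord d -> memV e d -> NM e u -> NM d u.
Proof.
move=> od ed /NM_inv[e' [c [phi [p [-> e'e Nc hp]]]]].
exact: NM_intro _ (ord_trans od ed e'e) Nc hp.
Qed.

(** An element is chosen at one stage only, so the head of a name determines its level. *)
Lemma NM_head d e u c r : is_ord d -> is_ord e -> NM d u -> u = cns c r ->
  N (st e) c -> forall e', memV e e' -> NM e' u.
Proof.
move=> od oe /NM_inv[e1 [c1 [phi [p [-> e1d Nc1 hp]]]]] /cns_inj[ec _] Nc e' ee'.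
rewrite ec in Nc1 *; have h := N_inj Nnew (is_ord_mem od e1d) oe Nc1 Nc.
by apply: (NM_intro _ ee' Nc) => v /hp; apply: NM_eq.
Qed.

Lemma ltf_st d c c' e : is_ord d -> memV e d -> N (st e) c ->
  ltf (st d) c' c <-> exists2 e', memV e' e & N (st e') c'.
Proof.
move=> od ed Nc; have oe := is_ord_mem od ed; rewrite /ltf st_le //; split.
  case=> -[e1 e1d [Nc1 h]] ne; case: h => [//|/st_A].
  case=> [|e' e'e1 Nc']; first exact: is_ord_mem e1d.
  by exists e' => //; apply: memV_eqR e'e1 (N_inj Nnew (is_ord_mem od e1d) oe Nc1 Nc).
case=> e' e'e Nc'; have A' : Af (st e) c' by apply/st_A => //; exists e'.
by split; [exists e => //; split=> //; right | move=> eq; rewrite eq in A'; case: (Nnew Nc A')].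
Qed.

Lemma Nth_mem p v : v \in decode p <-> exists i, Nth p i v.
Proof.
split=> [h|[i [hi <-]]]; last exact: mem_nth.
by exists (index v (decode p)); split; [rewrite index_mem | apply: nth_index].
Qed.

Lemma NmP d u : is_ord d -> Nm (st d) u <-> NM d u.
Proof.
move=> od; split.
  elim=> {u} c phi p /st_A -/(_ od)[e ed Nc] _ IH hl; apply: (NM_intro _ ed Nc).
  move=> v /Nth_mem[i hi]; have [c' [r [ev_ /(ltf_st _ od ed Nc)[e' e'e Nc']]]] := hl i v hi.
  have oe := is_ord_mem od ed.
  exact: (NM_head od (is_ord_mem oe e'e) (IH i v hi) ev_ Nc' e'e).
elim/ltn_ind: u => u IH /NM_inv[e [c [phi [p [eu ed Nc hp]]]]].
have pu : p < u by apply: mem_decode; rewrite eu CodeSeq.codeK !inE eqxx !orbT.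
rewrite eu; apply: Nm_intro; first by apply/st_A => //; exists e.
  move=> i v hi; have pv : v \in decode p by apply/Nth_mem; exists i.
  apply: IH; first by apply: ltn_trans pu; apply: mem_decode.
  exact: NM_mono od ed (hp v pv).
move=> i v hi; have /hp/NM_inv[e' [c' [phi' [p' [-> e'e Nc' _]]]]] : v \in decode p.
  by apply/Nth_mem; exists i.
by exists c', (code [:: phi'; p']); split=> //; apply/(ltf_st _ od ed Nc); exists e'.
Qed.

Lemma lvP d e c w : is_ord d -> memV e d -> N (st e) c -> lv (st d) c w <-> NM e w.
Proof.
move=> od ed Nc; have oe := is_ord_mem od ed; rewrite /lv NmP //; split.
  case=> NMw [c' [r [ew /(ltf_st _ od ed Nc)[e' e'e Nc']]]].
  exact: (NM_head od (is_ord_mem oe e'e) NMw ew Nc' e'e).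
move=> h; split; first exact: NM_mono h.
have [e' [c' [phi' [p' [-> e'e Nc' _]]]]] := NM_inv h.
by exists c', (code [:: phi'; p']); split=> //; apply/(ltf_st _ od ed Nc); exists e'.
Qed.

Lemma Lrk e c : is_ord e -> N (st e) c -> eqV (L (rk c)) (L e).
Proof. by move=> oe Nc; apply: L_eq; apply: rkP. Qed.

Lemma mem_val e c phi p x : is_ord e -> N (st e) c ->
  memV x (val (code [:: c; phi; p])) <->
  memV x (L e) /\ rsat (L e) (rdec phi) (x :: [seq val v | v <- decode p]).
Proof.
move=> oe Nc; have h := Lrk oe Nc; rewrite val_code memV_sep; last first.
  by move=> y z yz; apply: rsat_head.
rewrite (rsat_eqM _ _ h); split=> -[xL hx]; split=> //.
  exact: memV_eqR xL h.
exact: memV_eqR xL (eqV_sym h).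
Qed.

Lemma fenv_nth (T : eqType) (d0 : T) (s : seq T) (F : T -> V) :
  fenv (fun i : 'I_(size s) => F (nth d0 s i)) = [seq F v | v <- s].
Proof.
have h : [seq F (nth d0 s i) | i <- map (@nat_of_ord (size s)) (enum 'I_(size s))] =
   [seq F v | v <- s].
  by rewrite val_enum_ord -{3}(mkseq_nth d0 s) /mkseq -map_comp.
by rewrite -h -map_comp.
Qed.

Lemma val_L d u : is_ord d -> NM d u -> memV (val u) (L d).
Proof.
move=> od h; elim: h od => {}d e c phi p ed Nc hp IH od; have oe := is_ord_mem od ed.
apply/memV_L; exists e => //; apply/memV_def.
have [psi hpsi] := rf_form (rdec phi) (size (decode p)).+1.
exists (size (decode p)), psi, (fun i => val (nth 0 (decode p) i)); split=> [i|y].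
  by apply: IH => //; apply: mem_nth.
by rewrite (mem_val _ _ _ oe Nc) -(fenv_nth 0) -fenv_cons -hpsi sat_rsat fenv_cons.
Qed.

(** The induction has not stopped before d, so every level e below d has a chosen element to serve
    as head; the parameters are named by induction. *)
Lemma L_name d x : initial d -> memV x (L d) -> exists2 u, NM d u & eqV x (val u).
Proof.
elim/memV_ind: d x => d IH x id_ /memV_L[e ed /memV_def[n [phi [P [hP hx]]]]].
have ie := initial_mem id_ ed; have oe := proj1 ie.
have [c Nc] := N_ex (proj2 id_ e ed).
have [U hU] : exists U : 'I_n -> nat, forall i, NM e (U i) /\ eqV (P i) (val (U i)).
  have h i : exists u, NM e u /\ eqV (P i) (val u).
    by have [u h1 h2] := IH e ed (P i) ie (hP i); exists u.
  by exists (fun i => projT1 (cid (h i))) => i; case: cid.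
exists (code [:: c; renc (form_rf phi); code [seq U i | i <- enum 'I_n]]).
  apply: (NM_intro _ ed Nc) => v; rewrite CodeSeq.codeK => /mapP[i _ ->].
  by case: (hU i).
apply: eqV_ext => y; rewrite hx (mem_val _ _ _ oe Nc) CodeSeq.codeK rencK -map_comp.
rewrite (_ : rsat _ _ (y :: fenv P) <->
  rsat (L e) (form_rf phi) (y :: [seq (val \o U) i | i <- enum 'I_n])) //.
apply: rsat_eq => [||[|i]] /=; [exact: eqV_refl | by rewrite size_fenv size_map size_enum_ord | |].
  by move=> _; apply: eqV_refl.
rewrite ltnS size_fenv => hi; rewrite (nth_fenv _ _ (Ordinal hi)).
by rewrite (nth_fenv (fun i => val (U i)) _ (Ordinal hi)); case: (hU (Ordinal hi)).
Qed.

Definition tcorrect (d : V) : Prop := forall r e, (forall v, v \in decode e -> NM d v) ->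
  tsat (st d) r e <-> rsat (L d) r [seq val v | v <- decode e].

Section Step.
Variable d : V.
Hypothesis id_ : initial d.
Hypothesis IH : forall e, memV e d -> tcorrect e.
Let od : is_ord d := proj1 id_.

(** The induction on levels enters here: what was recorded at e is correct by the hypothesis for
    e. *)
Lemma fact_st e c phi p : memV e d -> N (st e) c -> (forall v, v \in decode p -> NM e v) ->
  fact (st d) c phi p <-> rsat (L e) (rdec phi) [seq val v | v <- decode p].
Proof.
move=> ed Nc hp; rewrite /fact (st_T N Tr) // -IH //; split=> [[e' e'd [Nc' h]]|h].
  have oe := is_ord_mem od ed; have oe' := is_ord_mem od e'd.
  case: h => phi' [p' [/cns_inj[-> ->]]].
  by rewrite (stg_eq _ (N_inj Nnew oe oe' Nc Nc')).
by exists e => //; split=> //; exists phi, p.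
Qed.

Lemma mem_name e c chi r w : memV e d -> N (st e) c -> (forall v, v \in decode r -> NM e v) ->
  NM e w -> memV (val w) (val (code [:: c; chi; r])) <-> fact (st d) c chi (cns w r).
Proof.
move=> ed Nc hr hw; have oe := is_ord_mem od ed.
rewrite (fact_st _ ed Nc) ?decode_cns; last by move=> v; rewrite inE => /orP[/eqP->|/hr].
rewrite (mem_val _ _ _ oe Nc) /=; split=> [[]//|h]; split=> //.
exact: val_L.
Qed.

Lemma NM_weak e e' w : is_ord e -> memV e' e \/ eqV e' e -> NM e' w -> NM e w.
Proof. by move=> oe [h|h]; [apply: NM_mono | apply: NM_eq]. Qed.

Lemma memat_st e c w u e1 c1 r1 : memV e d -> N (st e) c -> NM e w -> NM d u ->
  u = cns c1 r1 -> N (st e1) c1 -> memV e1 d -> memV e1 e \/ eqV e1 e ->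
  memat (st d) c w u <-> memV (val w) (val u).
Proof.
move=> ed Nc hw hu eu Nc1 e1d e1e; have oe := is_ord_mem od ed; have oe1 := is_ord_mem od e1d.
have [e2 [c2 [chi [r [eu2 e2d Nc2 hr]]]]] := NM_inv hu.
have ec : c2 = c1 by move: eu; rewrite eu2 code_cons => /cns_inj[].
subst c2; have e21 := N_inj Nnew (is_ord_mem od e2d) oe1 Nc2 Nc1.
have {}hr v : v \in decode r -> NM e1 v by move=> /hr; apply: NM_eq.
have eqfact w' : NM e1 w' -> fact (st d) c req01 (code [:: w; w']) <-> eqV (val w) (val w').
  move=> hw'; rewrite (fact_st _ ed Nc) ?CodeSeq.codeK; last first.
    by move=> v; rewrite !inE => /orP[/eqP->//|/eqP->]; apply: NM_weak hw'.
  by rewrite (rencK (REq 0 1)) /=; split=> [[]//|h]; split.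
split.
  case=> c' [chi' [r' [w' []]]]; rewrite eu2 => /(can_inj CodeSeq.codeK)[<- <- <-].
  case=> /(lvP _ od e1d Nc1) hw' [/(eqfact _ hw') h hf].
  by apply: memV_eqL h _; apply/(mem_name _ e1d Nc1).
move=> h; have [xL _] := proj1 (mem_val chi r (val w) oe1 Nc1) (eq_ind _ (fun u => memV (val w) (val u)) h _ eu2).
have [w' hw' e'] := L_name (initial_mem id_ e1d) xL.
exists c1, chi, r, w'; split=> //; split; first exact/(lvP _ od e1d Nc1).
split; first exact/eqfact.
by apply/(mem_name _ e1d Nc1) => //; rewrite -eu2; apply: memV_eqL h; apply: eqV_sym.
Qed.

Lemma le_st e1 c1 e c : memV e1 d -> N (st e1) c1 -> memV e d -> N (st e) c ->
  st d (code [:: c1; c]) <-> memV e1 e \/ eqV e1 e.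
Proof.
move=> e1d Nc1 ed Nc; have oe := is_ord_mem od ed; have oe1 := is_ord_mem od e1d.
rewrite (st_le N Tr) //; split.
  case=> e2 e2d [Nc2 h]; have e2e := N_inj Nnew (is_ord_mem od e2d) oe Nc2 Nc.
  case: h => [eq|/st_A -/(_ (is_ord_mem od e2d))[e3 e3e2 Nc3]].
    by right; rewrite eq in Nc1; exact: (N_inj Nnew oe1 oe Nc1 Nc).
  left; apply: memV_eqL (N_inj Nnew oe1 _ Nc1 Nc3) (memV_eqR e3e2 e2e).
  exact: is_ord_mem (is_ord_mem od e2d) e3e2.
case=> h; exists e => //; split=> //; first by right; apply/st_A => //; exists e1.
by left; apply: (@Nfun (st e1)) => //; rewrite (stg_eq _ h).
Qed.

(** Both sets are included in L_e for e the larger of the two levels, and every element of L_e has a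
    name, so comparing named elements compares the sets. *)
Lemma Qf_st u v : NM d u -> NM d v -> Qf (st d) u v <-> eqV (val u) (val v).
Proof.
move=> hu hv.
have [e1 [c1 [phi1 [p1 [eu e1d Nc1 _]]]]] := NM_inv hu.
have [e2 [c2 [phi2 [p2 [ev_ e2d Nc2 _]]]]] := NM_inv hv.
have o1 := is_ord_mem od e1d; have o2 := is_ord_mem od e2d.
have eu' : u = cns c1 (code [:: phi1; p1]) by rewrite eu.
have ev' : v = cns c2 (code [:: phi2; p2]) by rewrite ev_.
have memE e c w : memV e d -> N (st e) c -> NM e w ->
    memV e1 e \/ eqV e1 e -> memV e2 e \/ eqV e2 e ->
    (memat (st d) c w u <-> memV (val w) (val u)) /\
    (memat (st d) c w v <-> memV (val w) (val v)).
  move=> ed Nc hw h1 h2.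
  by split; [exact: (memat_st ed Nc hw hu eu' Nc1 e1d h1) | exact: (memat_st ed Nc hw hv ev' Nc2 e2d h2)].
split.
  case=> c [/st_A -/(_ od)[e ed Nc] [[c1' [r1 [eq1 h1]]] [[c2' [r2 [eq2 h2]]] hw]]].
  have oe := is_ord_mem od ed.
  rewrite eu' in eq1; rewrite ev' in eq2.
  have [? _] := cns_inj eq1; have [? _] := cns_inj eq2; subst c1' c2'.
  have {}h1 := proj1 (le_st e1d Nc1 ed Nc) h1; have {}h2 := proj1 (le_st e2d Nc2 ed Nc) h2.
  have ie := initial_mem id_ ed.
  have sub x : (exists2 e', memV e' e \/ eqV e' e & memV x (L e')) -> exists2 w, NM e w & eqV x (val w).
    case=> e' [h|h] xL; apply: L_name => //; first exact: L_mono xL.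
    exact: memV_eqR xL (L_eq h).
  apply: eqV_ext => x; split=> hx.
    have [|w NMw xw] := sub x.
      exists e1 => //; move: hx; rewrite eu => /(mem_val _ _ _ o1 Nc1)[].
      by [].
    have [m1 m2] := memE e c w ed Nc NMw h1 h2.
    have [hw1 _] := hw w (proj2 (lvP _ od ed Nc) NMw).
    exact: memV_eqL xw (proj1 m2 (hw1 (proj2 m1 (memV_eqL (eqV_sym xw) hx)))).
  have [|w NMw xw] := sub x.
    exists e2 => //; move: hx; rewrite ev_ => /(mem_val _ _ _ o2 Nc2)[].
    by [].
  have [m1 m2] := memE e c w ed Nc NMw h1 h2.
  have [_ hw2] := hw w (proj2 (lvP _ od ed Nc) NMw).
  exact: memV_eqL xw (proj1 m1 (hw2 (proj2 m2 (memV_eqL (eqV_sym xw) hx)))).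
move=> h; have [e [c [ed Nc h1 h2]]] : exists e c, [/\ memV e d, N (st e) c,
    memV e1 e \/ eqV e1 e & memV e2 e \/ eqV e2 e].
  case: (ord_trichotomy o1 o2) => h12.
  - by exists e2, c2; split=> //; [left | right; apply: eqV_refl].
  - by exists e2, c2; split=> //; [right | right; apply: eqV_refl].
  - by exists e1, c1; split=> //; [right; apply: eqV_refl | left].
exists c; split; first by apply/st_A => //; exists e.
split; first by exists c1, (code [:: phi1; p1]); split=> //; apply/(le_st e1d Nc1 ed Nc).
split; first by exists c2, (code [:: phi2; p2]); split=> //; apply/(le_st e2d Nc2 ed Nc).
move=> w /(lvP _ od ed Nc) NMw; have [-> ->] := memE e c w ed Nc NMw h1 h2.
by split=> hw; [apply: memV_eqR hw h | apply: memV_eqR hw (eqV_sym h)].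
Qed.

Lemma Ef_st u v : NM d u -> NM d v -> Ef (st d) u v <-> memV (val u) (val v).
Proof.
move=> hu hv; have [e [c [chi [r [ev_ ed Nc hr]]]]] := NM_inv hv.
have oe := is_ord_mem od ed; split.
  case=> c' [chi' [r' [u' []]]]; rewrite ev_ => /(can_inj CodeSeq.codeK)[<- <- <-].
  case=> /(lvP _ od ed Nc) hu' [/Qf_st -/(_ hu (NM_mono od ed hu')) h hf].
  by apply: memV_eqL h _; apply/(mem_name _ ed Nc).
move=> h; have [xL _] := proj1 (mem_val chi r (val u) oe Nc) (eq_ind _ (fun v => memV (val u) (val v)) h _ ev_).
have [u' hu' e'] := L_name (initial_mem id_ ed) xL.
exists c, chi, r, u'; split=> //; split; first exact/(lvP _ od ed Nc).
split; first by apply/Qf_st => //; apply: NM_mono hu'.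
by apply/(mem_name _ ed Nc) => //; rewrite -ev_; apply: memV_eqL h; apply: eqV_sym.
Qed.

Lemma tcorrect_step : tcorrect d.
Proof.
elim=> [i j|i j|p IHp|p IHp q IHq|p IHp|] e he /=.
- rewrite size_map; split.
    case=> u [v [[li <-] [[lj <-]]]] /Ef_st h; split=> //.
    by rewrite !(nth_map 0) //; apply: h; apply: he; apply: mem_nth.
  case=> li lj; rewrite !(nth_map 0) // => h.
  exists (nth 0 (decode e) i), (nth 0 (decode e) j); split=> //; split=> //.
  by apply/Ef_st => //; apply: he; apply: mem_nth.
- rewrite size_map; split.
    case=> u [v [[li <-] [[lj <-]]]] /Qf_st h; split=> //.
    by rewrite !(nth_map 0) //; apply: h; apply: he; apply: mem_nth.
  case=> li lj; rewrite !(nth_map 0) // => h.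
  exists (nth 0 (decode e) i), (nth 0 (decode e) j); split=> //; split=> //.
  by apply/Qf_st => //; apply: he; apply: mem_nth.
- by rewrite IHp.
- by rewrite IHp // IHq.
- have hcons u : NM d u -> forall v, v \in decode (cns u e) -> NM d v.
    by move=> hu v; rewrite decode_cns inE => /orP[/eqP->|/he].
  split=> h.
    move=> x /(L_name id_)[u hu xu].
    have := h u; rewrite NmP // IHp; last exact: hcons.
    by rewrite decode_cns => /(_ hu); apply: rsat_head; apply: eqV_sym.
  move=> u /NmP -/(_ od) hu; rewrite IHp; last exact: hcons.
  by rewrite decode_cns; apply: h; apply: val_L.
- by [].
Qed.

End Step.

Lemma truth d : initial d -> tcorrect d.
Proof.
elim/memV_ind: d => d IH id_; apply: tcorrect_step => // e ed.
by apply: IH => //; apply: initial_mem ed.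
Qed.

End Truth.

(** * The operator and its computability *)

Definition glt (g : baire) (y x : nat) : Prop := code_le g y x /\ ~ code_le g x y.

(* Elements code [:: x] list the given ordinal, 0 is its successor, and
   code [:: phi; e] is put at the level where phi(e) was found to be true. *)
Definition cand (g : baire) (f : nat -> Prop) (w : nat) : Prop :=
  (exists x, code_dom g x /\ w = code [:: x] /\
     forall y, code_dom g y -> glt g y x -> Af f (code [:: y])) \/
  ((forall x, code_dom g x -> Af f (code [:: x])) /\
   (w = 0 \/ exists phi e, w = code [:: phi; e] /\
      (forall i v, Nth e i v -> Nm f v) /\ Tr f (cns phi e))).

Definition next (g : baire) (f : nat -> Prop) (w : nat) : Prop :=
  (~ Af f w /\ cand g f w) /\ forall w', w' < w -> ~ (~ Af f w' /\ cand g f w').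

Lemma next_fun g f w w' : next g f w -> next g f w' -> w = w'.
Proof. by case=> h1 h2 [h3 h4]; case: (ltngtP w w') => [/h4|/h2|]. Qed.

Lemma next_new g f w : next g f w -> ~ Af f w.
Proof. by case=> -[]. Qed.

Lemma next_ex g f w : cand g f w -> ~ Af f w -> exists v, next g f v.
Proof.
move=> cw nw; have h : exists v, `[< ~ Af f v /\ cand g f v >] by exists w; apply/asboolP.
case: (ex_minnP h) => v /asboolP hv hmin; exists v; split=> // w' lt /asboolP/hmin.
by rewrite leqNgt lt.
Qed.

(** * Computability of names, truth and the operator *)

Lemma crel_Af (G : ctx) (f : G -> nat -> Prop) (x : G -> nat) :
  cset f -> gr x -> crel (fun g => Af (f g) (x g)).
Proof. by move=> hf hx; rewrite /Af; ctac. Qed.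

Ltac crel_atoms4 :=
  lazymatch goal with
  | |- @crel ?G (fun g => Af (@?f g) (@?x g)) => apply (@crel_Af G f x)
  | |- _ => crel_atoms3
  end.
Ltac crel_user ::= crel_atoms4; cbn beta.

Lemma crel_ltf (G : ctx) (f : G -> nat -> Prop) (x y : G -> nat) :
  cset f -> gr x -> gr y -> crel (fun g => ltf (f g) (x g) (y g)).
Proof. by move=> hf hx hy; rewrite /ltf; ctac. Qed.

Lemma crel_fact (G : ctx) (f : G -> nat -> Prop) (x y z : G -> nat) :
  cset f -> gr x -> gr y -> gr z -> crel (fun g => fact (f g) (x g) (y g) (z g)).
Proof. by move=> hf hx hy hz; rewrite /fact; ctac. Qed.

Ltac crel_atoms5 :=
  lazymatch goal with
  | |- @crel ?G (fun g => ltf (@?f g) (@?x g) (@?y g)) => apply (@crel_ltf G f x y)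
  | |- @crel ?G (fun g => fact (@?f g) (@?x g) (@?y g) (@?z g)) =>
      apply (@crel_fact G f x y z)
  | |- _ => crel_atoms4
  end.
Ltac crel_user ::= crel_atoms5; cbn beta.

Lemma ltn_well_founded : well_founded (fun x y : nat => x < y).
Proof. by elim/ltn_ind => n IH; constructor=> m /IH. Qed.

Lemma cset_Nm (G : ctx) (f : G -> nat -> Prop) : cset f -> cset (fun g => Nm (f g)).
Proof.
move=> hf.
pose H g : op := fun X u => exists c phi p, u = code [:: c; phi; p] /\ Af (f g) c /\
  forall i v, Nth p i v -> X v /\ exists c' r, v = cns c' r /\ ltf (f g) c' c.
apply: (@cset_rec (fun x y => x < y) G H); [exact: ltn_well_founded | | | ].
- by move=> D x y hx hy; ctac.
- by move=> D pi Y n wpi hY hn; have hf' := wpi _ hf; rewrite /H; ctac.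
move=> g u; rewrite /H; split.
  case=> c phi p A h1 h2; exists c, phi, p; split=> //; split=> // i v hi; split.
    split; last exact: h1 hi.
    have vp : v \in decode p by apply/Nth_mem; exists i.
    apply: ltn_trans (mem_decode vp) _; apply: mem_decode.
    by rewrite CodeSeq.codeK !inE eqxx !orbT.
  exact: h2 hi.
case=> c [phi [p [-> [A h]]]]; apply: Nm_intro => // i v hi; first by case: (h i v hi) => -[].
by case: (h i v hi).
Qed.

Lemma crel_Nm (G : ctx) (f : G -> nat -> Prop) (x : G -> nat) :
  cset f -> gr x -> crel (fun g => Nm (f g) (x g)).
Proof. by move=> hf hx; apply: (crel_app (cset_Nm hf)). Qed.

Ltac crel_atoms6 :=
  lazymatch goal with
  | |- @crel ?G (fun g => Nm (@?f g) (@?x g)) => apply (@crel_Nm G f x)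
  | |- _ => crel_atoms5
  end.
Ltac crel_user ::= crel_atoms6; cbn beta.

Lemma crel_lv (G : ctx) (f : G -> nat -> Prop) (c w : G -> nat) :
  cset f -> gr c -> gr w -> crel (fun g => lv (f g) (c g) (w g)).
Proof. by move=> hf hc hw; rewrite /lv; ctac. Qed.

Ltac crel_atoms7 :=
  lazymatch goal with
  | |- @crel ?G (fun g => lv (@?f g) (@?x g) (@?y g)) => apply (@crel_lv G f x y)
  | |- _ => crel_atoms6
  end.
Ltac crel_user ::= crel_atoms7; cbn beta.

Lemma crel_memat (G : ctx) (f : G -> nat -> Prop) (c w u : G -> nat) :
  cset f -> gr c -> gr w -> gr u -> crel (fun g => memat (f g) (c g) (w g) (u g)).
Proof. by move=> hf hc hw hu; rewrite /memat /req01; ctac. Qed.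

Ltac crel_atoms8 :=
  lazymatch goal with
  | |- @crel ?G (fun g => memat (@?f g) (@?x g) (@?y g) (@?z g)) =>
      apply (@crel_memat G f x y z)
  | |- _ => crel_atoms7
  end.
Ltac crel_user ::= crel_atoms8; cbn beta.

Lemma crel_Qf (G : ctx) (f : G -> nat -> Prop) (u v : G -> nat) :
  cset f -> gr u -> gr v -> crel (fun g => Qf (f g) (u g) (v g)).
Proof. by move=> hf hu hv; rewrite /Qf; ctac. Qed.

Ltac crel_atoms9 :=
  lazymatch goal with
  | |- @crel ?G (fun g => Qf (@?f g) (@?x g) (@?y g)) => apply (@crel_Qf G f x y)
  | |- _ => crel_atoms8
  end.
Ltac crel_user ::= crel_atoms9; cbn beta.

Lemma crel_Ef (G : ctx) (f : G -> nat -> Prop) (u v : G -> nat) :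
  cset f -> gr u -> gr v -> crel (fun g => Ef (f g) (u g) (v g)).
Proof. by move=> hf hu hv; rewrite /Ef; ctac. Qed.

Ltac crel_atoms10 :=
  lazymatch goal with
  | |- @crel ?G (fun g => Ef (@?f g) (@?x g) (@?y g)) => apply (@crel_Ef G f x y)
  | |- _ => crel_atoms9
  end.
Ltac crel_user ::= crel_atoms10; cbn beta.

Lemma Tr_cns f phi e : Tr f (cns phi e) <-> tsat f (rdec phi) e.
Proof. by split=> [[phi' [e' [/cns_inj[-> ->]]]]|h] //; exists phi, e. Qed.

(** Recursion on the code of the formula. The environment grows under quantifiers, hence [fstlt],
    which ignores it. *)
Lemma cset_Tr (G : ctx) (f : G -> nat -> Prop) : cset f -> cset (fun g => Tr (f g)).
Proof.
move=> hf.
pose H g : op := fun X s => exists phi e, s = cns phi e /\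
  ((exists i j u v, phi = code [:: 0; i; j] /\ Nth e i u /\ Nth e j v /\ Ef (f g) u v) \/
   (exists i j u v, phi = code [:: 1; i; j] /\ Nth e i u /\ Nth e j v /\ Qf (f g) u v) \/
   (exists p, phi = code [:: 2; p] /\ ~ X (cns p e)) \/
   (exists p q, phi = code [:: 3; p; q] /\ X (cns p e) /\ X (cns q e)) \/
   (exists p, phi = code [:: 4; p] /\ forall u, Nm (f g) u -> X (cns p (cns u e)))).
apply: (@cset_rec fstlt G H); [exact: fstlt_wf | exact: crel_fstlt | | ].
  by move=> D pi Y n wpi hY hn; have hf' := wpi _ hf; rewrite /H; ctac.
move=> g s.
have XE phi e p e' : p \in decode phi ->
    (fstlt (cns p e') (cns phi e) /\ Tr (f g) (cns p e')) = tsat (f g) (rdec p) e'.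
  move=> /mem_decode lt; apply: propext; rewrite Tr_cns; split=> [[]|] // h; split=> //.
  by exists phi, e, p, e'.
rewrite /H; split.
  case=> phi [e [-> h]]; exists phi, e; split=> //.
  move: h; rewrite rdecE /rstep; have ephi := CodeSeq.decodeK phi.
  have XE' := XE phi e.
  case: (decode phi) ephi XE' => [|[|[|[|[|[|a]]]]] [|p [|q [|b r]]]] // <- XE' /=.
  - by case=> u [v h]; left; exists p, q, u, v.
  - by case=> u [v h]; right; left; exists p, q, u, v.
  - by move=> h; do 2 right; left; exists p; rewrite XE' // !inE eqxx orbT.
  - move=> h; do 3 right; left; exists p, q; split=> //.
    by rewrite !XE' // !inE eqxx ?orbT.
  - move=> h; do 4 right; exists p; split=> // u hu.
    by rewrite XE' ?inE ?eqxx ?orbT //; apply: h.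
case=> phi [e [-> h]]; rewrite Tr_cns rdecE /rstep; move: h.
case=> [[i [j [u [v [-> h]]]]]|[[i [j [u [v [-> h]]]]]|[[p [-> h]]|[[p [q [-> h]]]|[p [-> h]]]]]].
- by rewrite CodeSeq.codeK; exists u, v.
- by rewrite CodeSeq.codeK; exists u, v.
- by move: h; rewrite CodeSeq.codeK XE // CodeSeq.codeK !inE eqxx orbT.
- by move: h; rewrite CodeSeq.codeK !XE // CodeSeq.codeK !inE eqxx ?orbT.
- rewrite CodeSeq.codeK => u /h; rewrite XE // CodeSeq.codeK !inE eqxx orbT.
  by [].
Qed.

Lemma crel_Tr (G : ctx) (f : G -> nat -> Prop) (x : G -> nat) :
  cset f -> gr x -> crel (fun g => Tr (f g) (x g)).
Proof. by move=> hf hx; apply: (crel_app (cset_Tr hf)). Qed.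

Section Operator.
Variable a : baire.
Hypothesis ca : computable a.

Lemma crel_code_le (G : ctx) (x y : G -> nat) :
  gr x -> gr y -> crel (fun g => code_le a (x g) (y g)).
Proof.
move=> hx hy; have : crel (fun g => a (code [:: x g; y g]) = 1).
  by apply: (computable_graph ca (x := fun g => code [:: x g; y g]) (y := fun=> 1)); ctac.
by apply: crel_ext => g; split=> /eqP.
Qed.

Ltac crel_atoms11 :=
  lazymatch goal with
  | |- @crel ?G (fun g => Tr (@?f g) (@?x g)) => apply (@crel_Tr G f x)
  | |- @crel ?G (fun g => is_true (code_le a (@?x g) (@?y g))) => apply (@crel_code_le G x y)
  | |- _ => crel_atoms10
  end.
Ltac crel_user ::= crel_atoms11; cbn beta.

Lemma crel_cand (G : ctx) (f : G -> nat -> Prop) (w : G -> nat) :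
  cset f -> gr w -> crel (fun g => cand a (f g) (w g)).
Proof. by move=> hf hw; rewrite /cand /glt /code_dom; ctac. Qed.

Ltac crel_atoms12 :=
  lazymatch goal with
  | |- @crel ?G (fun g => cand a (@?f g) (@?x g)) => apply (@crel_cand G f x)
  | |- _ => crel_atoms11
  end.
Ltac crel_user ::= crel_atoms12; cbn beta.

Lemma cset_grow (G : ctx) : cset (fun _ : G => Ifix (grow (next a) Tr)).
Proof.
apply: cset_Ifix => D pi Y n wpi hY hn; rewrite /grow /next; ctac.
Qed.

End Operator.

Definition ctx0 : ctx := @Ctx unit (fun=> [::]) (fun=> [::]).

Lemma crel_computable (P : nat -> Prop) :
  crel (G := xn ctx0) (fun g => P g.2) -> computable (fun n => nat_of_bool `[< P n >]).
Proof. by case=> p hp; exists (ev p 0 1) => n; apply: (hp (tt, n) [::] [::]). Qed.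

(** * The closure ordinal of the operator *)

Section Final.
Variables (a : baire) (alpha : V) (rka : nat -> V).
Hypothesis ca : computable a.
Hypothesis oa : is_ord alpha.
Hypothesis rk_mem : forall x, code_dom a x -> memV (rka x) alpha.
Hypothesis rk_onto :
  forall b, memV b alpha -> exists2 x, code_dom a x & eqV (rka x) b.
Hypothesis rk_le : forall x y, code_dom a x -> code_dom a y ->
  code_le a x y <-> memV (rka x) (rka y) \/ eqV (rka x) (rka y).

Local Notation N := (next a).
Local Notation H := (grow N Tr).
Local Notation st := (stg H).
Local Notation gam := (clord H).

Let Nfun : forall f w w', N f w -> N f w' -> w = w' := @next_fun a.
Let Nnew : forall f w, N f w -> ~ Af f w := @next_new a.

Lemma glt_rk x y : code_dom a x -> code_dom a y -> glt a y x <-> memV (rka y) (rka x).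
Proof.
move=> dx dy; rewrite /glt (rk_le dy dx) (rk_le dx dy); have ox := is_ord_mem oa (rk_mem dx).
split=> [[[//|e] []]|h]; first by right; apply: eqV_sym.
split; first by left.
case=> h'; first exact: ord_asym ox h h'.
by apply: (@memV_irr (rka y)); apply: memV_eqR h h'.
Qed.

(** A new candidate would let the induction go on beyond its closing stage. *)
Lemma gam_cand w : cand a (st gam) w -> Af (st gam) w.
Proof.
move=> cw; apply: contrapT => nw; have [v Nv] := next_ex cw nw.
exact: (N_end (T := Tr) Nnew Nv).
Qed.

Lemma gam_base x : code_dom a x -> Af (st gam) (code [:: x]).
Proof.
suff h b : forall x, code_dom a x -> eqV (rka x) b -> Af (st gam) (code [:: x]).
  by move=> dx; apply: (h (rka x)) => //; apply: eqV_refl.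
elim/memV_ind: b => b IH {}x dx xb; apply: gam_cand; left; exists x; split=> //; split=> //.
move=> y dy /(glt_rk dx dy) yx; apply: (IH (rka y)) => //; last exact: eqV_refl.
exact: memV_eqR yx xb.
Qed.

(** The element 0 becomes a candidate only once the whole coded order is present, so that order is
    complete at a stage strictly before the end. This yields the strict inequality in
    [alpha_gam]. *)
Lemma gam_start : exists2 d, memV d gam & forall x, code_dom a x -> Af (st d) (code [:: x]).
Proof.
have og := clord_ord H.
have /(st_A N Tr _ og)[d dg [[_ h] _]] : Af (st gam) 0.
  by apply: gam_cand; right; split; [apply: gam_base | left].
exists d => //; case: h => [[x [_ [/(can_inj CodeSeq.codeK (x1 := [::]))]]]|[]] //.
Qed.

(** An element of the coded order enters only after its predecessors, hence at a stage not below its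
    rank. *)
Lemma base_rank b x e : code_dom a x -> eqV (rka x) b -> is_ord e -> N (st e) (code [:: x]) ->
  forall z, memV z (rka x) -> memV z e.
Proof.
elim/memV_ind: b x e => b IH x e dx xb oe [[_ h] _] z zx.
have za : memV z alpha by apply: ord_trans zx => //; apply: rk_mem.
have [y dy yz] := rk_onto za.
have yx := memV_eqL yz zx; have oy := is_ord_mem oa (rk_mem dy).
have {h} : Af (st e) (code [:: y]).
  case: h => [[x' [_ [/(can_inj CodeSeq.codeK)[<-] h]]]|[_ [|]]].
  - by apply: h => //; apply/glt_rk.
  - by move/(can_inj CodeSeq.codeK (x2 := [::])).
  - by case=> phi [e' [/(can_inj CodeSeq.codeK)]].
case/(st_A N Tr _ oe) => e' e'e Ny; have oe' := is_ord_mem oe e'e.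
have sub := IH (rka y) (memV_eqR yx xb) y e' dy (eqV_refl _) oe' Ny.
apply: memV_eqL (eqV_sym yz) _.
case: (ord_trichotomy oy oe') => [h|h|/sub/memV_irr//]; first exact: ord_trans e'e h.
exact: memV_eqL h e'e.
Qed.

Lemma alpha_gam : memV alpha gam.
Proof.
have og := clord_ord H; have [d dg hd] := gam_start; have od := is_ord_mem og dg.
have sub z : memV z alpha -> memV z d.
  move=> /rk_onto[x dx xz]; have := hd x dx; case/(st_A N Tr _ od) => e ed Nx.
  have oe := is_ord_mem od ed; have ox := is_ord_mem oa (rk_mem dx).
  have se := base_rank dx (eqV_refl _) oe Nx.
  apply: memV_eqL (eqV_sym xz) _.
  case: (ord_trichotomy ox oe) => [h|h|/se/memV_irr//]; first exact: ord_trans ed h.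
  exact: memV_eqL h ed.
case: (ord_trichotomy oa og) => // h; last by case: (ord_asym og dg (sub _ h)).
by case: (@memV_irr d); apply: sub; apply: memV_eqR dg (eqV_sym h).
Qed.

Lemma gam_reflecting : reflecting gam.
Proof.
have og := clord_ord H; split=> // n phi X hX hs.
have ig := initial_gam N Tr.
have [U hU] : exists U : 'I_n -> nat, forall i, NM N gam (U i) /\ eqV (X i) (val N (U i)).
  have h i : exists u, NM N gam u /\ eqV (X i) (val N u).
    by have [u h1 h2] := L_name Nnew ig (hX i); exists u.
  by exists (fun i => projT1 (cid (h i))) => i; case: cid.
pose e := code [seq U i | i <- enum 'I_n].
have satE d : (sat (L d) phi X <-> rsat (L d) (form_rf phi) [seq val N v | v <- decode e]).
  rewrite sat_rsat /e CodeSeq.codeK -map_comp.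
  apply: rsat_eq => [||i]; [exact: eqV_refl | by rewrite size_fenv size_map size_enum_ord | ].
  rewrite size_fenv => hi; rewrite (nth_fenv _ _ (Ordinal hi)).
  by rewrite (nth_fenv (fun i => val N (U i)) _ (Ordinal hi)); case: (hU (Ordinal hi)).
have names v : v \in decode e -> NM N gam v.
  by rewrite /e CodeSeq.codeK => /mapP[i _ ->]; case: (hU i).
have /(st_A N Tr _ og)[d dg [[_ h] _]] : Af (st gam) (code [:: renc (form_rf phi); e]).
  apply: gam_cand; right; split; first exact: gam_base.
  right; exists (renc (form_rf phi)), e; split=> //; split.
    by move=> i v hi; apply/NmP => //; apply: names; apply/Nth_mem; exists i.
  by rewrite Tr_cns rencK (truth Nfun Nnew ig) // -satE.
have id_ := initial_mem ig dg; have od := proj1 id_.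
(* The other candidates code lists of length 1 or, as 0 is [code [::]], of length 0. *)
case: h => [[x [_ [/(can_inj CodeSeq.codeK)]]]|[_ [|]]] //.
  by move/(can_inj CodeSeq.codeK (x2 := [::])).
case=> phi' [e' [/(can_inj CodeSeq.codeK)[<- <-] [hnm]]].
(* Candidates must have parameters named at the current stage; this puts the X i into L_d. *)
have names' v : v \in decode e -> NM N d v.
  by move=> /Nth_mem[i /hnm /NmP]; apply.
rewrite Tr_cns rencK (truth Nfun Nnew id_) // -satE => hd.
exists d; split=> // i; have [_ XU] := hU i; apply: memV_eqL XU _.
apply: val_L => //; apply: names'; rewrite /e CodeSeq.codeK.
by apply/mapP; exists i; rewrite // mem_enum.
Qed.

Lemma gam_codes d : is_ord d -> memV d gam \/ eqV d gam -> has_computable_code d.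
Proof.
have og := clord_ord H; have ig := initial_gam N Tr => od [dg|dg]; last first.
  have id_ : initial N Tr d by split=> // e ed; apply: memV_eqR ed dg.
  exists (fun n => nat_of_bool `[< st gam n >]).
    by apply: crel_computable; have := cset_grow ca ctx0.
  apply: (codes_st Nfun Nnew id_) => x y; rewrite /code_le (stg_eq H dg).
  by split=> [|h]; [case: asboolP | rewrite asboolT].
have id_ := initial_mem ig dg; have [w Nw] := N_ex dg.
(* The element w chosen at stage d cuts the order: what lies strictly below w was chosen before d.
   As w is a fixed number, the segment is computable from the whole order. *)
pose P n := exists x y, n = code [:: x; y] /\ st gam (code [:: x; y]) /\
  st gam (code [:: y; w]) /\ y <> w.
exists (fun n => nat_of_bool `[< P n >]).
  apply: crel_computable; have hg : cset (fun _ : ctx0 => st gam) := cset_grow ca ctx0.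
  by rewrite /P; ctac.
apply: (codes_st Nfun Nnew id_) => x y.
have -> : code_le (fun n => nat_of_bool `[< P n >]) x y <-> P (code [:: x; y]).
  by rewrite /code_le; split=> [|h]; [case: asboolP | rewrite asboolT].
have ltE := ltf_st Nnew y og dg Nw; rewrite (st_le N Tr) //; split.
  case=> x' [y' [/(can_inj CodeSeq.codeK)[<- <-] [h1 h2]]].
  have [e ed Ne] := proj1 ltE h2; exists e => //; split=> //.
  move: h1 => /(st_le N Tr _ _ og)[e1 e1g [Ne1]].
  have e1e := N_inj Nnew (is_ord_mem og e1g) (is_ord_mem od ed) Ne1 Ne.
  by rewrite (stg_eq H e1e).
case=> e ed [Ne h]; exists x, y; split=> //; split; last by apply/ltE; exists e.
by apply/st_le => //; exists e => //; apply: ord_trans dg ed.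
Qed.

End Final.

Theorem corollary3p12 (pi : V) (hpi : closure_ordinal pi)
    (alpha : V) (halpha : memV alpha pi) :
  exists gamma : V,
    [/\ reflecting gamma, memV alpha gamma & memV gamma pi].
Proof.
have [opi npi pi_min] := hpi; have oa := is_ord_mem opi halpha.
have [a ca [_ _ [rka [rk_mem rk_onto rk_le]]]] : has_computable_code alpha.
  apply: contrapT => na; case: (pi_min _ oa na) => h.
    by apply: (@memV_irr pi); apply: memV_eqL h halpha.
  exact: ord_asym opi halpha h.
have og := clord_ord (grow (next a) Tr).
exists (clord (grow (next a) Tr)); split.
- exact: gam_reflecting oa rk_mem rk_le.
- exact: alpha_gam oa rk_mem rk_onto rk_le.
(* Otherwise pi would be at most the closure ordinal of the operator and so have a computable
   code. *)
- case: (ord_trichotomy og opi) => // h; case: npi; apply: (gam_codes ca opi).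
    by right; apply: eqV_sym.
  by left.
Qed.
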